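(* Up to isomorphism, there are exactly $12$ seven-dimensional real nilpotent Lie algebras admitting a calibrated $\mathrm{G}_2$-structure, namely: $(0,0,0,0,0,0,0)$, $(0,0,0,0,12,13,0)$, $(0,0,0,12,13,23,0)$, $(0,0,12,0,13+24,14,46+34+15+23)$, $(0,0,12,0,13,24+23,25+34+16+15-3\cdot26)$, $(0,0,0,12,23,-13,2\cdot26-2\cdot34-2\cdot16+2\cdot25)$, $(0,0,12,0,0,13+24,15)$, $(0,0,12,0,0,13,14+25)$, $(0,0,0,12,13,14,15)$, $(0,0,0,12,13,14+23,15)$, $(0,0,12,13,23,15+24,16+34)$, $(0,0,12,13,23,15+24,16+25+34)$.
   Context: Notation: $(a_1,\dots,a_7)$ denotes the Lie algebra having a basis $e^1,\dots,e^7$ of its dual with $de^i=a_i$, where e.g. ''$13+24$'' stands for $e^1\wedge e^3+e^2\wedge e^4$ and ''$2\cdot26$'' for $2e^2\wedge e^6$; $d$ is the Chevalley–Eilenberg differential. A $3$-form $\varphi\in\Lambda^3\mathfrak g^*$ defines a $\mathrm{G}_2$-structure if there is a basis $f^1,\dots,f^7$ of $\mathfrak g^*$ with $\varphi=f^{127}+f^{347}+f^{567}+f^{135}-f^{236}-f^{146}-f^{245}$; the $\mathrm{G}_2$-structure is calibrated if $d\varphi=0$. *)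

(* Defs.v *)
From HB Require Import structures.
From mathcomp Require Import all_boot all_order all_algebra.
Set Implicit Arguments. Unset Strict Implicit. Unset Printing Implicit Defensive.
Import Order.TTheory GRing.Theory Num.Theory.
Local Open Scope ring_scope.

(* A 7-dimensional Lie algebra on R^7 (row vectors, standard basis e_1..e_7,
   0-indexed as 'I_7) given by structure constants:
   [e_i, e_j] = \sum_k c i j k e_k. *)
Definition sconst (R : Type) := 'I_7 -> 'I_7 -> 'I_7 -> R.

Definition br (R : comUnitRingType) (c : sconst R) (x y : 'rV[R]_7) : 'rV[R]_7 :=
  \row_k \sum_(i < 7) \sum_(j < 7) x 0 i * y 0 j * c i j k.

Definition is_lie (R : comUnitRingType) (c : sconst R) : Prop :=
  (forall i j k, c i j k = - c j i k) /\ (forall i k, c i i k = 0) /\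
  (forall x y z : 'rV[R]_7,
      br c x (br c y z) + br c y (br c z x) + br c z (br c x y) = 0).

(* nilpotent: some term g^{n+1} of the lower central series vanishes, i.e.
   all iterated brackets [x_1,[x_2,...,[x_n,y]...]] vanish. *)
Definition lie_nilpotent (R : comUnitRingType) (c : sconst R) : Prop :=
  exists n : nat, forall (xs : seq 'rV[R]_7) (y : 'rV[R]_7),
    size xs = n -> foldr (br c) y xs = 0.

Definition lie_iso (R : comUnitRingType) (c1 c2 : sconst R) : Prop :=
  exists A : 'M[R]_7, A \in unitmx /\
    forall x y : 'rV[R]_7, br c2 (x *m A) (y *m A) = br c1 x y *m A.

(* 3-forms on g, given by their values phi i j k = phi(e_i,e_j,e_k). *)
Definition form3 (R : Type) := 'I_7 -> 'I_7 -> 'I_7 -> R.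

Definition cf (R : comUnitRingType) (u : 'rV[R]_7) (a : nat) : R := u 0 (@inord 6 a.-1).

(* (f^a /\ f^b /\ f^c)(u,v,w), where f^a(u) = cf u a *)
Definition ev3 (R : comUnitRingType) (a b c : nat) (u v w : 'rV[R]_7) : R :=
  cf u a * (cf v b * cf w c - cf v c * cf w b)
  - cf u b * (cf v a * cf w c - cf v c * cf w a)
  + cf u c * (cf v a * cf w b - cf v b * cf w a).

Definition phi0 (R : comUnitRingType) (u v w : 'rV[R]_7) : R :=
  ev3 1 2 7 u v w + ev3 3 4 7 u v w + ev3 5 6 7 u v w + ev3 1 3 5 u v w
  - ev3 2 3 6 u v w - ev3 1 4 6 u v w - ev3 2 4 5 u v w.

(* phi defines a G2-structure: there is a basis f^1..f^7 of g^* (f^a(e_i) = P i a,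
   P invertible) with phi = f^127 + ... - f^245. *)
Definition is_G2 (R : comUnitRingType) (phi : form3 R) : Prop :=
  exists P : 'M[R]_7, P \in unitmx /\
    forall i j k, phi i j k = phi0 (row i P) (row j P) (row k P).

(* Chevalley-Eilenberg differential of a 3-form:
   dphi(X0,X1,X2,X3) = sum_{i<j} (-1)^(i+j) phi([Xi,Xj], ...). *)
Definition brphi (R : comUnitRingType) (c : sconst R) (phi : form3 R)
  (a b e f : 'I_7) : R := \sum_(m < 7) c a b m * phi m e f.

Definition d3 (R : comUnitRingType) (c : sconst R) (phi : form3 R)
  (a b e f : 'I_7) : R :=
  - brphi c phi a b e f + brphi c phi a e b f - brphi c phi a f b e
  - brphi c phi b e a f + brphi c phi b f a e - brphi c phi e f a b.

Definition calibrated_G2 (R : comUnitRingType) (c : sconst R) : Prop :=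
  exists phi : form3 R, is_G2 phi /\ forall a b e f, d3 c phi a b e f = 0.

(* Lie algebras given in the notation (de^1, ..., de^7): each de^k is a list
   of terms (coef, p, q) standing for coef * e^p /\ e^q (1-based indices).
   Convention dalpha(X,Y) = - alpha([X,Y]), so c i j k = - de^k(e_i, e_j). *)
Definition tm (a : int) (p q : nat) : int * nat * nat := (a, p, q).

Definition sc_of (R : comUnitRingType) (d : seq (seq (int * nat * nat))) : sconst R :=
  fun i j k => - \sum_(t <- nth [::] d k)
     (t.1.1)%:~R * ((((t.1.2 == i.+1) && (t.2 == j.+1)) : nat)%:R
                   - (((t.1.2 == j.+1) && (t.2 == i.+1)) : nat)%:R).

Definition nil12 : seq (seq (seq (int * nat * nat))) :=
 [::
     [:: [::]; [::]; [::]; [::]; [::]; [::]; [::]];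
     [:: [::]; [::]; [::]; [::]; [:: tm 1 1 2]; [:: tm 1 1 3]; [::]];
     [:: [::]; [::]; [::]; [:: tm 1 1 2]; [:: tm 1 1 3]; [:: tm 1 2 3]; [::]];
     [:: [::]; [::]; [:: tm 1 1 2]; [::]; [:: tm 1 1 3; tm 1 2 4]; [:: tm 1 1 4];
         [:: tm 1 4 6; tm 1 3 4; tm 1 1 5; tm 1 2 3]];
     [:: [::]; [::]; [:: tm 1 1 2]; [::]; [:: tm 1 1 3]; [:: tm 1 2 4; tm 1 2 3];
         [:: tm 1 2 5; tm 1 3 4; tm 1 1 6; tm 1 1 5; tm (-3) 2 6]];
     [:: [::]; [::]; [::]; [:: tm 1 1 2]; [:: tm 1 2 3]; [:: tm (-1) 1 3];
         [:: tm 2 2 6; tm (-2) 3 4; tm (-2) 1 6; tm 2 2 5]];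
     [:: [::]; [::]; [:: tm 1 1 2]; [::]; [::]; [:: tm 1 1 3; tm 1 2 4]; [:: tm 1 1 5]];
     [:: [::]; [::]; [:: tm 1 1 2]; [::]; [::]; [:: tm 1 1 3]; [:: tm 1 1 4; tm 1 2 5]];
     [:: [::]; [::]; [::]; [:: tm 1 1 2]; [:: tm 1 1 3]; [:: tm 1 1 4]; [:: tm 1 1 5]];
     [:: [::]; [::]; [::]; [:: tm 1 1 2]; [:: tm 1 1 3]; [:: tm 1 1 4; tm 1 2 3];
         [:: tm 1 1 5]];
     [:: [::]; [::]; [:: tm 1 1 2]; [:: tm 1 1 3]; [:: tm 1 2 3];
         [:: tm 1 1 5; tm 1 2 4]; [:: tm 1 1 6; tm 1 3 4]];
     [:: [::]; [::]; [:: tm 1 1 2]; [:: tm 1 1 3]; [:: tm 1 2 3];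
         [:: tm 1 1 5; tm 1 2 4]; [:: tm 1 1 6; tm 1 2 5; tm 1 3 4]]
 ].

Definition L12 (R : comUnitRingType) (n : nat) : sconst R := sc_of R (nth [::] nil12 n).

(* Main.v *)
Require Import Defs.
From HB Require Import structures.
From mathcomp Require Import all_boot all_order all_algebra.
From mathcomp Require Import ring lra.
From Stdlib Require Import Classical.
Set Implicit Arguments. Unset Strict Implicit. Unset Printing Implicit Defensive.
Import Order.TTheory GRing.Theory Num.Theory.
Local Open Scope ring_scope.

(* A nilpotent Lie algebra has a central vector X and a vector Y with [Y, g]
   in R X. As G2 acts transitively on orthonormal pairs, the calibrated form can
   be written in a coframe (w, x0, x1, x2, x3, y, eta) in which X = e_7, Y = e_6
   and e_2, dual to x0, is central modulo X and Y. Closedness then expresses dy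
   and d eta through the other differentials and four parameters, so that only
   the Jacobi identity remains to be solved. If Y can be chosen with [Y, v] = l
   phi(X, Y, v) X, the solutions are the algebras number 1-4 and 6-10 of the
   list; otherwise dx0 is a nondegenerate Heisenberg term and a pencil of 2-forms
   yields number 5, 11 and 12, the remaining solutions having an eigenvector Y
   after all. The twelve algebras are told apart by the dimensions of [g, g] and
   [g, [g, g]] together with a few centralizer conditions. *)

(** * Lie brackets in coordinates *)

(** Contracting the closed form with the central X gives a closed 2-form, w y + om1, and contracting
    once more with Y shows that w is closed. So everything is governed by ker w modulo X and Y and
    by D = ad e_1 on it; in the simplest case the Jacobi identity says that D^2 annihilates om1 and
    om2. The obstacle is that the adapted frame is far from unique, so that a plain elimination
    would meet all its choices. Two devices prevent this. The eigenplane condition is stated without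
    a frame: where it is assumed to fail, a degenerate branch is closed by exhibiting any other Y.
    And e_2 is placed at the top of a chain of D, or in the derived algebra of ker w modulo X and Y,
    which supplies the nonvanishing conditions that the quadratic equations alone do not give. The
    equations that have to be solved over the reals come down to sums of squares and to forms a^2 -
    a b + b^2; roots are needed for unit quaternions, for the eigenvalues of a 2 by 2 matrix, and
    once for a cubic. Of the group G2 only three copies of Sp(1) are used, acting by quaternion
    multiplication. *)

Section Coordinates.
Variable R : comUnitRingType.
Implicit Types (x y z u v : 'rV[R]_7) (c : sconst R).

Definition vec (f : nat -> R) : 'rV[R]_7 := \row_i f i.+1.

Lemma cf_vec f (k : nat) : (0 < k < 8)%N -> cf (vec f) k = f k.
Proof. by case: k => // k /andP[_ hk]; rewrite /cf mxE /= inordK. Qed.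

Lemma cf_row x (i : 'I_7) : x 0 i = cf x i.+1.
Proof. by rewrite /cf /= inord_val. Qed.

Lemma cfP x y : (forall k, (0 < k < 8)%N -> cf x k = cf y k) -> x = y.
Proof. by move=> h; apply/rowP => i; rewrite !cf_row h //= ltnS. Qed.

Lemma cfD x y k : cf (x + y) k = cf x k + cf y k. Proof. by rewrite /cf mxE. Qed.
Lemma cfZ a x k : cf (a *: x) k = a * cf x k. Proof. by rewrite /cf mxE. Qed.
Lemma cfN x k : cf (- x) k = - cf x k. Proof. by rewrite /cf mxE. Qed.
Lemma cf0 k : cf (0 : 'rV[R]_7) k = 0. Proof. by rewrite /cf mxE. Qed.
Definition cfE := (cfD, cfZ, cfN, cf0).

Lemma brDl c x y z : br c (x + y) z = br c x z + br c y z.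
Proof.
apply/rowP => k; rewrite !mxE -big_split; apply: eq_bigr => i _ /=.
by rewrite -big_split; apply: eq_bigr => j _ /=; rewrite !mxE !mulrDl.
Qed.
Lemma brDr c x y z : br c x (y + z) = br c x y + br c x z.
Proof.
apply/rowP => k; rewrite !mxE -big_split; apply: eq_bigr => i _ /=.
by rewrite -big_split; apply: eq_bigr => j _ /=; rewrite !mxE mulrDr !mulrDl.
Qed.
Lemma brZl c a x y : br c (a *: x) y = a *: br c x y.
Proof.
apply/rowP => k; rewrite !mxE big_distrr; apply: eq_bigr => i _ /=.
by rewrite big_distrr; apply: eq_bigr => j _ /=; rewrite !mxE !mulrA.
Qed.
Lemma brZr c a x y : br c x (a *: y) = a *: br c x y.
Proof.
apply/rowP => k; rewrite !mxE big_distrr; apply: eq_bigr => i _ /=.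
rewrite big_distrr; apply: eq_bigr => j _ /=; rewrite !mxE; ring.
Qed.
Lemma br0r c x : br c x 0 = 0.
Proof. by have := brZr c 0 x 0; rewrite !scale0r. Qed.
Lemma brNl c x y : br c (- x) y = - br c x y.
Proof. by rewrite -scaleN1r brZl scaleN1r. Qed.
Lemma brNr c x y : br c x (- y) = - br c x y.
Proof. by rewrite -scaleN1r brZr scaleN1r. Qed.

Lemma br_delta c (i j : 'I_7) :
  br c (delta_mx 0 i) (delta_mx 0 j) = \row_k c i j k.
Proof.
apply/rowP => k; rewrite !mxE (bigD1 i) //= (bigD1 j) //= !mxE !eqxx !mul1r.
rewrite !big1 ?addr0 // => [p pi | p pj]; last first.
  by rewrite !mxE (negPf pj) !andbF mulr0 mul0r.
by rewrite big1 // => q _; rewrite !mxE (negPf pi) !mul0r.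
Qed.

(** Reduces a linear identity to basis vectors; applied to one argument after another it settles
    multilinear ones, such as the closedness of a 3-form. *)
Lemma linear_ext (V : lmodType R) (F : 'rV[R]_7 -> V) :
  (forall a u v, F (a *: u + v) = a *: F u + F v) ->
  (forall i, F (delta_mx 0 i) = 0) -> forall u, F u = 0.
Proof.
move=> hl hd u.
have h0 : F 0 = 0.
  have := hl 1 0 0; rewrite !scale1r !addr0 => /eqP.
  by rewrite -subr_eq0 opprD addNKr oppr_eq0 => /eqP.
rewrite (row_sum_delta u).
elim/big_rec: _ => // i w _ hw.
by rewrite hl hd hw scaler0 addr0.
Qed.

Lemma br_ext c1 c2 : (forall i j k, c1 i j k = c2 i j k) ->
  forall x y, br c1 x y = br c2 x y.
Proof.
by move=> h x y; apply/rowP => k; rewrite !mxE; apply: eq_bigr => i _;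
   apply: eq_bigr => j _; rewrite h.
Qed.

Lemma br_alt c : is_lie c -> forall x, br c x x = 0.
Proof.
move=> [ha [h0 _]] x; apply/rowP => k; rewrite !mxE.
have -> : \sum_(i < 7) \sum_(j < 7) x 0 i * x 0 j * c i j k =
   \sum_(i < 7) \sum_(j < 7 | (j < i)%N) x 0 i * x 0 j * c i j k +
   \sum_(i < 7) \sum_(j < 7 | (i < j)%N) x 0 i * x 0 j * c i j k.
  rewrite -big_split /=; apply: eq_bigr => i _.
  rewrite (bigID (fun j : 'I_7 => (j < i)%N)) /=; congr (_ + _).
  rewrite (bigID (fun j : 'I_7 => j == i)) /= [X in X + _]big1 ?add0r.
    by apply: eq_bigl => j; rewrite -leqNgt ltn_neqAle eq_sym andbC.
  by move=> j /andP[_ /eqP ->]; rewrite h0 mulr0.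
rewrite [X in _ + X](exchange_big_dep xpredT) //= -big_split /=.
apply: big1 => i _; rewrite -big_split /=; apply: big1 => j _.
rewrite (ha i j k); ring.
Qed.

Lemma br_anti c : is_lie c -> forall x y, br c x y = - br c y x.
Proof.
move=> hc x y; apply/eqP; rewrite -addr_eq0; apply/eqP.
have := br_alt hc (x + y); rewrite !(brDl, brDr) !(br_alt hc) add0r addr0.
by [].
Qed.

Lemma br_jacobi c : is_lie c -> forall x y z,
  br c x (br c y z) = br c (br c x y) z + br c y (br c x z).
Proof.
move=> hc x y z; have [_ [_ hj]] := hc.
have := hj x y z; rewrite (br_anti hc z x) brNr (br_anti hc z (br c x y)).
by rewrite -addrA -opprD => /eqP; rewrite subr_eq0 addrC => /eqP.
Qed.

Lemma is_lieP c : (forall x, br c x x = 0) ->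
  (forall x y z, br c x (br c y z) + br c y (br c z x) + br c z (br c x y) = 0) ->
  is_lie c.
Proof.
move=> ha hj; split; last split=> //.
  move=> i j k; apply/eqP; rewrite -addr_eq0; apply/eqP.
  have := ha (delta_mx 0 i + delta_mx 0 j).
  rewrite !(brDl, brDr) !ha add0r addr0 !br_delta => /rowP/(_ k).
  by rewrite !mxE.
by move=> i k; have := ha (delta_mx 0 i); rewrite br_delta => /rowP/(_ k); rewrite !mxE.
Qed.

End Coordinates.

(** * Isomorphisms and transport of structure *)

Section Iso.
Variable R : comUnitRingType.
Implicit Types (x y z u v : 'rV[R]_7) (c : sconst R).

Lemma lie_iso_sym c1 c2 : lie_iso c1 c2 -> lie_iso c2 c1.
Proof.
move=> [A [uA hA]]; exists (invmx A); rewrite unitmx_inv; split=> // x y.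
by rewrite -{2}(mulmxKV uA x) -{2}(mulmxKV uA y) hA mulmxK.
Qed.

Lemma lie_iso_trans c1 c2 c3 : lie_iso c1 c2 -> lie_iso c2 c3 -> lie_iso c1 c3.
Proof.
move=> [A [uA hA]] [B [uB hB]]; exists (A *m B); rewrite unitmx_mul uA uB.
by split=> // x y; rewrite !mulmxA hB hA.
Qed.

Lemma lie_iso_ext c1 c2 : (forall i j k, c1 i j k = c2 i j k) -> lie_iso c1 c2.
Proof.
move=> h; exists 1%:M; rewrite unitmx1; split=> // x y.
by rewrite !mulmx1 (br_ext h).
Qed.

Lemma is_lie_iso c1 c2 : lie_iso c1 c2 -> is_lie c1 -> is_lie c2.
Proof.
move=> /lie_iso_sym[A [uA hA]] hc.
have inj x : x *m A = 0 -> x = 0 by move=> h; rewrite -(mulmxK uA x) h mul0mx.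
apply: is_lieP => [x|x y z]; apply: inj; first by rewrite -hA br_alt.
by rewrite !mulmxDl -!hA; have [_ [_ hj]] := hc; apply: hj.
Qed.

Lemma foldr_br_iso c1 c2 (A : 'M[R]_7) :
  (forall x y, br c2 (x *m A) (y *m A) = br c1 x y *m A) ->
  forall xs y, foldr (br c2) (y *m A) (map (mulmx^~ A) xs) = foldr (br c1) y xs *m A.
Proof. by move=> hA xs y; elim: xs => //= x xs ->; rewrite hA. Qed.

Lemma nilpotent_iso c1 c2 : lie_iso c1 c2 -> lie_nilpotent c1 -> lie_nilpotent c2.
Proof.
move=> /lie_iso_sym[A [uA hA]] [n hn]; exists n => xs y sz.
rewrite -(mulmxK uA (foldr _ _ _)) -(foldr_br_iso hA) hn ?mul0mx //.
by rewrite size_map.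
Qed.

(* The structure constants of [c] in the basis given by the rows of [invmx A]. *)
Definition transport c (A : 'M[R]_7) : sconst R := fun i j k =>
  (br c (delta_mx 0 i *m invmx A) (delta_mx 0 j *m invmx A) *m A) 0 k.

Lemma br_transport c A : forall x y,
  br (transport c A) x y = br c (x *m invmx A) (y *m invmx A) *m A.
Proof.
move=> x y; apply/eqP; rewrite -subr_eq0; apply/eqP; move: x.
apply: linear_ext => [a u v|i].
  rewrite !(brDl, brZl, mulmxDl) -!scalemxAl !brZl -!scalemxAl scalerBr.
  by rewrite opprD addrACA.
move: y; apply: linear_ext => [a u v|j].
  rewrite !(brDr, brZr, mulmxDl) -!scalemxAl !brZr -!scalemxAl scalerBr.
  by rewrite opprD addrACA.
by apply/eqP; rewrite subr_eq0; apply/eqP/rowP => k; rewrite br_delta mxE.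
Qed.

Lemma transport_iso c A : A \in unitmx -> lie_iso c (transport c A).
Proof. by move=> uA; exists A; split=> // x y; rewrite br_transport !mulmxK. Qed.

End Iso.

Notation trm a p q := (a%R, p%N, q%N) (only parsing).
Notation trm1 a p := (a%R, p%N) (only parsing).

(** * Structure equations as lists of monomials *)

Section Coframes.
Variable R : comUnitRingType.
Implicit Types (x y z : nat -> R) (u v : 'rV[R]_7) (d : seq (seq (R * nat * nat))).

(** Forms are lists of monomials evaluated on coordinate functions indexed from 1. On a concrete
    list simplification unfolds the evaluation into a polynomial, so that an identity between forms
    becomes a goal for [ring]. *)
Definition ev1 (l : seq (R * nat)) x : R := foldr (fun t s => t.1 * x t.2 + s) 0 l.

Definition ev2 (l : seq (R * nat * nat)) x y : R :=
  foldr (fun t s => t.1.1 * (x t.1.2 * y t.2 - x t.2 * y t.1.2) + s) 0 l.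

Definition lc d : sconst R := fun i j k =>
  - ev2 (nth [::] d k) (fun n => (n == i.+1)%:R) (fun n => (n == j.+1)%:R).

Definition wfi (n : nat) := (0 < n < 8)%N.
Definition wf2 (l : seq (R * nat * nat)) := all (fun t => wfi t.1.2 && wfi t.2) l.
Definition wf1 (l : seq (R * nat)) := all (fun t => wfi t.2) l.

Lemma ev1_ext l x x' : wf1 l -> (forall n, wfi n -> x n = x' n) -> ev1 l x = ev1 l x'.
Proof. by move=> hl hx; elim: l hl => //= t l IH /andP[h1 /IH ->]; rewrite hx. Qed.

Lemma ev2_ext l x y x' y' : wf2 l -> (forall n, wfi n -> x n = x' n) ->
  (forall n, wfi n -> y n = y' n) -> ev2 l x y = ev2 l x' y'.
Proof.
move=> hl hx hy; elim: l hl => //= t l IH /andP[/andP[h1 h2] /IH ->].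
by rewrite !hx ?hy.
Qed.

Lemma ev1_lin l a u v :
  ev1 l (cf (a *: u + v)) = a * ev1 l (cf u) + ev1 l (cf v).
Proof. by elim: l => /= [|t l ->]; rewrite ?mulr0 ?addr0 // !cfE; ring. Qed.

Lemma ev2_linl l a u v (y : nat -> R) :
  ev2 l (cf (a *: u + v)) y = a * ev2 l (cf u) y + ev2 l (cf v) y.
Proof. by elim: l => /= [|t l ->]; rewrite ?mulr0 ?addr0 // !cfE; ring. Qed.

Lemma ev2_linr l a u v (x : nat -> R) :
  ev2 l x (cf (a *: u + v)) = a * ev2 l x (cf u) + ev2 l x (cf v).
Proof. by elim: l => /= [|t l ->]; rewrite ?mulr0 ?addr0 // !cfE; ring. Qed.

Lemma cf_delta (i : 'I_7) n : wfi n -> cf (delta_mx 0 i : 'rV[R]_7) n = (n == i.+1)%:R.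
Proof.
case: n => // n /andP[_ hn]; rewrite /cf mxE eqxx /= eqSS.
by rewrite -val_eqE /= inordK.
Qed.

Lemma br_lc d u v (k : 'I_7) : all wf2 d ->
  br (lc d) u v 0 k = - ev2 (nth [::] d k) (cf u) (cf v).
Proof.
move=> /all_nthP-/(_ [::]) wd; apply/eqP; rewrite -subr_eq0 opprK; apply/eqP.
have wk : wf2 (nth [::] d k).
  by case: (ltnP k (size d)) => h; [exact: wd | rewrite nth_default].
move: u; apply: (@linear_ext _ R^o) => [a u w|i].
  by rewrite brDl brZl !mxE ev2_linl /GRing.scale /=; ring.
move: v; apply: (@linear_ext _ R^o) => [a u w|j].
  by rewrite brDr brZr !mxE ev2_linr /GRing.scale /=; ring.
rewrite br_delta mxE addrC /lc; apply/eqP; rewrite subr_eq0; apply/eqP.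
by apply: ev2_ext => // n hn; rewrite cf_delta.
Qed.

Lemma cf_br_lc d u v n : all wf2 d -> wfi n ->
  cf (br (lc d) u v) n = - ev2 (nth [::] d n.-1) (cf u) (cf v).
Proof. by case: n => // n wd hn; rewrite /cf br_lc //= inordK. Qed.

Definition bf d x y (n : nat) : R := - ev2 (nth [::] d n.-1) x y.

Lemma wf2_nth d n : all wf2 d -> wf2 (nth [::] d n).
Proof.
move=> /all_nthP-/(_ [::]) wd.
by case: (ltnP n (size d)) => h; [exact: wd | rewrite nth_default].
Qed.

Lemma row3E u v w (k : 'I_7) : (u + v + w) 0 k = u 0 k + v 0 k + w 0 k.
Proof. by rewrite mxE [X in X + _]mxE. Qed.

(** Component [k] says that d(d e^(k+1)) = 0. Arbitrary functions on [nat] may serve as vectors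
    because a well-formed list reads only the indices 1 to 7. *)
Lemma lc_jacobi d : all wf2 d -> is_lie (lc d) ->
  forall (k : nat) x y z, (k < 7)%N ->
  ev2 (nth [::] d k) x (bf d y z) + ev2 (nth [::] d k) y (bf d z x)
  + ev2 (nth [::] d k) z (bf d x y) = 0.
Proof.
move=> wd [_ [_ hj]] k x y z hk.
have := hj (vec x) (vec y) (vec z) => /rowP/(_ (Ordinal hk)).
rewrite row3E [in X in _ = X -> _]mxE !br_lc //= -!opprD => /eqP.
rewrite oppr_eq0 => /eqP <-.
by congr (_ + _ + _); apply: ev2_ext; rewrite ?wf2_nth // => n hn;
  rewrite ?cf_vec // cf_br_lc // /bf; congr (- _); apply: ev2_ext;
  rewrite ?wf2_nth // => m hm; rewrite cf_vec.
Qed.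

Lemma lc_is_lie d : all wf2 d ->
  (forall (k : nat) x y z, (k < 7)%N ->
    ev2 (nth [::] d k) x (bf d y z) + ev2 (nth [::] d k) y (bf d z x)
    + ev2 (nth [::] d k) z (bf d x y) = 0) -> is_lie (lc d).
Proof.
move=> wd h; apply: is_lieP => [u|u v w]; apply/rowP => k; rewrite ?row3E !br_lc // [RHS]mxE.
  by elim: (nth _ _ _) => [|t l IH] /=; rewrite ?oppr0 // opprD IH; ring.
rewrite -!opprD -[RHS]oppr0 -(h k (cf u) (cf v) (cf w)) //; congr (- _).
by congr (_ + _ + _); apply: ev2_ext; rewrite ?wf2_nth // => n hn;
  rewrite cf_br_lc.
Qed.

End Coframes.

Section CoframeIso.
Variable R : fieldType.
Implicit Types (x y : nat -> R) (d : seq (seq (R * nat * nat))).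

Lemma unit_of_kernel n (A : 'M[R]_n) : (forall u : 'rV_n, u *m A = 0 -> u = 0) -> A \in unitmx.
Proof.
move=> h; rewrite -row_free_unit -kermx_eq0; apply/eqP/row_matrixP => i.
by rewrite row0; apply: h; rewrite -row_mul mulmx_ker row0.
Qed.

(* [S] lists seven 1-forms on the first algebra that satisfy the structure
   equations of the second one. *)
Lemma lc_iso d1 d2 (S : seq (seq (R * nat))) :
  all (@wf2 R) d1 -> all (@wf2 R) d2 -> all (@wf1 R) S ->
  (forall (k : nat) x y, (k < 7)%N ->
    ev2 (nth [::] d2 k) (fun n => ev1 (nth [::] S n.-1) x)
                        (fun n => ev1 (nth [::] S n.-1) y)
    = ev1 (nth [::] S k) (fun n => ev2 (nth [::] d1 n.-1) x y)) ->
  (forall x, (forall k, (k < 7)%N -> ev1 (nth [::] S k) x = 0) ->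
     forall n, wfi n -> x n = 0) ->
  lie_iso (lc d1) (lc d2).
Proof.
move=> w1 w2 wS hS hK.
have wSn n : wf1 (nth [::] S n).
  move/all_nthP: wS => /(_ [::]) wS.
  by case: (ltnP n (size S)) => h; [exact: wS | rewrite nth_default].
pose A : 'M[R]_7 := \matrix_(i < 7, k < 7) ev1 (nth [::] S k) (cf (delta_mx 0 i : 'rV[R]_7)).
have lin (u : 'rV[R]_7) (k : 'I_7) : (u *m A) 0 k = ev1 (nth [::] S k) (cf u).
  apply/eqP; rewrite -subr_eq0; apply/eqP; move: u.
  apply: (@linear_ext _ R^o) => [a u v|i].
    by rewrite mulmxDl -scalemxAl !mxE ev1_lin /GRing.scale /=; ring.
  rewrite -rowE [X in X - _]mxE [X in X - _]mxE; exact: subrr.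
have cA u n : wfi n -> cf (u *m A) n = ev1 (nth [::] S n.-1) (cf u).
  by case: n => // n hn; rewrite /cf lin /= inordK.
exists A; split.
  apply: unit_of_kernel => u hu; apply: cfP => n hn; rewrite cf0; move: n hn.
  by apply: hK => k hk; rewrite -(lin u (Ordinal hk)) hu mxE.
move=> u v; apply/rowP => k; rewrite br_lc // lin.
rewrite (_ : ev1 _ _ = ev1 (nth [::] S k)
   (fun n => - ev2 (nth [::] d1 n.-1) (cf u) (cf v))); last first.
  by apply: ev1_ext => // n hn; rewrite cf_br_lc.
have -> : ev1 (nth [::] S k) (fun n => - ev2 (nth [::] d1 n.-1) (cf u) (cf v))
  = - ev1 (nth [::] S k) (fun n => ev2 (nth [::] d1 n.-1) (cf u) (cf v)).
  by elim: (nth [::] S k) => [|t l IH] /=; rewrite ?oppr0 // IH; ring.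
rewrite -hS ?ltn_ord //; congr (- _).
by apply: ev2_ext; rewrite ?wf2_nth // => n hn; rewrite cA.
Qed.

End CoframeIso.

Section TwelveLists.
Variable R : comUnitRingType.

Definition cast2 (t : int * nat * nat) : R * nat * nat := (t.1.1%:~R, t.1.2, t.2).

Lemma L12_lc (n : nat) i j k :
  L12 R n i j k = lc (map (map cast2) (nth [::] nil12 n)) i j k.
Proof.
rewrite /L12 /sc_of /lc; congr (- _).
have -> : nth [::] (map (map cast2) (nth [::] nil12 n)) k =
  map cast2 (nth [::] (nth [::] nil12 n) k).
  case: (ltnP k (size (nth [::] nil12 n))) => h; first by rewrite (nth_map [::]).
  by rewrite nth_default ?size_map // [in RHS]nth_default.
elim: (nth [::] _ k) => [|t l IH]; first by rewrite big_nil.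
by rewrite big_cons IH /= -!mulnb !natrM [X in _ - X]mulrC.
Qed.

End TwelveLists.

(** * Closed forms and the gauge group *)

Section ClosedForms.
Variable R : comUnitRingType.
Implicit Types (x y z u v w : 'rV[R]_7) (c : sconst R) (A P : 'M[R]_7).

Definition trilinear (F : 'rV[R]_7 -> 'rV[R]_7 -> 'rV[R]_7 -> R) :=
  [/\ forall a u u' v w, F (a *: u + u') v w = a * F u v w + F u' v w,
      forall a u v v' w, F u (a *: v + v') w = a * F u v w + F u v' w &
      forall a u v w w', F u v (a *: w + w') = a * F u v w + F u v w'].

(** Closedness is asked of all vectors, not only of a basis, so that it can be carried along a
    linear isomorphism by substitution. *)
Definition closed3 c (F : 'rV[R]_7 -> 'rV[R]_7 -> 'rV[R]_7 -> R) := forall x y z t,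
  - F (br c x y) z t + F (br c x z) y t - F (br c x t) y z
  - F (br c y z) x t + F (br c y t) x z - F (br c z t) x y = 0.

(* [phi0] in coordinates (w, x0, x1, x2, x3, y, eta) adapted to the splitting
   R w + k + R y + R eta: w y eta + om1 eta + y om2 + w om3, with the
   hyperkaehler triple om1 = x01 + x23, om2 = x02 + x31, om3 = x03 + x12 on k. *)
Definition phi1 u v w : R :=
  ev3 1 6 7 u v w + ev3 2 3 7 u v w + ev3 4 5 7 u v w + ev3 2 4 6 u v w
  - ev3 3 5 6 u v w + ev3 1 2 5 u v w + ev3 1 3 4 u v w.

Lemma phi0_trilinear : trilinear (@phi0 R).
Proof. by split=> *; rewrite /phi0 /ev3 !cfE; ring. Qed.

Lemma phi1_trilinear : trilinear phi1.
Proof. by split=> *; rewrite /phi1 /ev3 !cfE; ring. Qed.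

Lemma trilinear_pull F A :
  trilinear F -> trilinear (fun u v w => F (u *m A) (v *m A) (w *m A)).
Proof. by case=> h1 h2 h3; split=> *; rewrite mulmxDl -scalemxAl (h1, h2, h3). Qed.

Lemma linear_sum (F : 'rV[R]_7 -> R) :
  (forall a u v, F (a *: u + v) = a * F u + F v) ->
  forall u, F u = \sum_(m < 7) u 0 m * F (delta_mx 0 m).
Proof.
move=> hF u; apply/eqP; rewrite -subr_eq0; apply/eqP; move: u.
apply: (@linear_ext _ R^o) => [a u v|i].
  rewrite hF /GRing.scale /= mulrBr mulr_sumr.
  rewrite (eq_bigr (fun m => a * (u 0 m * F (delta_mx 0 m)) + v 0 m * F (delta_mx 0 m))).
    by rewrite big_split /=; ring.
  by move=> m _; rewrite !mxE; ring.
rewrite (bigD1 i) //= mxE !eqxx mul1r big1 ?addr0 ?subrr // => m mi.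
by rewrite mxE (negPf mi) andbF mul0r.
Qed.

Lemma brphi_val c F (phi : form3 R) : trilinear F ->
  (forall i j k, phi i j k = F (delta_mx 0 i) (delta_mx 0 j) (delta_mx 0 k)) ->
  forall a b e f, brphi c phi a b e f =
    F (br c (delta_mx 0 a) (delta_mx 0 b)) (delta_mx 0 e) (delta_mx 0 f).
Proof.
move=> [h1 h2 h3] hp a b e f.
rewrite (linear_sum (F := fun u => F u _ _)) => [|*]; last by rewrite h1.
by rewrite /brphi br_delta; apply: eq_bigr => m _; rewrite mxE hp.
Qed.

Lemma closed3_d3 c F (phi : form3 R) : trilinear F ->
  (forall i j k, phi i j k = F (delta_mx 0 i) (delta_mx 0 j) (delta_mx 0 k)) ->
  (forall a b e f, d3 c phi a b e f = 0) <-> closed3 c F.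
Proof.
move=> hF hp; have hb := brphi_val c hF hp; split=> [hd|hc a b e f]; last first.
  by rewrite /d3 !hb; apply: hc.
have [h1 h2 h3] := hF.
move=> x y z t; move: x; apply: (@linear_ext _ R^o) => [a u v|i].
  by rewrite !(brDl, brZl) !(h1, h2, h3) /GRing.scale /=; ring.
move: y; apply: (@linear_ext _ R^o) => [a u v|j].
  by rewrite !(brDl, brZl, brDr, brZr) !(h1, h2, h3) /GRing.scale /=; ring.
move: z; apply: (@linear_ext _ R^o) => [a u v|k].
  by rewrite !(brDl, brZl, brDr, brZr) !(h1, h2, h3) /GRing.scale /=; ring.
move: t; apply: (@linear_ext _ R^o) => [a u v|l].
  by rewrite !(brDl, brZl, brDr, brZr) !(h1, h2, h3) /GRing.scale /=; ring.
by have := hd i j k l; rewrite /d3 !hb.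
Qed.

Lemma calibratedP c : calibrated_G2 c <->
  exists P, P \in unitmx /\ closed3 c (fun u v w => phi0 (u *m P) (v *m P) (w *m P)).
Proof.
split=> [[phi [[P [uP hp]] hd]]|[P [uP hc]]].
  exists P; split=> //; apply: (closed3_d3 c (trilinear_pull P phi0_trilinear) _).1 hd.
  by move=> i j k; rewrite hp !rowE.
exists (fun i j k => phi0 (row i P) (row j P) (row k P)); split; first by exists P.
apply: (closed3_d3 c (trilinear_pull P phi0_trilinear) _).2 hc.
by move=> i j k; rewrite !rowE.
Qed.

Lemma closed3_iso c c' F F' A : A \in unitmx ->
  (forall x y, br c' (x *m A) (y *m A) = br c x y *m A) ->
  (forall u v w, F' (u *m A) (v *m A) (w *m A) = F u v w) ->
  closed3 c F -> closed3 c' F'.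
Proof.
move=> uA hA hF hc x y z t.
rewrite -(mulmxKV uA x) -(mulmxKV uA y) -(mulmxKV uA z) -(mulmxKV uA t).
by rewrite !hA !hF.
Qed.

Lemma calibrated_iso c1 c2 : lie_iso c1 c2 -> calibrated_G2 c1 -> calibrated_G2 c2.
Proof.
move=> [A [uA hA]] /calibratedP[P [uP hc]]; apply/calibratedP.
exists (invmx A *m P); rewrite unitmx_mul unitmx_inv uA uP; split=> //.
by apply: (closed3_iso uA hA) hc => u v w; rewrite !mulmxA !mulmxK.
Qed.

(** The signed permutation of the coordinates that turns [phi0] into [phi1]. It is orthogonal, which
    is how its invertibility is proved. *)
Definition adapt_mx : 'M[R]_7 := \matrix_(i, k) nth 0 (nth [::]
  [:: [:: 1; 0; 0; 0; 0; 0; 0]; [:: 0; 0; 1; 0; 0; 0; 0]; [:: 0; 0; 0; 1; 0; 0; 0];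
      [:: 0; 0; 0; 0; 0; -1; 0]; [:: 0; 0; 0; 0; 1; 0; 0]; [:: 0; 1; 0; 0; 0; 0; 0];
      [:: 0; 0; 0; 0; 0; 0; 1]] i) k.

Lemma cf_mul_mx (S : seq (seq R)) u k : (0 < k < 8)%N ->
  cf (u *m (\matrix_(i < 7, j < 7) nth 0 (nth [::] S i) j)) k =
  cf u 1 * nth 0 (nth [::] S 0) k.-1 + (cf u 2 * nth 0 (nth [::] S 1) k.-1 +
  (cf u 3 * nth 0 (nth [::] S 2) k.-1 + (cf u 4 * nth 0 (nth [::] S 3) k.-1 +
  (cf u 5 * nth 0 (nth [::] S 4) k.-1 + (cf u 6 * nth 0 (nth [::] S 5) k.-1 +
   cf u 7 * nth 0 (nth [::] S 6) k.-1))))).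
Proof.
case: k => // k hk; rewrite /cf mxE /= !big_ord_recl big_ord0 addr0 !mxE /= inordK //.
by congr (_ + (_ + (_ + (_ + (_ + (_ + _)))))); congr (_ * _);
  congr (u _ _); apply/val_inj; rewrite /= inordK.
Qed.

Lemma cf_adapt u : let v := u *m adapt_mx in
  (cf v 1 = cf u 1) * (cf v 2 = cf u 6) * (cf v 3 = cf u 2) * (cf v 4 = cf u 3) *
  (cf v 5 = cf u 5) * (cf v 6 = - cf u 4) * (cf v 7 = cf u 7).
Proof. by rewrite /= /adapt_mx !cf_mul_mx //=; do ![split]; ring. Qed.

Lemma phi1_adapt u v w :
  phi0 (u *m adapt_mx) (v *m adapt_mx) (w *m adapt_mx) = phi1 u v w.
Proof. by rewrite /phi0 /phi1 /ev3 !cf_adapt; ring. Qed.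

Lemma adapt_unit : adapt_mx \in unitmx.
Proof.
suff /mulmx1_unit[] : adapt_mx *m adapt_mx^T = 1%:M by [].
apply/row_matrixP => i; rewrite !rowE mulmxA mulmx1; apply: cfP => k hk.
have -> : adapt_mx^T = \matrix_(i < 7, k < 7) nth 0 (nth [::]
  [:: [:: 1; 0; 0; 0; 0; 0; 0]; [:: 0; 0; 0; 0; 0; 1; 0]; [:: 0; 1; 0; 0; 0; 0; 0];
      [:: 0; 0; 1; 0; 0; 0; 0]; [:: 0; 0; 0; 0; 1; 0; 0]; [:: 0; 0; 0; -1; 0; 0; 0];
      [:: 0; 0; 0; 0; 0; 0; 1]] i) k.
  apply/matrixP => a b; rewrite !mxE.
  by case: a => [[|[|[|[|[|[|[|]]]]]]] ?] //; case: b => [[|[|[|[|[|[|[|]]]]]]] ?].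
rewrite cf_mul_mx // !cf_mul_mx //=.
by case: k hk => [|[|[|[|[|[|[|[|]]]]]]]] //= _; ring.
Qed.

Lemma closed_phi1_calibrated c : closed3 c phi1 -> calibrated_G2 c.
Proof.
move=> hc; apply/calibratedP; exists adapt_mx; rewrite adapt_unit; split=> //.
by move=> x y z t; rewrite !phi1_adapt; apply: hc.
Qed.

Lemma calibrated_closed_phi1 c : calibrated_G2 c ->
  exists c', lie_iso c c' /\ closed3 c' phi1.
Proof.
move=> /calibratedP[P [uP hc]]; pose A := P *m invmx adapt_mx.
have uA : A \in unitmx by rewrite unitmx_mul unitmx_inv uP adapt_unit.
exists (transport c A); split; first exact: transport_iso.
apply: (closed3_iso uA) hc => [x y|u v w]; first by rewrite br_transport !mulmxK.
by rewrite -phi1_adapt !mulmxA !mulmxKV // adapt_unit.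
Qed.

End ClosedForms.

(** * Quaternionic subgroups of G2 *)

Section Gauge.
Variable R : rcfType.
Implicit Types (u v w : 'rV[R]_7) (A B : 'M[R]_7).

(** The stabilizer of [phi1], a copy of G2. The elements constructed below belong to subgroups
    Sp(1), each fixing an associative triple of basis vectors and acting on the complementary
    4-plane. *)
Definition gauge A := A \in unitmx /\
  forall u v w, phi1 (u *m A) (v *m A) (w *m A) = phi1 u v w.

Lemma gaugeM A B : gauge A -> gauge B -> gauge (A *m B).
Proof.
move=> [uA hA] [uB hB]; split=> [|u v w]; first by rewrite unitmx_mul uA.
by rewrite !mulmxA hB hA.
Qed.

(* The coordinates of [x * conj a] for quaternions [x] and [a]. *)
Section Quaternions.
Variables (a0 a1 a2 a3 : R).
Let N := a0 ^+ 2 + a1 ^+ 2 + a2 ^+ 2 + a3 ^+ 2.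
Definition q0 (x0 x1 x2 x3 : R) := x0 * a0 + x1 * a1 + x2 * a2 + x3 * a3.
Definition q1 (x0 x1 x2 x3 : R) := - x0 * a1 + x1 * a0 - x2 * a3 + x3 * a2.
Definition q2 (x0 x1 x2 x3 : R) := - x0 * a2 + x1 * a3 + x2 * a0 - x3 * a1.
Definition q3 (x0 x1 x2 x3 : R) := - x0 * a3 - x1 * a2 + x2 * a1 + x3 * a0.

(** The triple [om1], [om2], [om3] is minus the imaginary part of x * conj y. Multiplying both
    arguments on the right by conj a inserts conj a * a = N, which is why the triple is only
    scaled. *)
Definition om1 (x0 x1 x2 x3 y0 y1 y2 y3 : R) := x0 * y1 - x1 * y0 + x2 * y3 - x3 * y2.
Definition om2 (x0 x1 x2 x3 y0 y1 y2 y3 : R) := x0 * y2 - x2 * y0 + x3 * y1 - x1 * y3.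
Definition om3 (x0 x1 x2 x3 y0 y1 y2 y3 : R) := x0 * y3 - x3 * y0 + x1 * y2 - x2 * y1.

Definition quat4 (om : R -> R -> R -> R -> R -> R -> R -> R -> R) x0 x1 x2 x3 y0 y1 y2 y3 :=
  om (q0 x0 x1 x2 x3) (q1 x0 x1 x2 x3) (q2 x0 x1 x2 x3) (q3 x0 x1 x2 x3)
     (q0 y0 y1 y2 y3) (q1 y0 y1 y2 y3) (q2 y0 y1 y2 y3) (q3 y0 y1 y2 y3).

Lemma quat_om1 x0 x1 x2 x3 y0 y1 y2 y3 :
  quat4 om1 x0 x1 x2 x3 y0 y1 y2 y3 = N * om1 x0 x1 x2 x3 y0 y1 y2 y3.
Proof. by rewrite /quat4 /om1 /q0 /q1 /q2 /q3 /N; ring. Qed.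
Lemma quat_om2 x0 x1 x2 x3 y0 y1 y2 y3 :
  quat4 om2 x0 x1 x2 x3 y0 y1 y2 y3 = N * om2 x0 x1 x2 x3 y0 y1 y2 y3.
Proof. by rewrite /quat4 /om2 /q0 /q1 /q2 /q3 /N; ring. Qed.
Lemma quat_om3 x0 x1 x2 x3 y0 y1 y2 y3 :
  quat4 om3 x0 x1 x2 x3 y0 y1 y2 y3 = N * om3 x0 x1 x2 x3 y0 y1 y2 y3.
Proof. by rewrite /quat4 /om3 /q0 /q1 /q2 /q3 /N; ring. Qed.

Lemma quat_inj x0 x1 x2 x3 : N = 1 ->
  q0 x0 x1 x2 x3 = 0 -> q1 x0 x1 x2 x3 = 0 -> q2 x0 x1 x2 x3 = 0 -> q3 x0 x1 x2 x3 = 0 ->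
  [/\ x0 = 0, x1 = 0, x2 = 0 & x3 = 0].
Proof.
move=> hN h0 h1 h2 h3.
have e0 : N * x0 = a0 * q0 x0 x1 x2 x3 - a1 * q1 x0 x1 x2 x3 - a2 * q2 x0 x1 x2 x3
   - a3 * q3 x0 x1 x2 x3 by rewrite /N /q0 /q1 /q2 /q3; ring.
have e1 : N * x1 = a1 * q0 x0 x1 x2 x3 + a0 * q1 x0 x1 x2 x3 + a3 * q2 x0 x1 x2 x3
   - a2 * q3 x0 x1 x2 x3 by rewrite /N /q0 /q1 /q2 /q3; ring.
have e2 : N * x2 = a2 * q0 x0 x1 x2 x3 - a3 * q1 x0 x1 x2 x3 + a0 * q2 x0 x1 x2 x3
   + a1 * q3 x0 x1 x2 x3 by rewrite /N /q0 /q1 /q2 /q3; ring.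
have e3 : N * x3 = a3 * q0 x0 x1 x2 x3 + a2 * q1 x0 x1 x2 x3 - a1 * q2 x0 x1 x2 x3
   + a0 * q3 x0 x1 x2 x3 by rewrite /N /q0 /q1 /q2 /q3; ring.
move: e0 e1 e2 e3; rewrite hN h0 h1 h2 h3 !mul1r !mulr0 !subr0 !addr0.
by move=> *; split.
Qed.
End Quaternions.

(** For nonzero b take a = b / |b|, so that b * conj a = |b| is real; for b = 0 take a = 1. *)
Lemma quat_unit (b0 b1 b2 b3 : R) : exists a0 a1 a2 a3 : R,
  [/\ a0 ^+ 2 + a1 ^+ 2 + a2 ^+ 2 + a3 ^+ 2 = 1,
      q1 a0 a1 a2 a3 b0 b1 b2 b3 = 0, q2 a0 a1 a2 a3 b0 b1 b2 b3 = 0 &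
      q3 a0 a1 a2 a3 b0 b1 b2 b3 = 0].
Proof.
set N := b0 ^+ 2 + b1 ^+ 2 + b2 ^+ 2 + b3 ^+ 2.
have hN : 0 <= N by rewrite !addr_ge0 ?sqr_ge0.
have [N0|N0] := eqVneq N 0.
  move/eqP: (N0); rewrite /N paddr_eq0 ?addr_ge0 ?sqr_ge0 // paddr_eq0 ?addr_ge0 ?sqr_ge0 //.
  rewrite paddr_eq0 ?sqr_ge0 // !sqrf_eq0 => /andP[/andP[/andP[/eqP -> /eqP ->] /eqP ->] /eqP ->].
  by exists 1, 0, 0, 0; rewrite /q1 /q2 /q3; split; ring.
set r := Num.sqrt N.
have r2 : r ^+ 2 = N by rewrite sqr_sqrtr.
have r0 : r != 0 by rewrite -sqrf_eq0 r2.
exists (b0 / r), (b1 / r), (b2 / r), (b3 / r); split.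
- rewrite !expr_div_n -!mulrDl -/N r2 divff //.
- by rewrite /q1; field.
- by rewrite /q2; field.
- by rewrite /q3; field.
Qed.

(** Along the associative triple e_1, e_6, e_7 the form is a volume form plus the pairing of the
    triple with the hyperkaehler forms of the complement. Both parts are visibly preserved by unit
    quaternions on the complement. *)
Lemma phi1_om_a u v w : phi1 u v w = ev3 1 6 7 u v w +
  (cf u 7 * om1 (cf v 2) (cf v 3) (cf v 4) (cf v 5) (cf w 2) (cf w 3) (cf w 4) (cf w 5)
   - cf v 7 * om1 (cf u 2) (cf u 3) (cf u 4) (cf u 5) (cf w 2) (cf w 3) (cf w 4) (cf w 5)
   + cf w 7 * om1 (cf u 2) (cf u 3) (cf u 4) (cf u 5) (cf v 2) (cf v 3) (cf v 4) (cf v 5)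
   + cf u 6 * om2 (cf v 2) (cf v 3) (cf v 4) (cf v 5) (cf w 2) (cf w 3) (cf w 4) (cf w 5)
   - cf v 6 * om2 (cf u 2) (cf u 3) (cf u 4) (cf u 5) (cf w 2) (cf w 3) (cf w 4) (cf w 5)
   + cf w 6 * om2 (cf u 2) (cf u 3) (cf u 4) (cf u 5) (cf v 2) (cf v 3) (cf v 4) (cf v 5)
   + cf u 1 * om3 (cf v 2) (cf v 3) (cf v 4) (cf v 5) (cf w 2) (cf w 3) (cf w 4) (cf w 5)
   - cf v 1 * om3 (cf u 2) (cf u 3) (cf u 4) (cf u 5) (cf w 2) (cf w 3) (cf w 4) (cf w 5)
   + cf w 1 * om3 (cf u 2) (cf u 3) (cf u 4) (cf u 5) (cf v 2) (cf v 3) (cf v 4) (cf v 5)).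
Proof. by rewrite /phi1 /ev3 /om1 /om2 /om3; ring. Qed.

Definition ga_mx (a0 a1 a2 a3 : R) : 'M[R]_7 := \matrix_(i < 7, j < 7) nth 0 (nth [::]
  [:: [:: 1; 0; 0; 0; 0; 0; 0];
      [:: 0; a0; - a1; - a2; - a3; 0; 0];
      [:: 0; a1; a0; a3; - a2; 0; 0];
      [:: 0; a2; - a3; a0; a1; 0; 0];
      [:: 0; a3; a2; - a1; a0; 0; 0];
      [:: 0; 0; 0; 0; 0; 1; 0];
      [:: 0; 0; 0; 0; 0; 0; 1]] i) j.

Lemma cf_ga a0 a1 a2 a3 u : let v := u *m ga_mx a0 a1 a2 a3 in
  (cf v 1 = cf u 1) *
  (cf v 6 = cf u 6) *
  (cf v 7 = cf u 7) *
  (cf v 2 = q0 a0 a1 a2 a3 (cf u 2) (cf u 3) (cf u 4) (cf u 5)) *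
  (cf v 3 = q1 a0 a1 a2 a3 (cf u 2) (cf u 3) (cf u 4) (cf u 5)) *
  (cf v 4 = q2 a0 a1 a2 a3 (cf u 2) (cf u 3) (cf u 4) (cf u 5)) *
  (cf v 5 = q3 a0 a1 a2 a3 (cf u 2) (cf u 3) (cf u 4) (cf u 5)).
Proof. by rewrite /= /ga_mx !cf_mul_mx //= /q0 /q1 /q2 /q3; do ![split]; ring. Qed.

Lemma gauge_a u : exists A, [/\ gauge A,
  (forall v, [/\ cf (v *m A) 1 = cf v 1, cf (v *m A) 6 = cf v 6 & cf (v *m A) 7 = cf v 7]),
  (forall v, cf v 2 = 0 -> cf v 3 = 0 -> cf v 4 = 0 -> cf v 5 = 0 -> v *m A = v) &
  [/\ cf (u *m A) 3 = 0, cf (u *m A) 4 = 0 & cf (u *m A) 5 = 0]].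
Proof.
have [a0 [a1 [a2 [a3 [hN h1 h2 h3]]]]] := quat_unit (cf u 2) (cf u 3) (cf u 4) (cf u 5).
exists (ga_mx a0 a1 a2 a3); split.
- split=> [|x y z].
    apply: unit_of_kernel => v hv; have E k : cf (v *m ga_mx a0 a1 a2 a3) k = 0.
      by rewrite hv cf0.
    have [] := @quat_inj a0 a1 a2 a3 (cf v 2) (cf v 3) (cf v 4) (cf v 5) hN.
    + by have := E 2; rewrite !cf_ga .
    + by have := E 3; rewrite !cf_ga .
    + by have := E 4; rewrite !cf_ga .
    + by have := E 5; rewrite !cf_ga .
    move=> e0 e1 e2 e3; have := (E 1, E 6, E 7); rewrite !cf_ga => -[[f0 f1] f2].

    by apply: cfP => k; rewrite cf0; case: k => [|[|[|[|[|[|[|[|k]]]]]]]].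
  rewrite !phi1_om_a /ev3 !cf_ga ?opprK.
  have E1 := quat_om1 a0 a1 a2 a3; have E2 := quat_om2 a0 a1 a2 a3.
  have E3 := quat_om3 a0 a1 a2 a3; rewrite /quat4 hN in E1 E2 E3.
  by rewrite !(E1, E2, E3) !mul1r.
- by move=> v; rewrite !cf_ga.
- move=> v e0 e1 e2 e3; apply: cfP => k.
  by case: k => [|[|[|[|[|[|[|[|k]]]]]]]] //= _; rewrite !cf_ga // ?(e0, e1, e2, e3) /q0 /q1 /q2 /q3; ring.
- by rewrite !cf_ga h1 h2 h3 ?oppr0.
Qed.

(** The same for the associative triple e_4, e_5, e_7. The order and the signs of the other four
    coordinates identify their plane with the quaternions so that the same three 2-forms occur. *)
Lemma phi1_om_b u v w : phi1 u v w = ev3 4 5 7 u v w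
   + cf u 4 * om3 (cf v 6) (- cf v 1) (- cf v 3) (cf v 2) (cf w 6) (- cf w 1) (- cf w 3) (cf w 2)
   - cf v 4 * om3 (cf u 6) (- cf u 1) (- cf u 3) (cf u 2) (cf w 6) (- cf w 1) (- cf w 3) (cf w 2)
   + cf w 4 * om3 (cf u 6) (- cf u 1) (- cf u 3) (cf u 2) (cf v 6) (- cf v 1) (- cf v 3) (cf v 2)
   + cf u 5 * om2 (cf v 6) (- cf v 1) (- cf v 3) (cf v 2) (cf w 6) (- cf w 1) (- cf w 3) (cf w 2)
   - cf v 5 * om2 (cf u 6) (- cf u 1) (- cf u 3) (cf u 2) (cf w 6) (- cf w 1) (- cf w 3) (cf w 2)
   + cf w 5 * om2 (cf u 6) (- cf u 1) (- cf u 3) (cf u 2) (cf v 6) (- cf v 1) (- cf v 3) (cf v 2)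
   + cf u 7 * om1 (cf v 6) (- cf v 1) (- cf v 3) (cf v 2) (cf w 6) (- cf w 1) (- cf w 3) (cf w 2)
   - cf v 7 * om1 (cf u 6) (- cf u 1) (- cf u 3) (cf u 2) (cf w 6) (- cf w 1) (- cf w 3) (cf w 2)
   + cf w 7 * om1 (cf u 6) (- cf u 1) (- cf u 3) (cf u 2) (cf v 6) (- cf v 1) (- cf v 3) (cf v 2).
Proof. by rewrite /phi1 /ev3 /om1 /om2 /om3; ring. Qed.

Definition gb_mx (a0 a1 a2 a3 : R) : 'M[R]_7 := \matrix_(i < 7, j < 7) nth 0 (nth [::]
  [:: [:: a0; a2; a3; 0; 0; - a1; 0];
      [:: - a2; a0; a1; 0; 0; a3; 0];
      [:: - a3; - a1; a0; 0; 0; - a2; 0];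
      [:: 0; 0; 0; 1; 0; 0; 0];
      [:: 0; 0; 0; 0; 1; 0; 0];
      [:: a1; - a3; a2; 0; 0; a0; 0];
      [:: 0; 0; 0; 0; 0; 0; 1]] i) j.

Lemma cf_gb a0 a1 a2 a3 u : let v := u *m gb_mx a0 a1 a2 a3 in
  (cf v 4 = cf u 4) *
  (cf v 5 = cf u 5) *
  (cf v 7 = cf u 7) *
  (cf v 6 = q0 a0 a1 a2 a3 (cf u 6) (- cf u 1) (- cf u 3) (cf u 2)) *
  (cf v 1 = - q1 a0 a1 a2 a3 (cf u 6) (- cf u 1) (- cf u 3) (cf u 2)) *
  (cf v 3 = - q2 a0 a1 a2 a3 (cf u 6) (- cf u 1) (- cf u 3) (cf u 2)) *
  (cf v 2 = q3 a0 a1 a2 a3 (cf u 6) (- cf u 1) (- cf u 3) (cf u 2)).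
Proof. by rewrite /= /gb_mx !cf_mul_mx //= /q0 /q1 /q2 /q3; do ![split]; ring. Qed.

Lemma gauge_b u : exists A, [/\ gauge A,
  (forall v, [/\ cf (v *m A) 4 = cf v 4, cf (v *m A) 5 = cf v 5 & cf (v *m A) 7 = cf v 7]),
  (forall v, cf v 6 = 0 -> cf v 1 = 0 -> cf v 3 = 0 -> cf v 2 = 0 -> v *m A = v) &
  [/\ cf (u *m A) 1 = 0, cf (u *m A) 3 = 0 & cf (u *m A) 2 = 0]].
Proof.
have [a0 [a1 [a2 [a3 [hN h1 h2 h3]]]]] := quat_unit (cf u 6) (- cf u 1) (- cf u 3) (cf u 2).
exists (gb_mx a0 a1 a2 a3); split.
- split=> [|x y z].
    apply: unit_of_kernel => v hv; have E k : cf (v *m gb_mx a0 a1 a2 a3) k = 0.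
      by rewrite hv cf0.
    have [] := @quat_inj a0 a1 a2 a3 (cf v 6) (- cf v 1) (- cf v 3) (cf v 2) hN.
    + by have := E 6; rewrite !cf_gb .
    + by have := E 1; rewrite !cf_gb => /eqP; rewrite oppr_eq0 => /eqP.
    + by have := E 3; rewrite !cf_gb => /eqP; rewrite oppr_eq0 => /eqP.
    + by have := E 2; rewrite !cf_gb .
    move=> e0 e1 e2 e3; have := (E 4, E 5, E 7); rewrite !cf_gb => -[[f0 f1] f2].
    move/eqP: e1; rewrite oppr_eq0 => /eqP e1. move/eqP: e2; rewrite oppr_eq0 => /eqP e2.
    by apply: cfP => k; rewrite cf0; case: k => [|[|[|[|[|[|[|[|k]]]]]]]].
  rewrite !phi1_om_b /ev3 !cf_gb ?opprK.
  have E1 := quat_om1 a0 a1 a2 a3; have E2 := quat_om2 a0 a1 a2 a3.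
  have E3 := quat_om3 a0 a1 a2 a3; rewrite /quat4 hN in E1 E2 E3.
  by rewrite !(E1, E2, E3) !mul1r.
- by move=> v; rewrite !cf_gb.
- move=> v e0 e1 e2 e3; apply: cfP => k.
  by case: k => [|[|[|[|[|[|[|[|k]]]]]]]] //= _; rewrite !cf_gb // ?(e0, e1, e2, e3) /q0 /q1 /q2 /q3; ring.
- by rewrite !cf_gb h1 h2 h3 ?oppr0.
Qed.

Lemma phi1_om_c u v w : phi1 u v w = ev3 1 2 5 u v w
   + cf u 1 * om1 (cf v 7) (- cf v 6) (cf v 3) (cf v 4) (cf w 7) (- cf w 6) (cf w 3) (cf w 4)
   - cf v 1 * om1 (cf u 7) (- cf u 6) (cf u 3) (cf u 4) (cf w 7) (- cf w 6) (cf w 3) (cf w 4)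
   + cf w 1 * om1 (cf u 7) (- cf u 6) (cf u 3) (cf u 4) (cf v 7) (- cf v 6) (cf v 3) (cf v 4)
   - cf u 2 * om2 (cf v 7) (- cf v 6) (cf v 3) (cf v 4) (cf w 7) (- cf w 6) (cf w 3) (cf w 4)
   + cf v 2 * om2 (cf u 7) (- cf u 6) (cf u 3) (cf u 4) (cf w 7) (- cf w 6) (cf w 3) (cf w 4)
   - cf w 2 * om2 (cf u 7) (- cf u 6) (cf u 3) (cf u 4) (cf v 7) (- cf v 6) (cf v 3) (cf v 4)
   + cf u 5 * om3 (cf v 7) (- cf v 6) (cf v 3) (cf v 4) (cf w 7) (- cf w 6) (cf w 3) (cf w 4)
   - cf v 5 * om3 (cf u 7) (- cf u 6) (cf u 3) (cf u 4) (cf w 7) (- cf w 6) (cf w 3) (cf w 4)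
   + cf w 5 * om3 (cf u 7) (- cf u 6) (cf u 3) (cf u 4) (cf v 7) (- cf v 6) (cf v 3) (cf v 4).
Proof. by rewrite /phi1 /ev3 /om1 /om2 /om3; ring. Qed.

Definition gc_mx (a0 a1 a2 a3 : R) : 'M[R]_7 := \matrix_(i < 7, j < 7) nth 0 (nth [::]
  [:: [:: 1; 0; 0; 0; 0; 0; 0];
      [:: 0; 1; 0; 0; 0; 0; 0];
      [:: 0; 0; a0; a1; 0; a3; a2];
      [:: 0; 0; - a1; a0; 0; - a2; a3];
      [:: 0; 0; 0; 0; 1; 0; 0];
      [:: 0; 0; - a3; a2; 0; a0; - a1];
      [:: 0; 0; - a2; - a3; 0; a1; a0]] i) j.

Lemma cf_gc a0 a1 a2 a3 u : let v := u *m gc_mx a0 a1 a2 a3 in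
  (cf v 1 = cf u 1) *
  (cf v 2 = cf u 2) *
  (cf v 5 = cf u 5) *
  (cf v 7 = q0 a0 a1 a2 a3 (cf u 7) (- cf u 6) (cf u 3) (cf u 4)) *
  (cf v 6 = - q1 a0 a1 a2 a3 (cf u 7) (- cf u 6) (cf u 3) (cf u 4)) *
  (cf v 3 = q2 a0 a1 a2 a3 (cf u 7) (- cf u 6) (cf u 3) (cf u 4)) *
  (cf v 4 = q3 a0 a1 a2 a3 (cf u 7) (- cf u 6) (cf u 3) (cf u 4)).
Proof. by rewrite /= /gc_mx !cf_mul_mx //= /q0 /q1 /q2 /q3; do ![split]; ring. Qed.

Lemma gauge_c u : exists A, [/\ gauge A,
  (forall v, [/\ cf (v *m A) 1 = cf v 1, cf (v *m A) 2 = cf v 2 & cf (v *m A) 5 = cf v 5]),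
  (forall v, cf v 7 = 0 -> cf v 6 = 0 -> cf v 3 = 0 -> cf v 4 = 0 -> v *m A = v) &
  [/\ cf (u *m A) 6 = 0, cf (u *m A) 3 = 0 & cf (u *m A) 4 = 0]].
Proof.
have [a0 [a1 [a2 [a3 [hN h1 h2 h3]]]]] := quat_unit (cf u 7) (- cf u 6) (cf u 3) (cf u 4).
exists (gc_mx a0 a1 a2 a3); split.
- split=> [|x y z].
    apply: unit_of_kernel => v hv; have E k : cf (v *m gc_mx a0 a1 a2 a3) k = 0.
      by rewrite hv cf0.
    have [] := @quat_inj a0 a1 a2 a3 (cf v 7) (- cf v 6) (cf v 3) (cf v 4) hN.
    + by have := E 7; rewrite !cf_gc .
    + by have := E 6; rewrite !cf_gc => /eqP; rewrite oppr_eq0 => /eqP.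
    + by have := E 3; rewrite !cf_gc .
    + by have := E 4; rewrite !cf_gc .
    move=> e0 e1 e2 e3; have := (E 1, E 2, E 5); rewrite !cf_gc => -[[f0 f1] f2].
    move/eqP: e1; rewrite oppr_eq0 => /eqP e1.
    by apply: cfP => k; rewrite cf0; case: k => [|[|[|[|[|[|[|[|k]]]]]]]].
  rewrite !phi1_om_c /ev3 !cf_gc ?opprK.
  have E1 := quat_om1 a0 a1 a2 a3; have E2 := quat_om2 a0 a1 a2 a3.
  have E3 := quat_om3 a0 a1 a2 a3; rewrite /quat4 hN in E1 E2 E3.
  by rewrite !(E1, E2, E3) !mul1r.
- by move=> v; rewrite !cf_gc.
- move=> v e0 e1 e2 e3; apply: cfP => k.
  by case: k => [|[|[|[|[|[|[|[|k]]]]]]]] //= _; rewrite !cf_gc // ?(e0, e1, e2, e3) /q0 /q1 /q2 /q3; ring.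
- by rewrite !cf_gc h1 h2 h3 ?oppr0.
Qed.

End Gauge.

(** * Adapted frames *)

Section Frames.
Variable R : rcfType.
Implicit Types (x y z u v w X Y : 'rV[R]_7) (A B : 'M[R]_7) (c : sconst R).

Definition ee (k : nat) : 'rV[R]_7 := vec (fun n => (n == k)%:R).

Lemma cf_ee k n : (0 < n < 8)%N -> cf (ee k) n = (n == k)%:R.
Proof. exact: cf_vec. Qed.

(** If every v in J outside I had a bracket outside I, iterating would give brackets of any length
    outside I, and in particular nonzero ones. With J an ideal containing I this is the usual
    central element of J modulo I. *)
Lemma nilpotent_pick c (J I : 'rV[R]_7 -> Prop) : lie_nilpotent c -> I 0 ->
  (forall x v, J v -> J (br c x v)) -> (exists v, J v /\ ~ I v) ->
  exists v, [/\ J v, ~ I v & forall x, I (br c x v)].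
Proof.
move=> [n hn] I0 hJ [v0 [Jv0 Iv0]]; apply: NNPP => hno.
have step v : J v -> ~ I v -> exists x, ~ I (br c x v).
  move=> Jv Iv; apply: NNPP => hx; apply: hno; exists v; split=> // x.
  by apply: NNPP => hIx; apply: hx; exists x.
have iter m : exists xs, [/\ size xs = m, J (foldr (br c) v0 xs) & ~ I (foldr (br c) v0 xs)].
  elim: m => [|m [xs [sz Jm Im]]]; first by exists [::].
  have [x hx] := step _ Jm Im.
  by exists (x :: xs); split; rewrite //= ?sz //; apply: hJ.
by have [xs [sz _]] := iter n; rewrite hn //.
Qed.

(** The number phi1 X Y v is the inner product of v with the cross product of X and Y. The condition
    mentions no frame, so both its validity and its failure survive every change of frame by the
    gauge group. *)
Definition eigenplane c := exists X Y (l : R), [/\ X != 0, (forall v, br c X v = 0),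
  ~ (exists m : R, Y = m *: X) & forall v, br c Y v = (l * phi1 X Y v) *: X].

(** Three quaternionic rotations bring X to the line of e_7, each clearing three of its coordinates
    without spoiling the zeros that are kept. The first two kinds fix e_7 and, applied once more,
    bring Y into the plane of e_6 and e_7. *)
Lemma gauge_frame X Y : X != 0 -> ~ (exists m : R, Y = m *: X) ->
  exists A (r s t : R), [/\ gauge A, r != 0, s != 0, X *m A = r *: ee 7 &
    Y *m A = s *: ee 6 + t *: ee 7].
Proof.
move=> X0 hXY.
have [A1 [gA1 _ _ [a3 a4 a5]]] := gauge_a X.
have [A2 [gA2 fA2 _ [b1 b3 b2]]] := gauge_b (X *m A1).
have [A3 [gA3 fA3 _ [c6 c3 c4]]] := gauge_c (X *m A1 *m A2).
set X3 := X *m A1 *m A2 *m A3 in c6 c3 c4.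
have X3E : X3 = cf X3 7 *: ee 7.
  have [e4 e5 _] := fA2 (X *m A1); have [f1 f2 f5] := fA3 (X *m A1 *m A2).
  apply: cfP => k hk; rewrite cfZ cf_ee //.
  case: k hk => [|[|[|[|[|[|[|[|k]]]]]]]] //= _; rewrite ?mulr0 ?mulr1 //.
  - by rewrite f1 b1.
  - by rewrite f2 b2.
  - by rewrite f5 e5 a5.
have [A4 [gA4 _ fA4 [d3 d4 d5]]] := gauge_a (Y *m A1 *m A2 *m A3).
have [A5 [gA5 hA5 fA5 [e1 e3 e2]]] := gauge_b (Y *m A1 *m A2 *m A3 *m A4).
have gA : gauge (A1 *m A2 *m A3 *m A4 *m A5) by do 4![apply: gaugeM => //].
have [uA _] := gA.
have XA : X *m (A1 *m A2 *m A3 *m A4 *m A5) = cf X3 7 *: ee 7.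
  rewrite !mulmxA -/X3 X3E -!scalemxAl fA4 ?cf_ee // fA5 ?cf_ee //.
  by rewrite cfZ cf_ee //= mulr1.
have YA : Y *m (A1 *m A2 *m A3 *m A4 *m A5) =
   cf (Y *m A1 *m A2 *m A3 *m A4 *m A5) 6 *: ee 6 +
   cf (Y *m A1 *m A2 *m A3 *m A4 *m A5) 7 *: ee 7.
  rewrite !mulmxA; set Y5 := _ *m A5.
  have [k4 k5 _] := hA5 (Y *m A1 *m A2 *m A3 *m A4).
  apply: cfP => k hk; rewrite cfD !cfZ !cf_ee //.
  case: k hk => [|[|[|[|[|[|[|[|k]]]]]]]] //= _; rewrite ?mulr0 ?mulr1 ?add0r ?addr0 //.
  - by rewrite k4 d4.
  - by rewrite k5 d5.
have r0 : cf X3 7 != 0.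
  apply: contra X0 => /eqP h; rewrite -(mulmxK uA X) XA h scale0r mul0mx //.
exists (A1 *m A2 *m A3 *m A4 *m A5), (cf X3 7).
exists (cf (Y *m A1 *m A2 *m A3 *m A4 *m A5) 6), (cf (Y *m A1 *m A2 *m A3 *m A4 *m A5) 7).
split=> //.
apply/eqP => h; apply: hXY; move: YA; rewrite h scale0r add0r => YA.
exists (cf (Y *m A1 *m A2 *m A3 *m A4 *m A5) 7 / cf X3 7).
by apply: (can_inj (mulmxK uA)); rewrite YA -scalemxAl XA scalerA divfK.
Qed.

Definition frame1 c := [/\ is_lie c, lie_nilpotent c, closed3 c (@phi1 R),
  (forall v, br c (ee 7) v = 0) & (forall v k, (0 < k < 7)%N -> cf (br c (ee 6) v) k = 0)].

Lemma closed3_transport c A : gauge A -> closed3 c (@phi1 R) ->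
  closed3 (transport c A) (@phi1 R).
Proof.
move=> [uA hA]; apply: (closed3_iso uA) => [x y|u v w]; last exact: hA.
by rewrite br_transport !mulmxK.
Qed.

(** The eigenplane itself becomes the plane of e_6 and e_7. There phi1(e_7, e_6, v) is a multiple of
    the first coordinate of v, so [e_6, e_k] vanishes for the listed k. *)
Lemma frame1_eig c : is_lie c -> lie_nilpotent c -> closed3 c (@phi1 R) ->
  eigenplane c -> exists c', [/\ lie_iso c c', frame1 c' &
    forall k, (1 < k < 6)%N -> cf (br c' (ee 6) (ee k)) 7 = 0].
Proof.
move=> hl hn hc [X [Y [l [X0 cX XY hY]]]].
have [A [r [s [t [gA r0 s0 XA YA]]]]] := gauge_frame X0 XY.
have [uA hA] := gA; exists (transport c A).
have hi := transport_iso c uA.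
have e7 : ee 7 = (r^-1 *: X) *m A.
  by rewrite -scalemxAl XA scalerA mulVf // scale1r.
have e6 : ee 6 = (s^-1 *: Y - (s^-1 * t * r^-1) *: X) *m A.
  rewrite mulmxBl -!scalemxAl XA YA scalerDr !scalerA mulVf // scale1r.
  by rewrite mulfVK // addrK.
have E7 v : br (transport c A) (ee 7) v = 0.
  by rewrite br_transport e7 mulmxK // brZl cX scaler0 mul0mx.
have E6 v : br (transport c A) (ee 6) v = (s^-1 * (l * phi1 (X *m A) (Y *m A) v) * r) *: ee 7.
  rewrite br_transport e6 mulmxK // brDl brNl !brZl cX scaler0 oppr0 addr0 hY.
  have <- : phi1 X Y (v *m invmx A) = phi1 (X *m A) (Y *m A) v by rewrite -hA mulmxKV.
  by rewrite scalerA -scalemxAl XA scalerA.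
split=> //; first split=> //.
- exact: is_lie_iso hi hl.
- exact: nilpotent_iso hi hn.
- exact: closed3_transport.
- move=> v k /andP[k0 k7]; rewrite E6 cfZ cf_ee ?k0 ?(leq_trans k7) //.
  by rewrite ltn_eqF // mulr0.
move=> k hk; rewrite E6 cfZ cf_ee // mulr1 XA YA.
suff -> : phi1 (r *: ee 7) (s *: ee 6 + t *: ee 7) (ee k) = 0 by rewrite !(mulr0, mul0r).
rewrite /phi1 /ev3 !cfE !cf_ee //.
by move: k hk => [|[|[|[|[|[|k]]]]]] //= _; ring.
Qed.

(** X is central and Y is central modulo X, both obtained from [nilpotent_pick]. The last clause
    keeps track of the absence of an eigenplane. *)
Lemma frame1_exists c : is_lie c -> lie_nilpotent c -> closed3 c (@phi1 R) ->
  exists c', lie_iso c c' /\ frame1 c' /\ (eigenplane c' -> eigenplane c).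
Proof.
move=> hl hn hc.
have [X [_ X0 cX]] : exists X, [/\ True, ~ X = 0 & forall x, br c x X = 0].
  apply: (nilpotent_pick (J := fun _ => True)) => //; exists (ee 1); split=> //.
  by move=> /(congr1 (fun u => cf u 1)); rewrite cf_ee // cf0 => /eqP; rewrite oner_eq0.
have [Y [_ XY cY]] : exists Y, [/\ True, ~ (exists m : R, Y = m *: X) &
     forall x, exists m : R, br c x Y = m *: X].
  apply: (nilpotent_pick (J := fun _ => True)) => //; first by exists 0; rewrite scale0r.
  apply: NNPP => h.
  have hk k : exists m : R, ee k = m *: X.
    by apply: NNPP => h'; apply: h; exists (ee k).
  have [m1 E1] := hk 1; have [m2 E2] := hk 2.
  have := congr1 (fun u => cf u 1) E1; have := congr1 (fun u => cf u 1) E2.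
  have := congr1 (fun u => cf u 2) E2.
  rewrite !cfZ !cf_ee //= => h22 h21 h11.
  have /eqP : m2 * (m1 * cf X 1) = 0 by rewrite mulrCA -h21 mulr0.
  by rewrite -h11 mulr1 => /eqP m20; move: h22; rewrite m20 mul0r => /eqP; rewrite oner_eq0.
have X0' : X != 0 by apply/eqP.
have [A [r [s [t [gA r0 s0 XA YA]]]]] := gauge_frame X0' XY.
have [uA hA] := gA; exists (transport c A).
have hi := transport_iso c uA.
have e7 : ee 7 = (r^-1 *: X) *m A.
  by rewrite -scalemxAl XA scalerA mulVf // scale1r.
have e6 : ee 6 = (s^-1 *: Y - (s^-1 * t * r^-1) *: X) *m A.
  rewrite mulmxBl -!scalemxAl XA YA scalerDr !scalerA mulVf // scale1r.
  by rewrite mulfVK // addrK.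
have cX' v : br c X v = 0 by rewrite (br_anti hl) cX oppr0.
split=> //; split; last first.
  move=> [X' [Y' [l [nX cX1 nXY hY]]]].
  exists (X' *m invmx A), (Y' *m invmx A), l; split.
  - by apply: contra nX => /eqP h; rewrite -(mulmxKV uA X') h mul0mx.
  - move=> v; have := cX1 (v *m A); rewrite br_transport mulmxK // => h.
    by rewrite -(mulmxK uA (br _ _ _)) h mul0mx.
  - move=> [m hm]; apply: nXY; exists m.
    by rewrite -(mulmxKV uA Y') hm -scalemxAl mulmxKV.
  - move=> v; have := hY (v *m A); rewrite br_transport mulmxK // => h.
    rewrite -(mulmxK uA (br _ _ _)) h -scalemxAl -[in RHS]hA !mulmxKV //.
split.
- exact: is_lie_iso hi hl.
- exact: nilpotent_iso hi hn.
- exact: closed3_transport.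
- by move=> v; rewrite br_transport e7 mulmxK // brZl cX' scaler0 mul0mx.
move=> v k hk; rewrite br_transport e6 mulmxK // brDl brNl !brZl cX' scaler0 oppr0 addr0.
have [m hm] := cY (v *m invmx A).
case/andP: hk => k0 k7.
rewrite (br_anti hl) hm -scaleNr scalerA -scalemxAl XA scalerA cfZ cf_ee ?k0 ?(leq_trans k7) //.
by rewrite ltn_eqF // mulr0.
Qed.

End Frames.

(** * A vector that is central modulo the plane of X and Y *)

Section Frame2.
Variable R : rcfType.
Implicit Types (x y z u v w X Y E : 'rV[R]_7) (A B : 'M[R]_7) (c : sconst R).
Local Notation ee := (@ee R).

Definition inI v := forall k, (0 < k < 6)%N -> cf v k = 0.
Definition inJ v := cf v 1 = 0.

Lemma inI0 : inI 0. Proof. by move=> k _; rewrite cf0. Qed.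
Lemma inID u v : inI u -> inI v -> inI (u + v).
Proof. by move=> hu hv k hk; rewrite cfD hu ?hv ?addr0. Qed.
Lemma inIZ a v : inI v -> inI (a *: v).
Proof. by move=> hv k hk; rewrite cfZ hv ?mulr0. Qed.
Lemma inIN v : inI v -> inI (- v).
Proof. by move=> hv k hk; rewrite cfN hv ?oppr0. Qed.

Lemma inI67 k : (5 < k < 8)%N -> inI (ee k).
Proof.
move=> /andP[hk _] j /andP[j0 j6]; rewrite cf_ee ?j0 ?(leq_trans j6) //.
by rewrite ltn_eqF // (leq_trans j6).
Qed.

Lemma inIE v : inI v -> v = cf v 6 *: ee 6 + cf v 7 *: ee 7.
Proof.
move=> hv; apply: cfP => k hk; rewrite cfD !cfZ !cf_ee //.
by case: k hk => [|[|[|[|[|[|[|[|k]]]]]]]] //= _;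
   rewrite ?mulr0 ?mulr1 ?add0r ?addr0 // hv.
Qed.

Lemma frame1_J c : frame1 c -> forall x y, inJ (br c x y).
Proof.
move=> [hl _ hc h7 h6] x y; have := hc x y (ee 6) (ee 7).
have [p1 p2 p3] := @phi1_trilinear R.
have r7 v : br c v (ee 7) = 0 by rewrite (br_anti hl) h7 oppr0.
have P0 u v : phi1 0 u v = 0 by rewrite /phi1 /ev3 !cf0; ring.
have P6 u v : phi1 (br c u (ee 6)) v (ee 7) = 0.
  have H v' k := h6 v' k; rewrite (br_anti hl) /phi1 /ev3 !cfN.
  rewrite (H _ 1) // (H _ 2) // (H _ 3) // (H _ 4) // (H _ 5) // (H _ 6) // !cf_ee //=.
  ring.
rewrite !r7 !P6 !P0 !subr0 addr0 => /eqP; rewrite ?addr0 oppr_eq0 => /eqP.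
move=> h; rewrite /inJ -h /phi1 /ev3 !cf_ee //=; ring.
Qed.

Lemma frame1_I c : frame1 c -> forall x v, inI v -> inI (br c x v).
Proof.
move=> [hl _ hc h7 h6] x v /inIE ->; rewrite brDr !brZr (br_anti hl x) (br_anti hl x (ee 7)).
rewrite h7 oppr0 scaler0 addr0; apply/inIZ/inIN => k /andP[k0 k6].
by rewrite h6 // k0 (leq_trans k6).
Qed.

(* The two ways in which [E] spans a line that is central modulo [I]: either
   the 4-dimensional reduction is abelian and [E] is in the last nonzero power of
   the derivation [ad e1], or it is not and [E] lies in its derived algebra. *)
Definition topcond c E :=
  (forall x y, inJ x -> inJ y -> inI (br c x y)) /\
  ((forall v, inJ v -> inI (br c (ee 1) v)) \/
   exists u, [/\ inJ u, inI (br c (ee 1) u - E) &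
     (forall v, inJ v -> inI (br c (ee 1) (br c (ee 1) v))) \/
     exists u', inJ u' /\ inI (br c (ee 1) u' - u)]).

Definition dercond c E := forall l : 'cV[R]_7,
  (forall x y, inJ x -> inJ y -> br c x y *m l = 0) -> ee 6 *m l = 0 -> ee 7 *m l = 0 ->
  E *m l = 0.

Lemma J_not_I : exists v, inJ v /\ ~ inI v.
Proof.
exists (ee 2); split; first by rewrite /inJ cf_ee.
by move=> /(_ 2 isT) /eqP; rewrite cf_ee // oner_eq0.
Qed.

(** If J modulo I is not abelian, the span of [J, J] and I is an ideal larger than I and E is picked
    there. If it is abelian, J acts trivially on it, so a vector E of J is central modulo I as soon
    as [e_1, E] lies in I. *)
Lemma pick_E0 c : frame1 c -> exists E, [/\ inJ E, ~ inI E,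
  forall x, inI (br c x E) & topcond c E \/ dercond c E].
Proof.
move=> hf; have [hl hn hc h7 h6] := hf; have hJ := frame1_J hf; have hI := frame1_I hf.
case: (classic (forall x y, inJ x -> inJ y -> inI (br c x y))) => [ab|nab]; last first.
  (* Membership in the span of [J, J] and I is expressed by the linear functionals that vanish on
     it; stability under ad x is then a matter of precomposing the functional with the matrix of ad
     x. *)
  pose J v := inJ v /\ forall l : 'cV[R]_7,
   (forall x y, inJ x -> inJ y -> br c x y *m l = 0) -> ee 6 *m l = 0 -> ee 7 *m l = 0 ->
     v *m l = 0.
  have [E [[E1 EJ] EI cE]] : exists v, [/\ J v, ~ inI v & forall x, inI (br c x v)].
    apply: (nilpotent_pick hn inI0) => [x v [v1 vJ]|].
      split=> // l hl1 hl6 hl7.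
      have l7 u : inI u -> u *m l = 0.
        by move=> /inIE ->; rewrite mulmxDl -!scalemxAl hl6 hl7 !scaler0 addr0.
      pose B := \matrix_(i < 7) br c x (delta_mx 0 i : 'rV[R]_7).
      have EB u : u *m B = br c x u.
        apply/eqP; rewrite -subr_eq0; apply/eqP; move: u.
        apply: linear_ext => [a u u'|i].
          by rewrite mulmxDl -scalemxAl brDr brZr scalerBr opprD addrACA.
        by rewrite -rowE rowK subrr.
      rewrite -EB -mulmxA; apply: vJ => [a b a1 b1||]; rewrite mulmxA EB.
      - by rewrite (br_jacobi hl) mulmxDl !hl1 ?addr0 //; apply: hJ.
      - by apply: l7; apply/hI/inI67.
      - by rewrite (br_anti hl) h7 oppr0 mul0mx.
    apply: NNPP => hno; apply: nab => x y hx hy; apply: NNPP => hxy; apply: hno.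
    exists (br c x y); split=> //; split=> //.
    by move=> l hl1 _ _; apply: hl1.
  by exists E; split=> //; right.
case: (classic (forall v, inJ v -> inI (br c (ee 1) v))) => [D0|D0].
  have [E [E1 EI cE]] := nilpotent_pick hn inI0 (J := inJ) (fun x v _ => hJ x v) J_not_I.
  by exists E; split=> //; left; split=> //; left.
have central v : inJ v -> inI (br c (ee 1) v) -> forall x, inI (br c x v).
  move=> v1 hv x; have -> : x = cf x 1 *: ee 1 + (x - cf x 1 *: ee 1) by rewrite addrC subrK.
  rewrite brDl brZl; apply: inID; first exact: inIZ.
  by apply: ab => //; rewrite /inJ cfD cfN cfZ cf_ee // mulr1 subrr.
have brB u v : br c (ee 1) (u - v) = br c (ee 1) u - br c (ee 1) v by rewrite brDr brNr.
case: (classic (forall v, inJ v -> inI (br c (ee 1) (br c (ee 1) v)))) => [D2|D2].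
  have [u hu] := not_all_ex_not _ _ D0.
  have [u1 Du] := imply_to_and _ _ hu.
  exists (br c (ee 1) u); split=> //.
    by apply: central; [apply: hJ | apply: D2].
  left; split=> //; right; exists u; split=> //; first by rewrite subrr; apply: inI0.
  by left.
(* With D = ad e_1, the vector u' has D^2 u' outside I and D^3 u' inside, so u', D u', D^2 u' is the
   chain asked for by [topcond]. *)
have [u' [u1 Du Du2]] : exists v, [/\ inJ v, ~ inI (br c (ee 1) (br c (ee 1) v)) &
    forall x, inI (br c (ee 1) (br c (ee 1) (br c x v)))].
  apply: (nilpotent_pick hn (I := fun v => inI (br c (ee 1) (br c (ee 1) v)))) => //.
  - by rewrite !br0r; apply: inI0.
  - have [u hu] := not_all_ex_not _ _ D2; have [u1 Du] := imply_to_and _ _ hu.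
    by exists u.
exists (br c (ee 1) (br c (ee 1) u')); split=> //.
  by apply: central; [apply: hJ | apply: Du2].
left; split=> //; right; exists (br c (ee 1) u'); split.
- exact: hJ.
- by rewrite subrr; apply: inI0.
- by right; exists u'; split=> //; rewrite subrr; apply: inI0.
Qed.

Definition frame2 c := [/\ frame1 c, forall v, inI (br c (ee 2) v) &
  topcond c (ee 2) \/ dercond c (ee 2)].

Lemma eigenplane_transport c A : gauge A -> eigenplane (transport c A) -> eigenplane c.
Proof.
move=> [uA hA] [X' [Y' [l [nX cX1 nXY hY]]]].
exists (X' *m invmx A), (Y' *m invmx A), l; split.
- by apply: contra nX => /eqP h; rewrite -(mulmxKV uA X') h mul0mx.
- move=> v; have := cX1 (v *m A); rewrite br_transport mulmxK // => h.
  by rewrite -(mulmxK uA (br _ _ _)) h mul0mx.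
- move=> [m hm]; apply: nXY; exists m.
  by rewrite -(mulmxKV uA Y') hm -scalemxAl mulmxKV.
- move=> v; have := hY (v *m A); rewrite br_transport mulmxK // => h.
  rewrite -(mulmxK uA (br _ _ _)) h -scalemxAl -[in RHS]hA !mulmxKV //.
Qed.

(** A rotation of the coordinates 2 to 5 brings E, modulo I, to the line of e_2. It fixes e_1, e_6
    and e_7 and preserves the first coordinate, hence all earlier normalizations. *)
Lemma frame2_exists c : frame1 c -> exists c', [/\ lie_iso c c', frame2 c',
  eigenplane c' -> eigenplane c &
  (forall v, inJ v -> br c (ee 6) v = 0) -> (forall v, inJ v -> br c' (ee 6) v = 0)].
Proof.
move=> hf; have [E [E1 EI cE hE]] := pick_E0 hf; have [hl hn hc h7 h6] := hf.
have [A [gA f167 fA [e3 e4 e5]]] := gauge_a E.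
have [uA hA] := gA; have hi := transport_iso c uA.
have fee k : (k == 1)%N || (k == 6)%N || (k == 7)%N -> ee k *m A = ee k.
  by move=> hk; apply: fA; rewrite cf_ee //; case: k hk => [|[|[|[|[|[|[|[|]]]]]]]].
have feV k : (k == 1)%N || (k == 6)%N || (k == 7)%N -> ee k *m invmx A = ee k.
  by move=> hk; rewrite -{1}(fee k hk) mulmxK.
have fI v : inI v -> v *m A = v by move=> hv; apply: fA; apply: hv.
have fIV v : inI v -> v *m invmx A = v by move=> hv; rewrite -{1}(fI v hv) mulmxK.
have fJ v : cf (v *m A) 1 = cf v 1 by have [] := f167 v.
have fJV v : cf (v *m invmx A) 1 = cf v 1 by rewrite -[in RHS](mulmxKV uA v) fJ.
have fIr v : inI (v *m A) -> inI v by move=> hv; rewrite -(mulmxK uA v) fIV.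
pose r := cf (E *m A) 2.
have EA : E *m A = r *: ee 2 + (cf E 6 *: ee 6 + cf E 7 *: ee 7).
  have [_ g6 g7] := f167 E.
  apply: cfP => k hk; rewrite !cfD !cfZ !cf_ee //.
  by case: k hk => [|[|[|[|[|[|[|[|k]]]]]]]] //= _;
   rewrite ?mulr0 ?mulr1 ?add0r ?addr0 // fJ.
have r0 : r != 0.
  apply/eqP => h; apply: EI; apply: fIr; rewrite EA h scale0r add0r.
  by apply: inID; apply/inIZ/inI67.
pose E' := r^-1 *: (E - (cf E 6 *: ee 6 + cf E 7 *: ee 7)).
have in67 a b : inI (a *: ee 6 + b *: ee 7).
  by apply: inID; apply/inIZ/inI67.
have E'A : E' *m A = ee 2.
  rewrite -scalemxAl mulmxBl EA mulmxDl -!scalemxAl !fee // addrK.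
  by rewrite scalerA mulVf // scale1r.
have E'V : ee 2 *m invmx A = E' by rewrite -E'A mulmxK.
have cE' x : inI (br c x E').
  rewrite brZr brDr brNr; apply/inIZ/inID => //; apply/inIN; apply: (frame1_I hf); exact: in67.
exists (transport c A); split=> //; last first.
- by move=> h v hv; rewrite br_transport feV // h ?mul0mx // /inJ fJV.
- exact: eigenplane_transport.
split.
- split.
  + exact: is_lie_iso hi hl.
  + exact: nilpotent_iso hi hn.
  + exact: closed3_transport.
  + by move=> v; rewrite br_transport feV // h7 mul0mx.
  + move=> v k hk; rewrite br_transport feV //.
    rewrite fI ?h6 // => j /andP[j0 j6]; apply: h6; rewrite j0 /=.
    exact: (leq_trans j6).
- move=> v; rewrite br_transport E'V.
  have h : inI (br c E' (v *m invmx A)) by rewrite (br_anti hl); apply: inIN.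
  by rewrite fI.
case: hE => [[ab hD]|hE]; [left|right].
  split=> [x y hx hy|].
    rewrite br_transport; have h : inI (br c (x *m invmx A) (y *m invmx A)).
      by apply: ab; rewrite /inJ fJV.
    by rewrite fI.
  case: hD => [D0|[u [u1 Du hD]]]; [left|right].
    move=> v hv; rewrite br_transport feV //.
    have h : inI (br c (ee 1) (v *m invmx A)) by apply: D0; rewrite /inJ fJV.
    by rewrite fI.
  exists ((r^-1 *: u) *m A); split; first by rewrite /inJ fJ cfZ u1 mulr0.
    rewrite br_transport feV // mulmxK // brZr -E'A -mulmxBl /E' -scalerBr.
    have h : inI (r^-1 *: (br c (ee 1) u - (E - (cf E 6 *: ee 6 + cf E 7 *: ee 7)))).
      by rewrite opprB addrCA; apply/inIZ/inID.
    by rewrite fI.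
  case: hD => [D2|[u' [u1' Du']]]; [left|right].
    move=> v hv; rewrite !br_transport !feV // mulmxK //.
    have h : inI (br c (ee 1) (br c (ee 1) (v *m invmx A))) by apply: D2; rewrite /inJ fJV.
    by rewrite fI.
  exists ((r^-1 *: u') *m A); split; first by rewrite /inJ fJ cfZ u1' mulr0.
  have h : inI (r^-1 *: (br c (ee 1) u' - u)) by apply: inIZ.
  by rewrite br_transport feV // mulmxK // brZr -mulmxBl -scalerBr fI.
move=> l hl1 hl6 hl7.
rewrite -E'A -mulmxA -scalemxAl mulmxBl mulmxDl -!scalemxAl !mulmxA !fee //.
rewrite hl6 hl7 !scaler0 addr0 subr0 -mulmxA hE ?scaler0 //.
- move=> x y hx hy; rewrite mulmxA; have := hl1 (x *m A) (y *m A).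
  by rewrite br_transport !mulmxK //; apply; rewrite /inJ fJ.
- by rewrite mulmxA fee.
- by rewrite mulmxA fee.
Qed.

End Frame2.

(** * Traces of nilpotent operators *)

Section NilpotentTrace.
Variable F : fieldType.

(** X - M divides X^m - M^m = X^m, so the characteristic polynomial divides a power of X and equals
    X^(n+1) by its degree; its second coefficient is minus the trace. *)
Lemma nilpotent_trace n (M : 'M[F]_n.+1) m : M ^+ m = 0 -> \tr M = 0.
Proof.
move=> hM.
have e : ('X%:M : 'M[{poly F}]_n.+1) ^+ m - (map_mx polyC M) ^+ m = ('X^m)%:M.
  by rewrite -!rmorphXn /= hM map_mx0 subr0.
have hc : GRing.comm ('X%:M : 'M[{poly F}]_n.+1) (map_mx polyC M).
  exact: comm_scalar_mx.
rewrite (subrXX_comm _ hc) -/(char_poly_mx M) in e.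
have := congr1 determinant e; rewrite det_mulmx det_scalar -/(char_poly M) -exprM.
set q := \det _ => hq.
have dv : char_poly M %| ('X - 0%:P) ^+ (m * n.+1).
  by rewrite subr0 -hq dvdp_mulr.
have [k _] := dvdp_exp_XsubCP dv; rewrite subr0 => hk.
have E : char_poly M = 'X^k.
  by apply/eqP; rewrite -eqp_monic ?char_poly_monic ?monicXn.
have kn : k = n.+1.
  by have := size_char_poly M; rewrite E size_polyXn => -[].
have := char_poly_trace M (ltn0Sn n); rewrite E kn coefXn /= ltn_eqF // => /esym/eqP.
by rewrite oppr_eq0 => /eqP.
Qed.

End NilpotentTrace.

(** * Structure equations forced by closedness *)

Section Model.
Variable R : rcfType.
Implicit Types (x y z u v w X Y E : 'rV[R]_7) (c : sconst R).
Local Notation ee := (@ee R).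

(** [S] is a subspace stable under ad x and [r] is a chart of a quotient of it, on which ad x acts
    by [M]. Some power of ad x vanishes, hence so does that power of [M]. *)
Lemma lie_nilpotent_trace c x n (S : 'rV[R]_7 -> Prop) (r : 'rV[R]_7 -> 'rV[R]_n.+1)
    (M : 'M[R]_n.+1) : lie_nilpotent c ->
  (forall v, S v -> S (br c x v)) -> (forall v, S v -> r (br c x v) = r v *m M) ->
  r 0 = 0 -> (forall t : 'rV_n.+1, exists2 v, S v & r v = t) -> \tr M = 0.
Proof.
move=> [m hm] hS hr r0 hs; apply: (@nilpotent_trace _ _ _ m).
apply/row_matrixP => i; rewrite row0 rowE.
have [v Sv <-] := hs (delta_mx 0 i).
have H k : S (foldr (br c) v (nseq k x)) /\
  r (foldr (br c) v (nseq k x)) = r v *m (M ^+ k).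
  elim: k => [|k [Sk rk]] /=; first by rewrite expr0 mulmx1.
  by split; [apply: hS | rewrite hr // rk exprSr mulmxA].
by have [_ <-] := H m; rewrite hm ?size_nseq.
Qed.

Lemma ee_decomp v : v = cf v 1 *: ee 1 + (cf v 2 *: ee 2 + (cf v 3 *: ee 3 +
  (cf v 4 *: ee 4 + (cf v 5 *: ee 5 + (cf v 6 *: ee 6 + cf v 7 *: ee 7))))).
Proof.
apply: cfP => k hk; rewrite !cfD !cfZ !cf_ee //.
by case: k hk => [|[|[|[|[|[|[|[|k]]]]]]]] //= _; rewrite ?(mulr0, mulr1, add0r, addr0).
Qed.

Lemma cf_br_r c x v k : cf (br c x v) k = cf v 1 * cf (br c x (ee 1)) k +
  (cf v 2 * cf (br c x (ee 2)) k + (cf v 3 * cf (br c x (ee 3)) k +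
  (cf v 4 * cf (br c x (ee 4)) k + (cf v 5 * cf (br c x (ee 5)) k +
  (cf v 6 * cf (br c x (ee 6)) k + cf v 7 * cf (br c x (ee 7)) k))))).
Proof. by rewrite {1}(ee_decomp v) !brDr !brZr !cfD !cfZ. Qed.

(* The coframe is (w, x0, x1, x2, x3, y, eta) of [phi1]; the coefficients of dy
   and d eta are the ones forced by d phi1 = 0. *)
Definition model (f1 f2 f3 m11 m12 m13 m21 m22 m23 m31 m32 m33 u2 u3 n22 n23 n32 d0 d1 d2 d3 : R)
  : seq (seq (R * nat * nat)) :=
 [:: [::];
 [:: trm (f1) 1 3; trm (f2) 1 4; trm (f3) 1 5; trm (u2) 3 4; trm (u3) 3 5];
 [:: trm (m11) 1 3; trm (m12) 1 4; trm (m13) 1 5];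
 [:: trm (m21) 1 3; trm (m22) 1 4; trm (m23) 1 5; trm (n22) 3 4; trm (n23) 3 5];
 [:: trm (m31) 1 3; trm (m32) 1 4; trm (m33) 1 5; trm (n32) 3 4; trm (- n22) 3 5];
 [:: trm (d0) 1 2; trm (d1) 1 3; trm (d2) 1 4; trm (d3) 1 5; trm (m11) 2 3; trm (m12) 2 4; trm (m13) 2 5;
     trm (- f2 - m31) 3 4; trm (m21 - f3) 3 5; trm (m22 + m33) 4 5];
 [:: trm (- d3) 1 2; trm (u2 - d2) 1 3; trm (d1 - n32) 1 4; trm (d0 + n22) 1 5;
     trm (m21 - m12 - f3) 6 1; trm (- f3 - m12) 2 3; trm (- m22) 2 4; trm (- m23) 2 5;
     trm (m32 - f1) 3 4; trm (m11 + m33) 3 5; trm (- u3) 6 3; trm (m21) 4 5; trm (- n22) 6 4; trm (- n23) 6 5]].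

Lemma phi1_ee u :
  (phi1 u (ee 1) (ee 2) = cf u 5) *
  (phi1 u (ee 1) (ee 3) = cf u 4) *
  (phi1 u (ee 1) (ee 4) = - cf u 3) *
  (phi1 u (ee 1) (ee 5) = - cf u 2) *
  (phi1 u (ee 1) (ee 6) = cf u 7) *
  (phi1 u (ee 1) (ee 7) = - cf u 6) *
  (phi1 u (ee 2) (ee 3) = cf u 7) *
  (phi1 u (ee 2) (ee 4) = cf u 6) *
  (phi1 u (ee 2) (ee 5) = cf u 1) *
  (phi1 u (ee 2) (ee 6) = - cf u 4) *
  (phi1 u (ee 2) (ee 7) = - cf u 3) *
  (phi1 u (ee 3) (ee 4) = cf u 1) *
  (phi1 u (ee 3) (ee 5) = - cf u 6) *
  (phi1 u (ee 3) (ee 6) = cf u 5) *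
  (phi1 u (ee 3) (ee 7) = cf u 2) *
  (phi1 u (ee 4) (ee 5) = cf u 7) *
  (phi1 u (ee 4) (ee 6) = cf u 2) *
  (phi1 u (ee 4) (ee 7) = - cf u 5) *
  (phi1 u (ee 5) (ee 6) = - cf u 3) *
  (phi1 u (ee 5) (ee 7) = cf u 4) *
  (phi1 u (ee 6) (ee 7) = cf u 1).
Proof. by do ![split]; rewrite /phi1 /ev3 !cf_ee //=; ring. Qed.

(** The last three zeros come from closedness on (e_2, e_a, e_b, e_7): brackets with e_2 lie in I
    and pair to zero because e_a and e_b lie in ker w, so only phi1([e_a, e_b], e_2, e_7) is left,
    minus the third coordinate of the bracket. *)
Lemma frame2_zeros c : frame2 c ->
  [/\ forall x y, cf (br c x y) 1 = 0,
      forall x k, (0 < k < 6)%N -> cf (br c x (ee 2)) k = 0,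
      forall x k, (0 < k < 7)%N -> cf (br c x (ee 6)) k = 0,
      forall x, br c x (ee 7) = 0 &
      [/\ cf (br c (ee 3) (ee 4)) 3 = 0, cf (br c (ee 3) (ee 5)) 3 = 0 &
          cf (br c (ee 4) (ee 5)) 3 = 0]].
Proof.
move=> [hf h2 _]; have [hl _ hc h7 h6] := hf.
have Z1 := frame1_J hf.
have Z2 x k : (0 < k < 6)%N -> cf (br c x (ee 2)) k = 0.
  by move=> hk; rewrite (br_anti hl) cfN h2 // oppr0.
have Z6 x k : (0 < k < 7)%N -> cf (br c x (ee 6)) k = 0.
  by move=> hk; rewrite (br_anti hl) cfN h6 // oppr0.
have Z7 x : br c x (ee 7) = 0 by rewrite (br_anti hl) h7 oppr0.
have Z3 a b : cf (br c (ee a) (ee b)) 3 * (a \in [:: 3; 4; 5])%N%:R * (b \in [:: 3; 4; 5])%N%:R = 0.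
  case ha: (a \in _)%N; last by rewrite mulr0 mul0r.
  case hb: (b \in _)%N; last by rewrite mulr0.
  rewrite !mulr1; have := hc (ee 2) (ee a) (ee b) (ee 7).
  rewrite !Z7 /phi1 /ev3 !cf0.
  have P k : (0 < k < 6)%N -> cf (br c (ee 2) (ee a)) k = 0 by exact: h2.
  have P' k : (0 < k < 6)%N -> cf (br c (ee 2) (ee b)) k = 0 by exact: h2.
  rewrite !(P 1%N, P 2%N, P 3%N, P 4%N, P 5%N) // !(P' 1%N, P' 2%N, P' 3%N, P' 4%N, P' 5%N) //.
  rewrite !Z1 !cf_ee //; move: ha hb; rewrite !inE.
  by move=> /or3P[] /eqP -> /or3P[] /eqP -> /=; rewrite ?mulr0n ?mulr1n => h; clear -h; lra.
split=> //; split.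
- by have := Z3 3%N 4%N; rewrite !inE !eqxx !mulr1.
- by have := Z3 3%N 5%N; rewrite !inE !eqxx !mulr1.
- by have := Z3 4%N 5%N; rewrite !inE !eqxx !mulr1.
Qed.

(** Each relation is a vanishing trace on a subquotient: of ad e_4 on the line of e_5, of ad e_5 on
    the line of e_4, of ad e_3 on the plane of e_4 and e_5, and of ad e_1 on the space of e_3, e_4,
    e_5. *)
Lemma frame2_traces c : frame2 c ->
  [/\ cf (br c (ee 4) (ee 5)) 5 = 0, cf (br c (ee 4) (ee 5)) 4 = 0,
      cf (br c (ee 3) (ee 4)) 4 + cf (br c (ee 3) (ee 5)) 5 = 0 &
      cf (br c (ee 1) (ee 3)) 3 + cf (br c (ee 1) (ee 4)) 4 + cf (br c (ee 1) (ee 5)) 5 = 0].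
Proof.
move=> hf2; have [Z1 Z2 Z6 Z7 [Z34 Z35 Z45]] := frame2_zeros hf2.
have [[hl hn hc h7 h6] _ _] := hf2.
have A0 x : br c x x = 0 by exact: br_alt.
pose S v := cf v 1 = 0 /\ cf v 3 = 0.
have T45 a b (M : R) : (a, b) = (4, 5)%N \/ (a, b) = (5, 4)%N ->
    M = cf (br c (ee a) (ee b)) b -> M = 0.
  move=> hab hM.
  have := @lie_nilpotent_trace c (ee a) 0 S (fun v => (cf v b)%:M) M%:M hn.
  rewrite mxtrace_scalar mulr1n; apply.
  - move=> v [v1 v3]; split; first exact: Z1.
    rewrite cf_br_r v1 v3 Z2 // Z6 // Z7 cf0.
    case: hab => -[ea eb]; rewrite ?ea ?eb ?A0 ?cf0 ?(br_anti hl (ee 5) (ee 4)) ?cfN ?Z45; ring.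
  - move=> v [v1 v3]; rewrite -scalar_mxM; congr (_%:M).
    rewrite cf_br_r v1 v3 hM Z7 cf0.
    by case: hab => -[ea eb]; rewrite ?ea ?eb ?Z2 // ?Z6 // ?A0 ?cf0; ring.
  - by rewrite cf0 raddf0.
  - move=> t; exists (t 0 0 *: ee b).
      by rewrite /S !cfZ !cf_ee //; case: hab => -[_ ->]; rewrite /= !mulr0.
    rewrite cfZ cf_ee ?eqxx ?mulr1; last by case: hab => -[_ ->].
    by rewrite -mx11_scalar.
split.
- by apply: (T45 4%N 5%N) => //; left.
- have : cf (br c (ee 5) (ee 4)) 4 = 0 by apply: (T45 5%N 4%N) => //; right.
  by rewrite (br_anti hl) cfN => /eqP; rewrite oppr_eq0 => /eqP.
- pose rr v : 'rV[R]_2 := \row_(i < 2) cf v (i + 4)%N.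
  pose M : 'M[R]_2 := \matrix_(i < 2, j < 2) cf (br c (ee 3) (ee (i + 4)%N)) (j + 4)%N.
  have := @lie_nilpotent_trace c (ee 3) 1 S rr M hn.
  rewrite /mxtrace !big_ord_recl big_ord0 addr0 !mxE /=; apply.
  + move=> v [v1 v3]; split; first exact: Z1.
    by rewrite cf_br_r v1 v3 Z2 // Z6 // Z7 cf0 Z34 Z35; ring.
  + move=> v [v1 v3]; apply/rowP => i; rewrite !mxE !big_ord_recl big_ord0 !mxE /=.
    rewrite cf_br_r v1 A0 cf0 Z7 cf0.
    by case: i => [[|[|i]] hi] //=; rewrite Z2 // Z6 //; ring.
  + by apply/rowP => i; rewrite !mxE cf0.
  + move=> t; exists (t 0 0 *: ee 4 + t 0 1 *: ee 5).
      by rewrite /S !cfD !cfZ !cf_ee //= !mulr0 addr0.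
    apply/rowP => i; rewrite !mxE cfD !cfZ.
    by case: i => [[|[|i]] hi] //=; rewrite !cf_ee //= ?(mulr0, mulr1, addr0, add0r);
       congr (t _ _); apply/val_inj.
pose rr v : 'rV[R]_3 := \row_(i < 3) cf v (i + 3)%N.
pose M : 'M[R]_3 := \matrix_(i < 3, j < 3) cf (br c (ee 1) (ee (i + 3)%N)) (j + 3)%N.
have := @lie_nilpotent_trace c (ee 1) 2 (fun v => cf v 1 = 0) rr M hn.
rewrite /mxtrace !big_ord_recl big_ord0 addr0 !mxE /= addrA; apply.
- by move=> v v1; apply: Z1.
- move=> v v1; apply/rowP => i; rewrite !mxE !big_ord_recl big_ord0 !mxE /=.
  rewrite cf_br_r v1 Z7 cf0.
  by case: i => [[|[|[|i]]] hi] //=; rewrite Z2 // Z6 //; ring.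
- by apply/rowP => i; rewrite !mxE cf0.
- move=> t; exists (t 0 0 *: ee 3 + t 0 1 *: ee 4 + t 0 2%:R *: ee 5).
    by rewrite !cfD !cfZ !cf_ee //= !mulr0 !addr0.
  apply/rowP => i; rewrite !mxE !cfD !cfZ.
  by case: i => [[|[|[|i]]] hi] //=; rewrite !cf_ee //= ?(mulr0, mulr1, addr0, add0r);
     congr (t _ _); apply/val_inj.
Qed.

Lemma cf_br_expand c u v k : is_lie c -> cf (br c u v) k =
  cf (br c (ee 1) (ee 2)) k * (cf u 1 * cf v 2 - cf u 2 * cf v 1) +
  cf (br c (ee 1) (ee 3)) k * (cf u 1 * cf v 3 - cf u 3 * cf v 1) +
  cf (br c (ee 1) (ee 4)) k * (cf u 1 * cf v 4 - cf u 4 * cf v 1) +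
  cf (br c (ee 1) (ee 5)) k * (cf u 1 * cf v 5 - cf u 5 * cf v 1) +
  cf (br c (ee 1) (ee 6)) k * (cf u 1 * cf v 6 - cf u 6 * cf v 1) +
  cf (br c (ee 1) (ee 7)) k * (cf u 1 * cf v 7 - cf u 7 * cf v 1) +
  cf (br c (ee 2) (ee 3)) k * (cf u 2 * cf v 3 - cf u 3 * cf v 2) +
  cf (br c (ee 2) (ee 4)) k * (cf u 2 * cf v 4 - cf u 4 * cf v 2) +
  cf (br c (ee 2) (ee 5)) k * (cf u 2 * cf v 5 - cf u 5 * cf v 2) +
  cf (br c (ee 2) (ee 6)) k * (cf u 2 * cf v 6 - cf u 6 * cf v 2) +
  cf (br c (ee 2) (ee 7)) k * (cf u 2 * cf v 7 - cf u 7 * cf v 2) +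
  cf (br c (ee 3) (ee 4)) k * (cf u 3 * cf v 4 - cf u 4 * cf v 3) +
  cf (br c (ee 3) (ee 5)) k * (cf u 3 * cf v 5 - cf u 5 * cf v 3) +
  cf (br c (ee 3) (ee 6)) k * (cf u 3 * cf v 6 - cf u 6 * cf v 3) +
  cf (br c (ee 3) (ee 7)) k * (cf u 3 * cf v 7 - cf u 7 * cf v 3) +
  cf (br c (ee 4) (ee 5)) k * (cf u 4 * cf v 5 - cf u 5 * cf v 4) +
  cf (br c (ee 4) (ee 6)) k * (cf u 4 * cf v 6 - cf u 6 * cf v 4) +
  cf (br c (ee 4) (ee 7)) k * (cf u 4 * cf v 7 - cf u 7 * cf v 4) +
  cf (br c (ee 5) (ee 6)) k * (cf u 5 * cf v 6 - cf u 6 * cf v 5) +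
  cf (br c (ee 5) (ee 7)) k * (cf u 5 * cf v 7 - cf u 7 * cf v 5) +
  cf (br c (ee 6) (ee 7)) k * (cf u 6 * cf v 7 - cf u 7 * cf v 6).
Proof.
move=> hl; have A0 a : cf (br c (ee a) (ee a)) k = 0 by rewrite br_alt ?cf0.
rewrite cf_br_r.
have E x b : cf (br c x (ee b)) k = - cf (br c (ee b) x) k by rewrite (br_anti hl) cfN.
rewrite !(E u) !(cf_br_r _ _ u) !A0.
rewrite (E (ee 2) 1) (E (ee 3) 1) (E (ee 4) 1) (E (ee 5) 1) (E (ee 6) 1) (E (ee 7) 1) (E (ee 3) 2) (E (ee 4) 2) (E (ee 5) 2) (E (ee 6) 2) (E (ee 7) 2) (E (ee 4) 3) (E (ee 5) 3) (E (ee 6) 3) (E (ee 7) 3) (E (ee 5) 4) (E (ee 6) 4) (E (ee 7) 4) (E (ee 6) 5) (E (ee 7) 5) (E (ee 7) 6).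
ring.
Qed.

(** Closedness is linear in the structure constants; [C1234] is its value on e_1, e_2, e_3, e_4, and
    so on. It leaves free in dy only the components of [e_1, e_j] along e_6, for j from 2 to 5, and
    determines d eta from the other differentials. *)
Lemma frame2_lc c : frame2 c ->
  let g a b k := cf (br c (ee a) (ee b)) k in
  let d := (model (- g 1 3 2) (- g 1 4 2) (- g 1 5 2) (- g 1 3 3) (- g 1 4 3) (- g 1 5 3) (- g 1 3 4) (- g 1 4 4) (- g 1 5 4) (- g 1 3 5) (- g 1 4 5) (- g 1 5 5) (- g 3 4 2) (- g 3 5 2) (- g 3 4 4) (- g 3 5 4) (- g 3 4 5) (- g 1 2 6) (- g 1 3 6) (- g 1 4 6) (- g 1 5 6)) in
  (forall i j k, c i j k = lc d i j k) /\ g 1 3 3 + g 1 4 4 + g 1 5 5 = 0.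
Proof.
move=> hf2 g d; have [T455 T454 TN TM] := frame2_traces hf2.
have [Z1 Z2 Z6 Z7 [Z34 Z35 Z45]] := frame2_zeros hf2.
have [[hl hn hc h7 h6] h2 _] := hf2.
have A0 x : br c x x = 0 by exact: br_alt.
have {}TN : g 3 4 4 + g 3 5 5 = 0 by [].
pose zs := (fun x y => Z1 x y, fun x => Z2 x 2%N isT, fun x => Z2 x 3%N isT, fun x => Z2 x 4%N isT,
  fun x => Z2 x 5%N isT, fun x => h2 x 2%N isT, fun x => h2 x 3%N isT, fun x => h2 x 4%N isT,
  fun x => h2 x 5%N isT, fun x => Z6 x 2%N isT, fun x => Z6 x 3%N isT, fun x => Z6 x 4%N isT,
  fun x => Z6 x 5%N isT, fun x => Z6 x 6%N isT, Z7, h7, A0, T455, T454, Z34, Z35, Z45, @cf0 R).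

have C1234 : g 1 3 6 - g 1 4 7 - g 3 4 5 = 0.
  by have := hc (ee 1) (ee 2) (ee 3) (ee 4); rewrite !phi1_ee ?zs => h; rewrite -[RHS]h /g; ring.
have C1235 : g 1 2 6 - g 1 5 7 - g 3 5 5 = 0.
  by have := hc (ee 1) (ee 2) (ee 3) (ee 5); rewrite !phi1_ee ?zs => h; rewrite -[RHS]h /g; ring.
have C1236 : - g 1 3 4 - g 1 6 7 - g 2 3 7 = 0.
  by have := hc (ee 1) (ee 2) (ee 3) (ee 6); rewrite !phi1_ee ?zs => h; rewrite -[RHS]h /g; ring.
have C1237 : - g 1 3 3 + g 2 3 6 = 0.
  by have := hc (ee 1) (ee 2) (ee 3) (ee 7); rewrite !phi1_ee ?zs => h; rewrite -[RHS]h /g; ring.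
have C1245 : - g 1 2 7 - g 1 5 6 = 0.
  by have := hc (ee 1) (ee 2) (ee 4) (ee 5); rewrite !phi1_ee ?zs => h; rewrite -[RHS]h /g; ring.
have C1246 : - g 1 4 4 - g 2 4 7 = 0.
  by have := hc (ee 1) (ee 2) (ee 4) (ee 6); rewrite !phi1_ee ?zs => h; rewrite -[RHS]h /g; ring.
have C1247 : - g 1 4 3 + g 2 4 6 = 0.
  by have := hc (ee 1) (ee 2) (ee 4) (ee 7); rewrite !phi1_ee ?zs => h; rewrite -[RHS]h /g; ring.
have C1256 : - g 1 5 4 - g 2 5 7 = 0.
  by have := hc (ee 1) (ee 2) (ee 5) (ee 6); rewrite !phi1_ee ?zs => h; rewrite -[RHS]h /g; ring.
have C1257 : - g 1 5 3 + g 2 5 6 = 0.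
  by have := hc (ee 1) (ee 2) (ee 5) (ee 7); rewrite !phi1_ee ?zs => h; rewrite -[RHS]h /g; ring.
have C1345 : - g 1 3 7 - g 1 4 6 + g 3 4 2 = 0.
  by have := hc (ee 1) (ee 3) (ee 4) (ee 5); rewrite !phi1_ee ?zs => h; rewrite -[RHS]h /g; ring.
have C1346 : - g 1 3 2 + g 1 4 5 - g 3 4 7 = 0.
  by have := hc (ee 1) (ee 3) (ee 4) (ee 6); rewrite !phi1_ee ?zs => h; rewrite -[RHS]h /g; ring.
have C1347 : g 1 3 5 + g 1 4 2 + g 3 4 6 = 0.
  by have := hc (ee 1) (ee 3) (ee 4) (ee 7); rewrite !phi1_ee ?zs => h; rewrite -[RHS]h /g; ring.
have C1356 : g 1 3 3 + g 1 5 5 - g 3 5 7 = 0.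
  by have := hc (ee 1) (ee 3) (ee 5) (ee 6); rewrite !phi1_ee ?zs => h; rewrite -[RHS]h /g; ring.
have C1357 : - g 1 3 4 + g 1 5 2 + g 3 5 6 = 0.
  by have := hc (ee 1) (ee 3) (ee 5) (ee 7); rewrite !phi1_ee ?zs => h; rewrite -[RHS]h /g; ring.
have C1456 : g 1 4 3 + g 1 5 2 - g 1 6 7 - g 4 5 7 = 0.
  by have := hc (ee 1) (ee 4) (ee 5) (ee 6); rewrite !phi1_ee ?zs => h; rewrite -[RHS]h /g; ring.
have C1457 : - g 1 4 4 - g 1 5 5 + g 4 5 6 = 0.
  by have := hc (ee 1) (ee 4) (ee 5) (ee 7); rewrite !phi1_ee ?zs => h; rewrite -[RHS]h /g; ring.
have C2345 : - g 2 3 7 - g 2 4 6 + g 3 5 6 - g 4 5 7 = 0.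
  by have := hc (ee 2) (ee 3) (ee 4) (ee 5); rewrite !phi1_ee ?zs => h; rewrite -[RHS]h /g; ring.
have C2346 : g 3 4 4 - g 4 6 7 = 0.
  by have := hc (ee 2) (ee 3) (ee 4) (ee 6); rewrite !phi1_ee ?zs => h; rewrite -[RHS]h /g; ring.
have C2356 : g 3 5 4 - g 5 6 7 = 0.
  by have := hc (ee 2) (ee 3) (ee 5) (ee 6); rewrite !phi1_ee ?zs => h; rewrite -[RHS]h /g; ring.
have C2456 : - g 2 6 7 = 0.
  by have := hc (ee 2) (ee 4) (ee 5) (ee 6); rewrite !phi1_ee ?zs => h; rewrite -[RHS]h /g; ring.
have C3456 : g 3 5 2 - g 3 6 7 = 0.
  by have := hc (ee 3) (ee 4) (ee 5) (ee 6); rewrite !phi1_ee ?zs => h; rewrite -[RHS]h /g; ring.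
have C3457 : - g 3 4 4 - g 3 5 5 - g 4 5 2 = 0.
  by have := hc (ee 3) (ee 4) (ee 5) (ee 7); rewrite !phi1_ee ?zs => h; rewrite -[RHS]h /g; ring.
have E127 : g 1 2 7 = - g 1 5 6 by clear -C1245; lra.
have E137 : g 1 3 7 = g 3 4 2 - g 1 4 6 by clear -C1345; lra.
have E147 : g 1 4 7 = - g 3 4 5 + g 1 3 6 by clear -C1234; lra.
have E157 : g 1 5 7 = g 3 4 4 + g 1 2 6 by clear -TN C1235; lra.
(* [g 1 6 7], [g 2 3 7] and [g 4 5 7] are coupled: [C1236], [C1456] and [C2345] determine their
   pairwise sums. *)
have E167 : g 1 6 7 = g 1 5 2 + g 1 4 3 - g 1 3 4 by clear -C1236 C1247 C1357 C1456 C2345; lra.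
have E236 : g 2 3 6 = g 1 3 3 by clear -C1237; lra.
have E237 : g 2 3 7 = - g 1 5 2 - g 1 4 3 by clear -C1236 C1247 C1357 C1456 C2345; lra.
have E246 : g 2 4 6 = g 1 4 3 by clear -C1247; lra.
have E247 : g 2 4 7 = - g 1 4 4 by clear -C1246; lra.
have E256 : g 2 5 6 = g 1 5 3 by clear -C1257; lra.
have E257 : g 2 5 7 = - g 1 5 4 by clear -C1256; lra.
have E267 : g 2 6 7 = 0 by clear -C2456; lra.
have E346 : g 3 4 6 = - g 1 4 2 - g 1 3 5 by clear -C1347; lra.
have E347 : g 3 4 7 = - g 1 3 2 + g 1 4 5 by clear -C1346; lra.
have E355 : g 3 5 5 = - g 3 4 4 by clear -TN; lra.
have E356 : g 3 5 6 = - g 1 5 2 + g 1 3 4 by clear -C1357; lra.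
have E357 : g 3 5 7 = g 1 3 3 + g 1 5 5 by clear -C1356; lra.
have E367 : g 3 6 7 = g 3 5 2 by clear -C3456; lra.
have E452 : g 4 5 2 = 0 by clear -TN C3457; lra.
have E456 : g 4 5 6 = g 1 4 4 + g 1 5 5 by clear -C1457; lra.
have E457 : g 4 5 7 = g 1 3 4 by clear -C1236 C1247 C1357 C1456 C2345; lra.
have E467 : g 4 6 7 = g 3 4 4 by clear -C2346; lra.
have E567 : g 5 6 7 = g 3 5 4 by clear -C2356; lra.
split=> // i j k.
suff H u v n : (0 < n < 8)%N -> cf (br c u v) n = - ev2 (nth [::] d n.-1) (cf u) (cf v).
  have -> : c i j k = br c (delta_mx 0 i) (delta_mx 0 j) 0 k by rewrite br_delta mxE.
  have -> : lc d i j k = br (lc d) (delta_mx 0 i) (delta_mx 0 j) 0 k by rewrite br_delta mxE.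
  by rewrite [RHS](@br_lc R d) // [LHS]cf_row H //= ltnS.
move=> hn8; rewrite (cf_br_expand _ _ _ hl) /d /model.
case: n hn8 => [|[|[|[|[|[|[|[|n]]]]]]]] // _ /=; rewrite -!/(g _ _ _).
- by rewrite /g !Z1; ring.
- rewrite E452 /g !zs; ring.
- rewrite /g !zs; ring.
- rewrite /g !zs; ring.
- rewrite E355 /g !zs; ring.
- rewrite E236 E246 E256 E346 E356 E456 /g !zs; ring.
rewrite E127 E137 E147 E157 E167 E237 E247 E257 E267 E347 E357 E367 E457 E467 E567 /g !zs; ring.
Qed.

End Model.

(** * The parameter space *)

Section Collect.
Variable R : rcfType.
Implicit Types (x y z u v w X Y E : 'rV[R]_7) (c : sconst R).
Local Notation ee := (@ee R).

Lemma model_wf (f1 f2 f3 m11 m12 m13 m21 m22 m23 m31 m32 m33 u2 u3 n22 n23 n32 d0 d1 d2 d3 : R) :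
  all (@wf2 R) (model f1 f2 f3 m11 m12 m13 m21 m22 m23 m31 m32 m33 u2 u3 n22 n23 n32 d0 d1 d2 d3).
Proof. by []. Qed.

Definition ind (a n : nat) : R := (n == a)%:R.

(** The coefficient of e^a e^b e^e in d(d e^(k+1)): [k] counts from 0, whereas the vector indices
    count from 1. *)
Lemma jac_at (d : seq (seq (R * nat * nat))) : is_lie (lc d) -> all (@wf2 R) d ->
  forall k a b e : nat, (k < 7)%N ->
  ev2 (nth [::] d k) (ind a) (bf d (ind b) (ind e)) +
  ev2 (nth [::] d k) (ind b) (bf d (ind e) (ind a)) +
  ev2 (nth [::] d k) (ind e) (bf d (ind a) (ind b)) = 0.
Proof. by move=> hl wd k a b e hk; apply: lc_jacobi. Qed.

(** [topcond] in coordinates. The rows f, m1, m2, m3 form minus the matrix of ad e_1 on the vectors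
    e_3, e_4, e_5, whence the signs; [a1], [a2], [a3] and [b1], [b2], [b3] are the coordinates of u
    and u'. *)
Definition topparams (f1 f2 f3 m11 m12 m13 m21 m22 m23 m31 m32 m33 : R) :=
  (f1 = 0 /\ f2 = 0 /\ f3 = 0 /\ m11 = 0 /\ m12 = 0 /\ m13 = 0 /\
   m21 = 0 /\ m22 = 0 /\ m23 = 0 /\ m31 = 0 /\ m32 = 0 /\ m33 = 0) \/
  exists a1 a2 a3 : R,
   [/\ f1 * a1 + f2 * a2 + f3 * a3 = -1, m11 * a1 + m12 * a2 + m13 * a3 = 0,
       m21 * a1 + m22 * a2 + m23 * a3 = 0, m31 * a1 + m32 * a2 + m33 * a3 = 0 &
    ((forall b1 b2 b3 e1 e2 e3 : R,
        e1 = m11 * b1 + m12 * b2 + m13 * b3 -> e2 = m21 * b1 + m22 * b2 + m23 * b3 ->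
        e3 = m31 * b1 + m32 * b2 + m33 * b3 ->
        [/\ f1 * e1 + f2 * e2 + f3 * e3 = 0, m11 * e1 + m12 * e2 + m13 * e3 = 0,
            m21 * e1 + m22 * e2 + m23 * e3 = 0 & m31 * e1 + m32 * e2 + m33 * e3 = 0]) \/
     exists b1 b2 b3 : R, [/\ m11 * b1 + m12 * b2 + m13 * b3 = - a1,
       m21 * b1 + m22 * b2 + m23 * b3 = - a2 & m31 * b1 + m32 * b2 + m33 * b3 = - a3])].

(** The last alternative is [dercond] for e_2: no functional x0 + a4 x2 + a5 x3 vanishes on the
    brackets of ker w, since it would also have to vanish on e_2, where its value is 1. *)
Theorem calibrated_model c0 : is_lie c0 -> lie_nilpotent c0 -> calibrated_G2 c0 ->
  exists f1 f2 f3 m11 m12 m13 m21 m22 m23 m31 m32 m33 u2 u3 n22 n23 n32 d0 d1 d2 d3 : R,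
  let d := model f1 f2 f3 m11 m12 m13 m21 m22 m23 m31 m32 m33 u2 u3 n22 n23 n32 d0 d1 d2 d3 in
  [/\ lie_iso c0 (lc d), is_lie (lc d), m11 + m22 + m33 = 0,
    [/\ u3 = 0, n22 = 0 & n23 = 0] \/ ~ eigenplane (lc d) &
    ([/\ u2 = 0, u3 = 0, n22 = 0, n23 = 0 & n32 = 0] /\
      topparams f1 f2 f3 m11 m12 m13 m21 m22 m23 m31 m32 m33) \/
    (forall a4 a5 : R, u2 + a4 * n22 + a5 * n32 = 0 -> u3 + a4 * n23 - a5 * n22 = 0 -> False)].
Proof.
move=> hl0 hn0 /calibrated_closed_phi1[c1 [i01 hc1]].
have hl1 := is_lie_iso i01 hl0; have hn1 := nilpotent_iso i01 hn0.
have [c2 [i12 hf2 heig]] : exists c2, [/\ lie_iso c1 c2, frame1 c2 &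
    (forall k, (1 < k < 6)%N -> cf (br c2 (ee 6) (ee k)) 7 = 0) \/ ~ eigenplane c2].
  case: (classic (eigenplane c1)) => [he|hne].
    by have [c2 [i12 hf h6]] := frame1_eig hl1 hn1 hc1 he; exists c2; split=> //; left.
  have [c2 [i12 [hf h]]] := frame1_exists hl1 hn1 hc1.
  by exists c2; split=> //; right => /h.
have [c3 [i23 hf3 hev h63]] := frame2_exists hf2.
have [E TM] := frame2_lc hf3; have [Z1 Z2 Z6 Z7 [Z34 Z35 Z45]] := frame2_zeros hf3.
have [T455 T454 TN _] := frame2_traces hf3.
have [[hl hn hc h7 h6] h2 htd] := hf3.
set g := fun a b k => cf (br c3 (ee a) (ee b)) k in E TM.
exists (- g 1 3 2)%N, (- g 1 4 2)%N, (- g 1 5 2)%N, (- g 1 3 3)%N, (- g 1 4 3)%N, (- g 1 5 3)%N,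
 (- g 1 3 4)%N, (- g 1 4 4)%N, (- g 1 5 4)%N, (- g 1 3 5)%N, (- g 1 4 5)%N, (- g 1 5 5)%N,
 (- g 3 4 2)%N, (- g 3 5 2)%N, (- g 3 4 4)%N, (- g 3 5 4)%N, (- g 3 4 5)%N,
 (- g 1 2 6)%N, (- g 1 3 6)%N, (- g 1 4 6)%N, (- g 1 5 6)%N => d.
have Eb : forall x y, br c3 x y = br (lc d) x y by exact: br_ext.
have i3d : lie_iso c3 (lc d) by exact: lie_iso_ext.
have wd : all (@wf2 R) d by [].
have E6 k j : (0 < k < 8)%N -> (0 < j < 8)%N -> cf (br c3 (ee k) (ee j)) 7 =
    - ev2 (nth [::] d 6) (fun n => (n == k)%:R) (fun n => (n == j)%:R).
  move=> hk hj; rewrite Eb cf_br_lc //; congr (- _).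
  by apply: (ev2_ext (wf2_nth 6 (wd : all (@wf2 R) d))) => n hn'; rewrite cf_ee.
split.
- exact: lie_iso_trans (lie_iso_trans i01 i12) (lie_iso_trans i23 i3d).
- exact: is_lie_iso i3d hl.
- by rewrite -!opprD TM oppr0.
- case: heig => [h67|hne]; last first.
    right=> he; apply: hne; apply: hev; case: he => X [Y [l [X0 cX XY hY]]].
    by exists X, Y, l; split=> // v; rewrite Eb.
  left; have h6J : forall v, inJ v -> br c2 (ee 6) v = 0.
    move=> v v1; have [hl2 _ _ h72 h62] := hf2; apply: cfP => k hk; rewrite cf0.
    have [k7|k7] := ltnP k 7; first by rewrite h62 // k7 andbT; case/andP: hk.
    have -> : k = 7%N by apply/eqP; rewrite eqn_leq k7 -ltnS andbT; case/andP: hk.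
    rewrite cf_br_r v1 (h67 2%N) // (h67 3%N) // (h67 4%N) // (h67 5%N) // (br_alt hl2) cf0 (br_anti hl2 (ee 6) (ee 7)) h72 oppr0 cf0.
    ring.
  have h6' := h63 h6J.
  have K j : (1 < j < 6)%N -> cf (br c3 (ee 6) (ee j)) 7 = 0.
    by move=> hj; rewrite h6' ?cf0 // /inJ cf_ee //; case: j hj => [|[|]].
  have := K 3%N isT; have := K 4%N isT; have := K 5%N isT.
  by rewrite !E6 //= => k5 k4 k3; clear -k3 k4 k5; split; lra.
case: htd => [[ab hD]|hd].
  left; split.
    have J3 : inJ (ee 3) by rewrite /inJ cf_ee.
    have J4 : inJ (ee 4) by rewrite /inJ cf_ee.
    have J5 : inJ (ee 5) by rewrite /inJ cf_ee.
    have A34 := ab _ _ J3 J4; have A35 := ab _ _ J3 J5.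
    by rewrite /g !A34 ?A35 ?oppr0.
  have D1 v k : (1 < k < 6)%N -> inJ v -> cf (br c3 (ee 1) v) k =
     cf v 3 * g 1 3 k + cf v 4 * g 1 4 k + cf v 5 * g 1 5 k.
    move=> hk v1; rewrite cf_br_r v1 Z7 cf0 Z2 ?Z6.
    + by rewrite /g; ring.
    + by case: k hk => [|[|[|[|[|[|]]]]]].
    + by case: k hk => [|[|[|[|[|[|]]]]]].
  have mkJ (b1 b2 b3 : R) : exists v, [/\ inJ v, cf v 3 = b1, cf v 4 = b2 & cf v 5 = b3].
    exists (b1 *: ee 3 + b2 *: ee 4 + b3 *: ee 5).
    by rewrite /inJ !cfD !cfZ !cf_ee //= ?(mulr0, mulr1, addr0, add0r).
  case: hD => [D0|[u [u1 Du hD]]]; [left|right].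
    have K j k : (1 < j < 6)%N -> (1 < k < 6)%N -> g 1%N j k = 0.
      move=> hj hk; apply: D0; last by case: k hk => [|[|[|[|[|[|]]]]]].
      by rewrite /inJ cf_ee //; case: j hj => [|[|[|[|[|[|]]]]]].
    by rewrite !K // oppr0.
  have U k : (1 < k < 6)%N -> cf (br c3 (ee 1) u) k = (k == 2)%:R.
    move=> hk; have hk' : (0 < k < 6)%N by case: k hk => [|[|[|[|[|[|]]]]]].
    have := Du k hk'; rewrite cfD cfN cf_ee; last by case: k {hk} hk' => [|[|[|[|[|[|]]]]]].
    by move/eqP; rewrite subr_eq0 => /eqP.
  have U2 := U 2%N isT; have U3 := U 3%N isT; have U4 := U 4%N isT; have U5 := U 5%N isT.
  rewrite !D1 //= in U2 U3 U4 U5.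
  exists (cf u 3), (cf u 4), (cf u 5); split; try by clear -U2 U3 U4 U5; lra.
  case: hD => [D2|[u' [u1' Du']]]; [left|right].
    move=> b1 b2 b3 e1 e2 e3 he1 he2 he3.
    have [v [v1 v3 v4 v5]] := mkJ b1 b2 b3.
    have W k : (1 < k < 6)%N -> cf (br c3 (ee 1) (br c3 (ee 1) v)) k = 0.
      by move=> hk; apply: D2 => //; case: k hk => [|[|[|[|[|[|]]]]]].
    have W2 := W 2%N isT; have W3 := W 3%N isT; have W4 := W 4%N isT; have W5 := W 5%N isT.
    have Jv : inJ (br c3 (ee 1) v) by exact: Z1.
    rewrite !(D1 (br c3 (ee 1) v)) // !(D1 v) // v3 v4 v5 in W2 W3 W4 W5.
    have -> : e1 = - (b1 * g 1 3 3 + b2 * g 1 4 3 + b3 * g 1 5 3) by rewrite he1; ring.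
    have -> : e2 = - (b1 * g 1 3 4 + b2 * g 1 4 4 + b3 * g 1 5 4) by rewrite he2; ring.
    have -> : e3 = - (b1 * g 1 3 5 + b2 * g 1 4 5 + b3 * g 1 5 5) by rewrite he3; ring.
    by split; [rewrite -[RHS]W2|rewrite -[RHS]W3|rewrite -[RHS]W4|rewrite -[RHS]W5]; ring.
  have W k : (1 < k < 6)%N -> cf (br c3 (ee 1) u') k = cf u k.
    move=> hk; have hk' : (0 < k < 6)%N by case: k hk => [|[|[|[|[|[|]]]]]].
    by have := Du' k hk'; rewrite cfD cfN => /eqP; rewrite subr_eq0 => /eqP.
  have W3 := W 3%N isT; have W4 := W 4%N isT; have W5 := W 5%N isT.
  rewrite !D1 // in W3 W4 W5.
  by exists (cf u' 3), (cf u' 4), (cf u' 5); rewrite -W3 -W4 -W5; split; ring.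
right=> a4 a5 h4 h5.
pose l : 'cV[R]_7 := \col_i nth 0 [:: 0; 1; 0; a4; a5; 0; 0] i.
have lE v : (v *m l) 0 0 = cf v 2 + a4 * cf v 4 + a5 * cf v 5.
  rewrite mxE !big_ord_recl big_ord0 !mxE /= !cf_row /=; ring.
have l0 v : cf v 2 + a4 * cf v 4 + a5 * cf v 5 = 0 -> v *m l = 0.
  by move=> h; apply/matrixP => i j; rewrite !ord1 lE h mxE.
have : ee 2 *m l = 0.
  apply: hd; last first.
  - by apply: l0; rewrite !cf_ee //=; ring.
  - by apply: l0; rewrite !cf_ee //=; ring.
  move=> x y x1 y1; apply: l0; rewrite (cf_br_expand x y 2 hl) (cf_br_expand x y 4 hl).
  rewrite (cf_br_expand x y 5 hl) x1 y1.
  have h2' k j : (0 < k < 6)%N -> cf (br c3 (ee 2) (ee j)) k = 0 by move=> hk; apply: h2.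
  have Z2' k j : (0 < k < 6)%N -> cf (br c3 (ee j) (ee 2)) k = 0 by move=> hk; apply: Z2.
  have g452 : cf (br c3 (ee 4) (ee 5)) 2 = 0.
    by rewrite Eb cf_br_lc //= ?cf_ee //=; ring.
  have g355 : g 3 5 5 = - g 3 4 4 by rewrite /g; lra.
  rewrite /g in g355 h4 h5.
  rewrite !(h2' 2%N) // !(h2' 4%N) // !(h2' 5%N) // !Z6 // !Z7 !cf0 g452 T454 T455 g355.
  set G342 := cf (br c3 (ee 3) (ee 4)) 2 in h4 *; set G352 := cf (br c3 (ee 3) (ee 5)) 2 in h5 *.
  have -> : G342 = - (a4 * cf (br c3 (ee 3) (ee 4)) 4 + a5 * cf (br c3 (ee 3) (ee 4)) 5) by lra.
  have -> : G352 = - a4 * cf (br c3 (ee 3) (ee 5)) 4 + a5 * cf (br c3 (ee 3) (ee 4)) 4 by lra.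
  ring.
move=> /matrixP/(_ 0 0); rewrite lE mxE !cf_ee //= !mulr0 !addr0 => /eqP.
by rewrite oner_eq0.
Qed.

End Collect.

(** * Solutions of the Jacobi identity *)

Section FamilyOne.
Variable R : rcfType.

(** The coefficients of w x_i x_j in d(dy), for the pairs 01, 02, 03, 12, 13, 23, followed by those
    in d(d eta) in the same order. *)
Lemma model_jacobi_abelian (f1 f2 f3 m11 m12 m13 m21 m22 m23 m31 m32 m33 d0 d1 d2 d3 : R) :
  is_lie (lc (model f1 f2 f3 m11 m12 m13 m21 m22 m23 m31 m32 m33 0 0 0 0 0 d0 d1 d2 d3)) ->
  m11 ^+ 2 + m12 * m21 + m13 * m31 = 0 /\
  m11 * m12 + m12 * m22 + m13 * m32 = 0 /\
  m11 * m13 + m12 * m23 + m13 * m33 = 0 /\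
  f1 * m12 - 2%:R * f2 * m11 - f2 * m22 - f3 * m32 - m11 * m31 + m21 * m32 - 2%:R * m22 * m31 - m31 * m33 = 0 /\
  f1 * m13 - f2 * m23 - 2%:R * f3 * m11 - f3 * m33 + m11 * m21 + m21 * m22 + 2%:R * m21 * m33 - m23 * m31 = 0 /\
  2%:R * f2 * m13 - 2%:R * f3 * m12 + m12 * m21 + m13 * m31 + 2%:R * m22 * m33 + m22 ^+ 2 + m33 ^+ 2 = 0 /\
  - 2%:R * f3 * m11 - 2%:R * m11 * m12 + m11 * m21 - m21 * m22 - m23 * m31 = 0 /\
  - 2%:R * f3 * m12 + m12 * m21 - 2%:R * m12 ^+ 2 - m22 ^+ 2 - m23 * m32 = 0 /\
  - 2%:R * f3 * m13 - 2%:R * m12 * m13 + m13 * m21 - m22 * m23 - m23 * m33 = 0 /\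
  - f1 * m11 - 2%:R * f1 * m22 + 2%:R * f2 * f3 + 2%:R * f2 * m12 - f2 * m21 + f3 * m31 + 2%:R * m11 * m32 + m12 * m31 - 2%:R * m21 * m31 + m22 * m32 + m32 * m33 = 0 /\
  - 2%:R * f1 * m23 + 2%:R * f3 * m12 - 2%:R * f3 * m21 + 2%:R * f3 ^+ 2 + 2%:R * m11 * m33 + m11 ^+ 2 - m12 * m21 + 2%:R * m21 ^+ 2 + m23 * m32 + m33 ^+ 2 = 0 /\
  f1 * m13 - f2 * m23 - f3 * m33 + m11 * m12 - m12 * m22 - m13 * m32 + 2%:R * m21 * m22 + 2%:R * m21 * m33 = 0.
Proof.
move=> hl; have J := jac_at hl (model_wf f1 f2 f3 m11 m12 m13 m21 m22 m23 m31 m32 m33 0 0 0 0 0 d0 d1 d2 d3).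
split; first by rewrite -[RHS](J 5%N 1%N 2%N 3%N isT) /bf /ind /=; ring.
split; first by rewrite -[RHS](J 5%N 1%N 2%N 4%N isT) /bf /ind /=; ring.
split; first by rewrite -[RHS](J 5%N 1%N 2%N 5%N isT) /bf /ind /=; ring.
split; first by rewrite -[RHS](J 5%N 1%N 3%N 4%N isT) /bf /ind /=; ring.
split; first by rewrite -[RHS](J 5%N 1%N 3%N 5%N isT) /bf /ind /=; ring.
split; first by rewrite -[RHS](J 5%N 1%N 4%N 5%N isT) /bf /ind /=; ring.
split; first by rewrite -[RHS](J 6%N 1%N 2%N 3%N isT) /bf /ind /=; ring.
split; first by rewrite -[RHS](J 6%N 1%N 2%N 4%N isT) /bf /ind /=; ring.
split; first by rewrite -[RHS](J 6%N 1%N 2%N 5%N isT) /bf /ind /=; ring.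
split; first by rewrite -[RHS](J 6%N 1%N 3%N 4%N isT) /bf /ind /=; ring.
split; first by rewrite -[RHS](J 6%N 1%N 3%N 5%N isT) /bf /ind /=; ring.
by rewrite -[RHS](J 6%N 1%N 4%N 5%N isT) /bf /ind /=; ring.
Qed.

Lemma model_jacobi_B0 (f1 f2 f3 m11 m12 m13 m21 m22 m23 m31 m32 m33 u2 d0 d1 d2 d3 : R) :
  is_lie (lc (model f1 f2 f3 m11 m12 m13 m21 m22 m23 m31 m32 m33 u2 0 0 0 0 d0 d1 d2 d3)) ->
  m11 * u2 + m22 * u2 = 0 /\
  m23 * u2 = 0 /\
  - m13 * u2 = 0 /\
  m11 ^+ 2 + m12 * m21 + m13 * m31 = 0 /\
  m11 * m12 + m12 * m22 + m13 * m32 = 0 /\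
  m11 * m13 + m12 * m23 + m13 * m33 = 0 /\
  - d0 * u2 + f1 * m12 - 2%:R * f2 * m11 - f2 * m22 - f3 * m32 - m11 * m31 + m21 * m32 - 2%:R * m22 * m31 - m31 * m33 = 0 /\
  f1 * m13 - f2 * m23 - 2%:R * f3 * m11 - f3 * m33 + m11 * m21 + m21 * m22 + 2%:R * m21 * m33 - m23 * m31 = 0 /\
  2%:R * f2 * m13 - 2%:R * f3 * m12 + m12 * m21 + m13 * m31 + 2%:R * m22 * m33 + m22 ^+ 2 + m33 ^+ 2 = 0 /\
  m13 * u2 = 0 /\
  - 2%:R * f3 * m11 - 2%:R * m11 * m12 + m11 * m21 - m21 * m22 - m23 * m31 = 0 /\
  - 2%:R * f3 * m12 + m12 * m21 - 2%:R * m12 ^+ 2 - m22 ^+ 2 - m23 * m32 = 0 /\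
  - 2%:R * f3 * m13 - 2%:R * m12 * m13 + m13 * m21 - m22 * m23 - m23 * m33 = 0 /\
  d3 * u2 - f1 * m11 - 2%:R * f1 * m22 + 2%:R * f2 * f3 + 2%:R * f2 * m12 - f2 * m21 + f3 * m31 + 2%:R * m11 * m32 + m12 * m31 - 2%:R * m21 * m31 + m22 * m32 + m32 * m33 = 0 /\
  - 2%:R * f1 * m23 + 2%:R * f3 * m12 - 2%:R * f3 * m21 + 2%:R * f3 ^+ 2 + 2%:R * m11 * m33 + m11 ^+ 2 - m12 * m21 + 2%:R * m21 ^+ 2 + m23 * m32 + m33 ^+ 2 = 0 /\
  f1 * m13 - f2 * m23 - f3 * m33 + m11 * m12 - m12 * m22 - m13 * m32 + 2%:R * m21 * m22 + 2%:R * m21 * m33 = 0 /\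
  - m23 * u2 = 0.
Proof.
move=> hl; have J := jac_at hl (model_wf f1 f2 f3 m11 m12 m13 m21 m22 m23 m31 m32 m33 u2 0 0 0 0 d0 d1 d2 d3).
split; first by rewrite -[RHS](J 1%N 1%N 3%N 4%N isT) /bf /ind /=; ring.
split; first by rewrite -[RHS](J 1%N 1%N 3%N 5%N isT) /bf /ind /=; ring.
split; first by rewrite -[RHS](J 1%N 1%N 4%N 5%N isT) /bf /ind /=; ring.
split; first by rewrite -[RHS](J 5%N 1%N 2%N 3%N isT) /bf /ind /=; ring.
split; first by rewrite -[RHS](J 5%N 1%N 2%N 4%N isT) /bf /ind /=; ring.
split; first by rewrite -[RHS](J 5%N 1%N 2%N 5%N isT) /bf /ind /=; ring.
split; first by rewrite -[RHS](J 5%N 1%N 3%N 4%N isT) /bf /ind /=; ring.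
split; first by rewrite -[RHS](J 5%N 1%N 3%N 5%N isT) /bf /ind /=; ring.
split; first by rewrite -[RHS](J 5%N 1%N 4%N 5%N isT) /bf /ind /=; ring.
split; first by rewrite -[RHS](J 5%N 3%N 4%N 5%N isT) /bf /ind /=; ring.
split; first by rewrite -[RHS](J 6%N 1%N 2%N 3%N isT) /bf /ind /=; ring.
split; first by rewrite -[RHS](J 6%N 1%N 2%N 4%N isT) /bf /ind /=; ring.
split; first by rewrite -[RHS](J 6%N 1%N 2%N 5%N isT) /bf /ind /=; ring.
split; first by rewrite -[RHS](J 6%N 1%N 3%N 4%N isT) /bf /ind /=; ring.
split; first by rewrite -[RHS](J 6%N 1%N 3%N 5%N isT) /bf /ind /=; ring.
split; first by rewrite -[RHS](J 6%N 1%N 4%N 5%N isT) /bf /ind /=; ring.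
by rewrite -[RHS](J 6%N 3%N 4%N 5%N isT) /bf /ind /=; ring.
Qed.

Lemma sum2sq_eq0 (a b : R) : a ^+ 2 + b ^+ 2 = 0 -> a = 0 /\ b = 0.
Proof.
move=> /eqP; rewrite paddr_eq0 ?sqr_ge0 // !sqrf_eq0.
by move=> /andP[/eqP -> /eqP ->].
Qed.

Lemma eisenstein_eq0 (a b : R) : a ^+ 2 - a * b + b ^+ 2 = 0 -> a = 0 /\ b = 0.
Proof.
move=> h; apply: sum2sq_eq0; apply/eqP; rewrite eq_le addr_ge0 ?sqr_ge0 // andbT.
have -> : a ^+ 2 + b ^+ 2 = 2 * (a ^+ 2 - a * b + b ^+ 2) - (a - b) ^+ 2 by ring.
by rewrite h mulr0 sub0r oppr_le0 sqr_ge0.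
Qed.

Lemma mulr_0l (a b : R) : a != 0 -> a * b = 0 -> b = 0.
Proof. by move=> a0 /eqP; rewrite mulf_eq0 (negPf a0) /= => /eqP. Qed.

(** The terms with u2 kill m13, m23 and m11 + m22 at once. The remaining quadratic relations then
    combine to m11^2 + m12^2 = 0 and f3^2 - f3 m21 + m21^2 = 0. *)
Lemma heisenberg_untwisted (f1 f2 f3 m11 m12 m13 m21 m22 m23 m31 m32 m33 u2 d0 d1 d2 d3 : R) :
  is_lie (lc (model f1 f2 f3 m11 m12 m13 m21 m22 m23 m31 m32 m33 u2 0 0 0 0 d0 d1 d2 d3)) ->
  m11 + m22 + m33 = 0 -> u2 != 0 ->
  [/\ f3 = 0, m11 = 0 /\ m12 = 0 /\ m13 = 0, m21 = 0 /\ m22 = 0 /\ m23 = 0, m33 = 0 & d0 = 0 /\ d3 = 0].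
Proof.
move=> hl tr u0.
have [j1 [j2 [j3 [j4 [j5 [j6 [j7 [j8 [j9 [j10 [j11 [j12 [j13 [j14 [j15 _]]]]]]]]]]]]]]] := model_jacobi_B0 hl.
have m13_0 : m13 = 0 by apply: (mulr_0l u0); rewrite -[RHS]oppr0 -[in RHS]j3; ring.
have m23_0 : m23 = 0 by apply: (mulr_0l u0); rewrite -[RHS]j2; ring.
have m22_e : m22 = - m11.
  by apply/eqP; rewrite -subr_eq0; apply/eqP/(mulr_0l u0); rewrite -[RHS]j1; ring.
have m33_0 : m33 = 0 by lra.
subst m13 m23 m33 m22.
have p : m12 * m21 = - m11 ^+ 2 by lra.
have q : f3 * m12 = 0 by nra.
have r : m12 ^+ 2 = - m11 ^+ 2 by nra.
have [e1 e2] : m11 = 0 /\ m12 = 0 by apply: sum2sq_eq0; rewrite r subrr.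
subst m11 m12.
have [e3 e4] : f3 = 0 /\ m21 = 0 by apply: eisenstein_eq0; lra.
subst f3 m21; do ![split=> //].
- by rewrite oppr0.
- by apply: (mulr_0l u0); lra.
- by apply: (mulr_0l u0); lra.
Qed.

(** Here D^2 annihilates om1 and om2, while D u = E up to sign and D E = 0. If D^2 = 0, pairing u
    with v gives om1(E, D v) = om2(E, D v) = 0: the image of D has no x1 and x2 components. If u
    comes from a u', pairing u with u' shows that u is a multiple of e_5 modulo e_2, and this is
    contradictory. *)
Lemma abelian_untwisted (f1 f2 f3 m11 m12 m13 m21 m22 m23 m31 m32 m33 d0 d1 d2 d3 : R) :
  is_lie (lc (model f1 f2 f3 m11 m12 m13 m21 m22 m23 m31 m32 m33 0 0 0 0 0 d0 d1 d2 d3)) ->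
  m11 + m22 + m33 = 0 -> topparams f1 f2 f3 m11 m12 m13 m21 m22 m23 m31 m32 m33 ->
  m21 - m12 - f3 = 0 ->
  [/\ f3 = 0, m11 = 0 /\ m12 = 0 /\ m13 = 0, m21 = 0 /\ m22 = 0 /\ m23 = 0 & m33 = 0].
Proof.
move=> hl tr htop b0.
have [p01 [p02 [p03 [p12 [p13 [p23 [q01 [q02 [q03 [q12 [q13 q23]]]]]]]]]]] := model_jacobi_abelian hl.
case: htop => [|[a1 [a2 [a3 [fa ma1 ma2 ma3 htop]]]]]; first by do 11![case=> ?]; move=> ?; subst.
(* The components of [D^2 om1] and [D^2 om2] vanish by the Jacobi identity. *)
pose D2 om (x0 x1 x2 x3 y0 y1 y2 y3 : R) : R :=
  let D y1 y2 y3 := (f1 * y1 + f2 * y2 + f3 * y3, m11 * y1 + m12 * y2 + m13 * y3,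
     m21 * y1 + m22 * y2 + m23 * y3, m31 * y1 + m32 * y2 + m33 * y3) in
  let: (Dx0, Dx1, Dx2, Dx3) := D x1 x2 x3 in let: (Dy0, Dy1, Dy2, Dy3) := D y1 y2 y3 in
  let: (DDx0, DDx1, DDx2, DDx3) := D Dx1 Dx2 Dx3 in
  let: (DDy0, DDy1, DDy2, DDy3) := D Dy1 Dy2 Dy3 in
  om DDx0 DDx1 DDx2 DDx3 y0 y1 y2 y3 + 2 * om Dx0 Dx1 Dx2 Dx3 Dy0 Dy1 Dy2 Dy3
   + om x0 x1 x2 x3 DDy0 DDy1 DDy2 DDy3.
have K1 x0 x1 x2 x3 y0 y1 y2 y3 : D2 (@om1 R) x0 x1 x2 x3 y0 y1 y2 y3 = 0.
  transitivity ((m11 ^+ 2 + m12 * m21 + m13 * m31) * (x0 * y1 - x1 * y0) +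
    (m11 * m12 + m12 * m22 + m13 * m32) * (x0 * y2 - x2 * y0) +
    (m11 * m13 + m12 * m23 + m13 * m33) * (x0 * y3 - x3 * y0) +
    (f1 * m12 - 2%:R * f2 * m11 - f2 * m22 - f3 * m32 - m11 * m31 + m21 * m32 - 2%:R * m22 * m31 - m31 * m33) * (x1 * y2 - x2 * y1) +
    (f1 * m13 - f2 * m23 - 2%:R * f3 * m11 - f3 * m33 + m11 * m21 + m21 * m22 + 2%:R * m21 * m33 - m23 * m31) * (x1 * y3 - x3 * y1) +
    (2%:R * f2 * m13 - 2%:R * f3 * m12 + m12 * m21 + m13 * m31 + 2%:R * m22 * m33 + m22 ^+ 2 + m33 ^+ 2) * (x2 * y3 - x3 * y2)).
    by rewrite /D2 /om1; ring.
  by rewrite p01 p02 p03 p12 p13 p23 !mul0r !addr0.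
have e3 : f3 = m21 - m12 by lra.
have e33 : m33 = - m11 - m22 by lra.
have K2 x0 x1 x2 x3 y0 y1 y2 y3 : D2 (@om2 R) x0 x1 x2 x3 y0 y1 y2 y3 = 0.
  transitivity (- ((- 2%:R * f3 * m11 - 2%:R * m11 * m12 + m11 * m21 - m21 * m22 - m23 * m31) * (x0 * y1 - x1 * y0) +
    (- 2%:R * f3 * m12 + m12 * m21 - 2%:R * m12 ^+ 2 - m22 ^+ 2 - m23 * m32) * (x0 * y2 - x2 * y0) +
    (- 2%:R * f3 * m13 - 2%:R * m12 * m13 + m13 * m21 - m22 * m23 - m23 * m33) * (x0 * y3 - x3 * y0) +
    (- f1 * m11 - 2%:R * f1 * m22 + 2%:R * f2 * f3 + 2%:R * f2 * m12 - f2 * m21 + f3 * m31 + 2%:R * m11 * m32 + m12 * m31 - 2%:R * m21 * m31 + m22 * m32 + m32 * m33) * (x1 * y2 - x2 * y1) +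
    (- 2%:R * f1 * m23 + 2%:R * f3 * m12 - 2%:R * f3 * m21 + 2%:R * f3 ^+ 2 + 2%:R * m11 * m33 + m11 ^+ 2 - m12 * m21 + 2%:R * m21 ^+ 2 + m23 * m32 + m33 ^+ 2) * (x1 * y3 - x3 * y1) +
    (f1 * m13 - f2 * m23 - f3 * m33 + m11 * m12 - m12 * m22 - m13 * m32 + 2%:R * m21 * m22 + 2%:R * m21 * m33) * (x2 * y3 - x3 * y2))).
    by rewrite /D2 /om2 e3 e33; ring.
  by rewrite q01 q02 q03 q12 q13 q23 !mul0r !addr0 oppr0.
have C1 y0 y1 y2 y3 := K1 0 a1 a2 a3 y0 y1 y2 y3; have C2 y0 y1 y2 y3 := K2 0 a1 a2 a3 y0 y1 y2 y3.
clear K1 K2 hl b0 p02 p03 p12 p13 p23 q01 q02 q03 q12 q13 q23.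
rewrite /D2 /= fa ma1 ma2 ma3 /om1 /om2 in C1 C2.
have done1 : m11 = 0 -> m12 = 0 -> m13 = 0 -> m21 = 0 -> m22 = 0 -> m23 = 0 ->
  [/\ f3 = 0, m11 = 0 /\ m12 = 0 /\ m13 = 0, m21 = 0 /\ m22 = 0 /\ m23 = 0 & m33 = 0].
  move=> g1 g2 g3 g4 g5 g6; do ![split=> //]; [rewrite e3 g2 g4 | rewrite e33 g1 g5]; ring.
case: htop => [hD2|[b1 [b2 [b3 [mb1 mb2 mb3]]]]].
  have L (c1 c2 c3 : R) : m11 * c1 + m12 * c2 + m13 * c3 = 0 /\ m21 * c1 + m22 * c2 + m23 * c3 = 0.
    have [h1 h2 h3 h4] := hD2 c1 c2 c3 _ _ _ erefl erefl erefl.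
    have := C1 0 c1 c2 c3; have := C2 0 c1 c2 c3; rewrite h1 h2 h3 h4.
    set M1 := m11 * c1 + _; set M2 := m21 * c1 + _ => k2 k1; clear -k1 k2; split; lra.
  have [l1 l2] := L 1 0 0; have [l3 l4] := L 0 1 0; have [l5 l6] := L 0 0 1.
  by apply: done1; clear -l1 l2 l3 l4 l5 l6; lra.
have g0 : f1 * - a1 + f2 * - a2 + f3 * - a3 = 1 by rewrite !mulrN; lra.
have g1 : m11 * - a1 + m12 * - a2 + m13 * - a3 = 0 by rewrite !mulrN; lra.
have g2 : m21 * - a1 + m22 * - a2 + m23 * - a3 = 0 by rewrite !mulrN; lra.
have g3 : m31 * - a1 + m32 * - a2 + m33 * - a3 = 0 by rewrite !mulrN; lra.
have a1_0 : a1 = 0.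
  by have := C1 0 b1 b2 b3; rewrite mb1 mb2 mb3 g0 g1 g2 g3 => h; lra.
have a2_0 : a2 = 0.
  by have := C2 0 b1 b2 b3; rewrite mb1 mb2 mb3 g0 g1 g2 g3 => h; lra.
(* Now f3 a3 = -1, so a3 is nonzero and the third column of M vanishes; with the trace this leaves
   m11, m12, m21, which the pairings with u kill, and then f3 = m21 - m12 = 0. *)
clear g0 g1 g2 g3; subst a1 a2; exfalso.
have a3_0 : f3 * a3 = -1 by rewrite -fa; ring.
have k13 : m13 = 0.
  have /eqP : m13 * a3 = 0 by rewrite -[RHS]ma1; ring.
  rewrite mulf_eq0 => /orP[/eqP // | /eqP z]; move: a3_0; rewrite z mulr0 => /eqP.
  by rewrite eq_sym oppr_eq0 oner_eq0.
have k23 : m23 = 0.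
  have /eqP : m23 * a3 = 0 by rewrite -[RHS]ma2; ring.
  rewrite mulf_eq0 => /orP[/eqP // | /eqP z]; move: a3_0; rewrite z mulr0 => /eqP.
  by rewrite eq_sym oppr_eq0 oner_eq0.
have k33 : m33 = 0.
  have /eqP : m33 * a3 = 0 by rewrite -[RHS]ma3; ring.
  rewrite mulf_eq0 => /orP[/eqP // | /eqP z]; move: a3_0; rewrite z mulr0 => /eqP.
  by rewrite eq_sym oppr_eq0 oner_eq0.
have k22 : m22 = - m11 by lra.
subst m13 m23 m33 m22.
have l1 : m11 = 0 by have := C1 0 1 0 0; lra.
subst m11; have z : m21 * m12 = 0 by have := p01; lra.
have l2 : m12 = 0.
  have := C1 0 0 1 0 => h; have -> : m12 = - (a3 * (m21 * m12)) / 2 by lra.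
  by rewrite z mulr0 oppr0 mul0r.
subst m12; have l3 : m21 = 0 by have := C2 0 1 0 0; lra.
by move: a3_0; rewrite e3 l3 subrr mul0r => /eqP; rewrite eq_sym oppr_eq0 oner_eq0.
Qed.

End FamilyOne.

(** * The twelve algebras as targets *)

Section Targets.
Variable R : rcfType.

Definition nil12R : seq (seq (seq (R * nat * nat))) :=
 [:: [:: [::]; [::]; [::]; [::]; [::]; [::]; [::]];
     [:: [::]; [::]; [::]; [::]; [:: trm 1 1 2]; [:: trm 1 1 3]; [::]];
     [:: [::]; [::]; [::]; [:: trm 1 1 2]; [:: trm 1 1 3]; [:: trm 1 2 3]; [::]];
     [:: [::]; [::]; [:: trm 1 1 2]; [::]; [:: trm 1 1 3; trm 1 2 4]; [:: trm 1 1 4];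
         [:: trm 1 4 6; trm 1 3 4; trm 1 1 5; trm 1 2 3]];
     [:: [::]; [::]; [:: trm 1 1 2]; [::]; [:: trm 1 1 3]; [:: trm 1 2 4; trm 1 2 3];
         [:: trm 1 2 5; trm 1 3 4; trm 1 1 6; trm 1 1 5; trm (- 3) 2 6]];
     [:: [::]; [::]; [::]; [:: trm 1 1 2]; [:: trm 1 2 3]; [:: trm (- 1) 1 3];
         [:: trm 2 2 6; trm (- 2) 3 4; trm (- 2) 1 6; trm 2 2 5]];
     [:: [::]; [::]; [:: trm 1 1 2]; [::]; [::]; [:: trm 1 1 3; trm 1 2 4]; [:: trm 1 1 5]];
     [:: [::]; [::]; [:: trm 1 1 2]; [::]; [::]; [:: trm 1 1 3]; [:: trm 1 1 4; trm 1 2 5]];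
     [:: [::]; [::]; [::]; [:: trm 1 1 2]; [:: trm 1 1 3]; [:: trm 1 1 4]; [:: trm 1 1 5]];
     [:: [::]; [::]; [::]; [:: trm 1 1 2]; [:: trm 1 1 3]; [:: trm 1 1 4; trm 1 2 3];
         [:: trm 1 1 5]];
     [:: [::]; [::]; [:: trm 1 1 2]; [:: trm 1 1 3]; [:: trm 1 2 3];
         [:: trm 1 1 5; trm 1 2 4]; [:: trm 1 1 6; trm 1 3 4]];
     [:: [::]; [::]; [:: trm 1 1 2]; [:: trm 1 1 3]; [:: trm 1 2 3];
         [:: trm 1 1 5; trm 1 2 4]; [:: trm 1 1 6; trm 1 2 5; trm 1 3 4]]].

Lemma nil12RE : map (map (map (@cast2 R))) nil12 = nil12R.
Proof.
have m1 : (-1)%:~R = -1 :> R by ring.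
have m2 : (-2)%:~R = -2 :> R by ring.
have m3 : (-3)%:~R = -3 :> R by ring.
by rewrite /nil12 /nil12R /= /cast2 /tm /= ?m1 ?m2 ?m3.
Qed.

Definition tgt n := nth [::] nil12R n.

Lemma L12_tgt n i j k : L12 R n i j k = lc (tgt n) i j k.
Proof.
rewrite L12_lc /tgt -nil12RE; case: (ltnP n 12) => hn; first by rewrite (nth_map [::]).
by rewrite [nth _ nil12 _]nth_default // nth_default // size_map.
Qed.

Lemma tgt_wf n : all (@wf2 R) (tgt n).
Proof. by move: n => [|[|[|[|[|[|[|[|[|[|[|[|n]]]]]]]]]]]] //; rewrite /tgt nth_default. Qed.

Lemma iso_tgt c n : (n < 12)%N -> lie_iso c (lc (tgt n)) ->
  exists m : 'I_12, lie_iso c (L12 R m).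
Proof.
move=> hn h; exists (Ordinal hn); apply: lie_iso_trans h (lie_iso_ext _) => i j k.
by rewrite L12_tgt.
Qed.

Lemma lin2 (a b c d x y : R) : a * d - b * c != 0 ->
  a * x + b * y = 0 -> c * x + d * y = 0 -> x = 0 /\ y = 0.
Proof.
move=> nz h1 h2; split; apply: (mulr_0l nz).
- have -> : (a * d - b * c) * x = d * (a * x + b * y) - b * (c * x + d * y) by ring.
  by rewrite h1 h2 !mulr0 subr0.
- have -> : (a * d - b * c) * y = a * (c * x + d * y) - c * (a * x + b * y) by ring.
  by rewrite h1 h2 !mulr0 subr0.
Qed.

End Targets.

Ltac kernel_eqs hx h1 h2 h3 h4 h5 h6 h7 :=
  have h1 := hx 0%N isT; have h2 := hx 1%N isT; have h3 := hx 2%N isT; have h4 := hx 3%N isT;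
  have h5 := hx 4%N isT; have h6 := hx 5%N isT; have h7 := hx 6%N isT;
  rewrite /= in h1 h2 h3 h4 h5 h6 h7; clear hx.

Ltac iso_forms S :=
  apply: (@lc_iso _ _ _ S) => //; first by move=> [|[|[|[|[|[|[|?]]]]]]] x y // _ /=; ring.

(** * Two-step algebras over a three-dimensional space *)

Section TwoStep.
Variable R : rcfType.
Implicit Types (T : 'M[R]_(4, 3)).

Lemma sum4 (F : 'I_4 -> R) : \sum_j F j = F (inord 0) + F (inord 1) + F (inord 2) + F (inord 3).
Proof.
rewrite !big_ord_recl big_ord0 addr0 !addrA.
by congr (_ + _ + _ + _); congr (F _); apply/val_inj; rewrite /= inordK.
Qed.

(** Rows are taken in the basis 23, 31, 12, so that 2-forms on 3-space are vectors and the wedge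
    product of 1-forms is the cross product. *)
Definition two_step T : seq (seq (R * nat * nat)) :=
  let r i := [:: trm (T (inord i) (inord 0)) 2 3; trm (T (inord i) (inord 1)) 3 1;
                 trm (T (inord i) (inord 2)) 1 2] in
  [:: [::]; [::]; [::]; r 0; r 1; r 2; r 3]%N.

Lemma two_step_left T (L : 'M[R]_4) : L \in unitmx ->
  lie_iso (lc (two_step T)) (lc (two_step (L *m T))).
Proof.
move=> uL.
pose r i := [:: trm1 (L (inord i) (inord 0)) 4; trm1 (L (inord i) (inord 1)) 5;
                trm1 (L (inord i) (inord 2)) 6; trm1 (L (inord i) (inord 3)) 7].
apply: (@lc_iso _ _ _ [:: [:: trm1 1 1]; [:: trm1 1 2]; [:: trm1 1 3]; r 0; r 1; r 2; r 3]%N) => //.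
  move=> [|[|[|[|[|[|[|k]]]]]]] x y // _; rewrite /two_step /= ?mxE ?sum4; ring.
move=> x hx; kernel_eqs hx h1 h2 h3 h4 h5 h6 h7.
pose X : 'cV[R]_4 := \col_i x (i + 4)%N.
have LX : L *m X = 0.
  apply/colP => i; rewrite !mxE sum4 !mxE !inordK //.
  have -> : i = inord i by apply/val_inj; rewrite /= inord_val.
  case: i => [[|[|[|[|i]]]] hi] //=.
  - by rewrite -[RHS]h4; ring.
  - by rewrite -[RHS]h5; ring.
  - by rewrite -[RHS]h6; ring.
  - by rewrite -[RHS]h7; ring.
have X0 : X = 0 by rewrite -(mulKmx uL X) LX mulmx0.
have K (i : 'I_4) : x (i + 4)%N = 0 by have := congr1 (fun M : 'cV[R]_4 => M i 0) X0; rewrite !mxE.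
have := (K (inord 0), K (inord 1), K (inord 2), K (inord 3)); rewrite !inordK // => -[[[k4 k5] k6] k7].
move=> [|[|[|[|[|[|[|[|n]]]]]]]] //= _; lra.
Qed.

Lemma two_step_normal T : exists L : 'M[R]_4, L \in unitmx /\
  exists Q : 'M[R]_3, Q \in unitmx /\ L *m T = pid_mx (\rank T) *m Q.
Proof.
exists (invmx (col_ebase T)); rewrite unitmx_inv col_ebase_unit; split=> //.
exists (row_ebase T); rewrite row_ebase_unit; split=> //.
by rewrite -{2}(mulmx_ebase T) -!mulmxA mulKmx ?col_ebase_unit.
Qed.

Lemma sum3 (F : 'I_3 -> R) : \sum_j F j = F (inord 0) + F (inord 1) + F (inord 2).
Proof.
rewrite !big_ord_recl big_ord0 addr0 !addrA.
by congr (_ + _ + _); congr (F _); apply/val_inj; rewrite /= inordK.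
Qed.

(** Only the rank of T matters: ranks 0, 2, 3 give numbers 1, 2, 3 of the list. Rank 1 is the
    Heisenberg algebra plus an abelian factor, which is not on it. *)
Lemma two_step_class T : \rank T <> 1%N -> exists m : 'I_12, lie_iso (lc (two_step T)) (L12 R m).
Proof.
move=> nr1; have [L [uL [Q [uQ LT]]]] := two_step_normal T.
have i1 := two_step_left T uL; rewrite LT in i1.
have : (\rank T <= 3)%N by exact: rank_leq_col.
move: nr1 LT i1; case: (\rank T) => [|[|[|[|r]]]] // _ LT i1 _.
- rewrite pid_mx_0 mul0mx in i1; apply: (iso_tgt (n := 0)) => //; apply: lie_iso_trans i1 _.
  apply: (@lc_iso _ _ _ [:: [:: trm1 (1 : R) 1]; [:: trm1 1 2]; [:: trm1 1 3]; [:: trm1 1 4];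
    [:: trm1 1 5]; [:: trm1 1 6]; [:: trm1 1 7]]) => //.
    move=> [|[|[|[|[|[|[|k]]]]]]] x y // _; rewrite /two_step /= ?mxE; ring.
  move=> x hx; kernel_eqs hx h1 h2 h3 h4 h5 h6 h7.
  move=> [|[|[|[|[|[|[|[|n]]]]]]]] //= _; lra.
- pose q i k := Q (inord i) (inord k).
  have E : two_step (pid_mx 2 *m Q) = [:: [::]; [::]; [::];
    [:: trm (q 0 0) 2 3; trm (q 0 1) 3 1; trm (q 0 2) 1 2];
    [:: trm (q 1 0) 2 3; trm (q 1 1) 3 1; trm (q 1 2) 1 2];
    [:: trm 0 2 3; trm 0 3 1; trm 0 1 2]; [:: trm 0 2 3; trm 0 3 1; trm 0 1 2]]%N.
    rewrite /two_step /q !mxE !sum3 !mxE !inordK //= -?val_eqE /= ?inordK //=.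
    by rewrite !(mulr1n, mulr0n, mul1r, mul0r, addr0, add0r).
  rewrite E in i1; apply: (iso_tgt (n := 1)) => //; apply: lie_iso_trans i1 _.
  set a0 := q 0 0 in E *; set a1 := q 0 1 in E *; set a2 := q 0 2 in E *.
  set b0 := q 1 0 in E *; set b1 := q 1 1 in E *; set b2 := q 1 2 in E *.
  (* With p = a x b orthogonal to a and b one has p x (a x p) = N a and p x (b x p) = N b, which are
     the two structure equations of the target. *)
  pose p0 := a1 * b2 - a2 * b1; pose p1 := a2 * b0 - a0 * b2; pose p2 := a0 * b1 - a1 * b0.
  pose N := p0 ^+ 2 + p1 ^+ 2 + p2 ^+ 2.
  have N0 : N != 0.
    apply/eqP => hN.
    have [[z0 z1] z2] : (p0 = 0 /\ p1 = 0) /\ p2 = 0.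
      move/eqP: hN; rewrite /N paddr_eq0 ?addr_ge0 ?sqr_ge0 // paddr_eq0 ?sqr_ge0 //.
      by rewrite !sqrf_eq0 => /andP[/andP[/eqP -> /eqP ->] /eqP ->].
    have inj (x y : R) : x * a0 + y * b0 = 0 -> x * a1 + y * b1 = 0 -> x * a2 + y * b2 = 0 ->
        x = 0 /\ y = 0.
      move=> e0 e1 e2; pose v : 'rV[R]_3 := \row_i [:: x; y; 0]`_i.
      have vQ : v *m Q = 0.
        apply/rowP => k; rewrite !mxE sum3 !mxE !inordK //= mul0r addr0.
        have -> : k = inord k by apply/val_inj; rewrite /= inord_val.
        by case: k => [[|[|[|k]]] hk].
      have v0 : v = 0 by rewrite -(mulmxK uQ v) vQ mul0mx.
      have := congr1 (fun M : 'rV[R]_3 => (M 0 (inord 0), M 0 (inord 1))) v0.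
      by rewrite !mxE !inordK //= => -[-> ->].
    have [c0 _] : b0 = 0 /\ - a0 = 0 by apply: inj; rewrite /p0 /p1 /p2 in z0 z1 z2; lra.
    have [_ c1] : b0 = 0 /\ - a0 = 0 by apply: inj; rewrite /p0 /p1 /p2 in z0 z1 z2; lra.
    have [_ c2] : b1 = 0 /\ - a1 = 0 by apply: inj; rewrite /p0 /p1 /p2 in z0 z1 z2; lra.
    have [_ c3] : b2 = 0 /\ - a2 = 0 by apply: inj; rewrite /p0 /p1 /p2 in z0 z1 z2; lra.
    have [] : (1 : R) = 0 /\ (0 : R) = 0 by apply: inj; lra.
    by move/eqP; rewrite oner_eq0.
  apply: (@lc_iso _ _ _ [:: [:: trm1 p0 1; trm1 p1 2; trm1 p2 3];
    [:: trm1 (a1 * p2 - a2 * p1) 1; trm1 (a2 * p0 - a0 * p2) 2; trm1 (a0 * p1 - a1 * p0) 3];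
    [:: trm1 (b1 * p2 - b2 * p1) 1; trm1 (b2 * p0 - b0 * p2) 2; trm1 (b0 * p1 - b1 * p0) 3];
    [:: trm1 1 6]; [:: trm1 N 4]; [:: trm1 N 5]; [:: trm1 1 7]]) => //.
    by move=> [|[|[|[|[|[|[|k]]]]]]] x y // _ /=; rewrite /N /p0 /p1 /p2; ring.
  move=> x hx; kernel_eqs hx h1 h2 h3 h4 h5 h6 h7.
  have k4 : x 4 = 0 by apply: (mulr_0l N0); lra.
  have k5 : x 5 = 0 by apply: (mulr_0l N0); lra.
  pose A := a0 ^+ 2 + a1 ^+ 2 + a2 ^+ 2.
  (* The vectors p, a x p, b x p have triple product N^2. *)
  have N2 : N ^+ 2 != 0 by rewrite sqrf_eq0.
  have T3 : (N ^+ 2) = p0 * ((a2 * p0 - a0 * p2) * (b0 * p1 - b1 * p0) - (a0 * p1 - a1 * p0) * (b2 * p0 - b0 * p2))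
    - p1 * ((a1 * p2 - a2 * p1) * (b0 * p1 - b1 * p0) - (a0 * p1 - a1 * p0) * (b1 * p2 - b2 * p1))
    + p2 * ((a1 * p2 - a2 * p1) * (b2 * p0 - b0 * p2) - (a2 * p0 - a0 * p2) * (b1 * p2 - b2 * p1)).
    by rewrite /N /p0 /p1 /p2; ring.
  move: h1 h2 h3; set A0 := a1 * p2 - a2 * p1; set A1 := a2 * p0 - a0 * p2; set A2 := a0 * p1 - a1 * p0.
  set B0 := b1 * p2 - b2 * p1; set B1 := b2 * p0 - b0 * p2; set B2 := b0 * p1 - b1 * p0 => h1 h2 h3.
  have k1 : x 1 = 0.
    apply: (mulr_0l N2); rewrite T3 -/A0 -/A1 -/A2 -/B0 -/B1 -/B2.
    transitivity ((A1 * B2 - A2 * B1) * (p0 * x 1 + (p1 * x 2 + (p2 * x 3 + 0)))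
      - (p1 * B2 - p2 * B1) * (A0 * x 1 + (A1 * x 2 + (A2 * x 3 + 0)))
      + (p1 * A2 - p2 * A1) * (B0 * x 1 + (B1 * x 2 + (B2 * x 3 + 0)))); first by ring.
    by rewrite h1 h2 h3; ring.
  have k2 : x 2 = 0.
    apply: (mulr_0l N2); rewrite T3 -/A0 -/A1 -/A2 -/B0 -/B1 -/B2.
    transitivity (- (A0 * B2 - A2 * B0) * (p0 * x 1 + (p1 * x 2 + (p2 * x 3 + 0)))
      + (p0 * B2 - p2 * B0) * (A0 * x 1 + (A1 * x 2 + (A2 * x 3 + 0)))
      - (p0 * A2 - p2 * A0) * (B0 * x 1 + (B1 * x 2 + (B2 * x 3 + 0)))); first by ring.
    by rewrite h1 h2 h3; ring.
  have k3 : x 3 = 0.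
    apply: (mulr_0l N2); rewrite T3 -/A0 -/A1 -/A2 -/B0 -/B1 -/B2.
    transitivity ((A0 * B1 - A1 * B0) * (p0 * x 1 + (p1 * x 2 + (p2 * x 3 + 0)))
      - (p0 * B1 - p1 * B0) * (A0 * x 1 + (A1 * x 2 + (A2 * x 3 + 0)))
      + (p0 * A1 - p1 * A0) * (B0 * x 1 + (B1 * x 2 + (B2 * x 3 + 0)))); first by ring.
    by rewrite h1 h2 h3; ring.
  by move=> [|[|[|[|[|[|[|[|n]]]]]]]] //= _; lra.
(* In rank 3 the matrix Q only mixes the first three rows and is undone by a further row
   operation. *)
pose L2 : 'M[R]_(3 + 1) := block_mx (invmx Q) 0 0 1%:M.
have uL2 : L2 \in unitmx.
  by rewrite unitmxE det_lblock det1 mulr1 -unitmxE unitmx_inv.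
have i2 := two_step_left (pid_mx 3 *m Q) uL2.
have E2 : L2 *m (pid_mx 3 *m Q) = pid_mx 3.
  have -> : pid_mx 3 = col_mx 1%:M 0 :> 'M[R]_(3 + 1, 3) by rewrite -pid_mx_col.
  have -> : col_mx 1%:M 0 *m Q = col_mx Q 0 :> 'M[R]_(3 + 1, 3).
    by rewrite mul_col_mx mul1mx mul0mx.
  rewrite mul_block_col (mulVmx uQ).
  by rewrite !mul0mx !mulmx0 !addr0.
rewrite E2 in i2; have E : two_step (pid_mx 3) = [:: [::]; [::]; [::];
    [:: trm 1 2 3; trm 0 3 1; trm 0 1 2]; [:: trm 0 2 3; trm 1 3 1; trm 0 1 2];
    [:: trm 0 2 3; trm 0 3 1; trm 1 1 2]; [:: trm 0 2 3; trm 0 3 1; trm 0 1 2]].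
  by rewrite /two_step !mxE !inordK.
rewrite E in i2; apply: (iso_tgt (n := 2)) => //; apply: lie_iso_trans i1 (lie_iso_trans i2 _).
iso_forms [:: [:: trm1 (1 : R) 1]; [:: trm1 1 2]; [:: trm1 1 3]; [:: trm1 1 6]; [:: trm1 (-1) 5];
    [:: trm1 1 4]; [:: trm1 1 7]].
move=> x hx; kernel_eqs hx h1 h2 h3 h4 h5 h6 h7.
by move=> [|[|[|[|[|[|[|[|n]]]]]]]] //= _; lra.
Qed.

End TwoStep.

Ltac from_eq k := by rewrite -[RHS]k; ring.

(** * Untwisted solutions: vanishing eigenvalue *)

Section FamilyOneClass.
Variable R : rcfType.

(** A certificate: [e] is a known relation and [w] its cofactor in u - v, which leaves a single
    polynomial identity. *)
Lemma eq_from_zero (e w u v : R) : e = 0 -> u - v = e * w -> u = v.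
Proof. by move=> -> h; apply/eqP; rewrite -subr_eq0 h mul0r. Qed.

(** Here dx1 = dx2 = 0, dx0 = w (f1 x1 + f2 x2) + n x1 x2 and dx3 = w (h1 x1 + h2 x2). *)
Definition untwisted (n f1 f2 h1 h2 d0 d1 d2 d3 : R) :=
  model f1 f2 0 0 0 0 0 0 0 h1 h2 0 n 0 0 0 0 d0 d1 d2 d3.

(** With d0 = d3 = 0 all differentials are 2-forms in w, x1, x2, and only rank 1 has to be excluded.
    In rank 1 the 2 by 2 minors of [t] vanish, and combinations of them are sums of squares that
    force T = 0. *)
Lemma untwisted_two_step (n f1 f2 h1 h2 d1 d2 : R) :
  exists m : 'I_12, lie_iso (lc (untwisted n f1 f2 h1 h2 0 d1 d2 0)) (L12 R m).
Proof.
pose t := [:: [:: n; - f2; f1]; [:: 0; - h2; h1]; [:: - (f2 + h1); - d2; d1];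
              [:: h2 - f1; - d1; n - d2]].
pose T : 'M[R]_(4, 3) := \matrix_(i, j) (nth [::] t i)`_j.
have TE i k : (i < 4)%N -> (k < 3)%N -> T (inord i) (inord k) = (nth [::] t i)`_k.
  by move=> hi hk; rewrite mxE !inordK.
have i0 : lie_iso (lc (untwisted n f1 f2 h1 h2 0 d1 d2 0)) (lc (two_step T)).
  apply: (@lc_iso _ _ _ [:: [:: trm1 (1 : R) 1]; [:: trm1 1 3]; [:: trm1 1 4]; [:: trm1 1 2];
    [:: trm1 1 5]; [:: trm1 1 6]; [:: trm1 1 7]]) => //.
    by move=> [|[|[|[|[|[|[|k]]]]]]] x y // _; rewrite /two_step /= ?TE //=; ring.
  move=> x hx; kernel_eqs hx k1 k2 k3 k4 k5 k6 k7.
  by move=> [|[|[|[|[|[|[|[|k]]]]]]]] //= _; lra.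
have [m im] : exists m : 'I_12, lie_iso (lc (two_step T)) (L12 R m); last first.
  by exists m; apply: lie_iso_trans i0 im.
apply: two_step_class => r1.
have [L [uL [Q [uQ LT]]]] := two_step_normal T.
have ab i k : T i k = invmx L i (inord 0) * Q (inord 0) k.
  have pQ j : (j < 4)%N -> (pid_mx 1 *m Q : 'M_(4, 3)) (inord j) k = (j == 0)%:R * Q (inord 0) k.
    move=> hj; rewrite mxE sum3 !mxE !inordK //.
    by case: j hj => [|j] hj; rewrite /= ?(andbF, mulr0n, mulr1n, mul0r, mul1r, addr0).
  by rewrite -(mulKmx uL T) LT r1 mxE sum4 !pQ //=; ring.
have mn i k j l : (i < 4)%N -> (k < 3)%N -> (j < 4)%N -> (l < 3)%N ->
    (nth [::] t i)`_k * (nth [::] t j)`_l = (nth [::] t i)`_l * (nth [::] t j)`_k.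
  by move=> hi hk hj hl; rewrite -!TE // !ab; ring.
have m1 := mn 0%N 0%N 1%N 1%N isT isT isT isT; have m2 := mn 0%N 0%N 1%N 2%N isT isT isT isT.
have m3 := mn 0%N 0%N 2%N 1%N isT isT isT isT; have m4 := mn 0%N 0%N 3%N 2%N isT isT isT isT.
have m5 := mn 0%N 0%N 2%N 2%N isT isT isT isT; have m6 := mn 1%N 0%N 2%N 2%N isT isT isT isT.
have m7 := mn 1%N 0%N 3%N 1%N isT isT isT isT; have m8 := mn 0%N 1%N 1%N 2%N isT isT isT isT.
have m9 := mn 2%N 1%N 3%N 2%N isT isT isT isT.
rewrite /= in m1 m2 m3 m4 m5 m6 m7 m8 m9; clear mn ab.
have n0 : n = 0.
  apply/eqP; apply/negP => /negP n0.
  have e2 : h2 = 0 by apply: (mulr_0l n0); lra.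
  have e1 : h1 = 0 by apply: (mulr_0l n0); lra.
  have s : n ^+ 2 + (f1 ^+ 2 + f2 ^+ 2) = 0 by subst h1 h2; lra.
  move/eqP: s; rewrite paddr_eq0 ?addr_ge0 ?sqr_ge0 // sqrf_eq0 (negPf n0) //.
subst n.
have e1 : f2 + h1 = 0 by apply/eqP; rewrite -sqrf_eq0; apply/eqP; lra.
have e2 : h2 - f1 = 0 by apply/eqP; rewrite -sqrf_eq0; apply/eqP; lra.
have [f10 f20] : f1 = 0 /\ f2 = 0.
  have a1 : h1 = - f2 by lra.
  have a2 : h2 = f1 by lra.
  by apply: sum2sq_eq0; rewrite a1 a2 in m8; lra.
have [d10 d20] : d1 = 0 /\ d2 = 0 by apply: sum2sq_eq0; lra.
have h10 : h1 = 0 by lra.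
have h20 : h2 = 0 by lra.
have T0 : T = 0.
  apply/matrixP => i k; rewrite !mxE /t f10 f20 d10 d20 h10 h20.
  by case: i => [[|[|[|[|i]]]] hi] //=; case: k => [[|[|[|k]]] hk] //=; lra.
by move: r1; rewrite T0 mxrank0.
Qed.

(** The x1 x2 coefficients of dy and d eta are - a and - b. If both vanish, number 9 of the list
    results. Otherwise a y + b eta carries an x1 x2 term and b y - a eta does not, which is number
    10. *)
Lemma untwisted_rank2 (f1 f2 h1 h2 d0 d1 d2 d3 : R) : f1 * h2 - f2 * h1 != 0 ->
  d0 ^+ 2 + d3 ^+ 2 != 0 ->
  exists m : 'I_12, lie_iso (lc (untwisted 0 f1 f2 h1 h2 d0 d1 d2 d3)) (L12 R m).
Proof.
move=> D0 r0; pose D := f1 * h2 - f2 * h1; pose r := d0 ^+ 2 + d3 ^+ 2.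
pose a := f2 + h1; pose b := f1 - h2.
have [s0|s0] := eqVneq (a ^+ 2 + b ^+ 2) 0.
  have [a0 b0] := sum2sq_eq0 s0; rewrite /a in a0; rewrite /b in b0.
  have eh1 : h1 = - f2 by lra.
  have eh2 : h2 = f1 by lra.
  rewrite eh1 eh2 in D0 *.
  apply: (iso_tgt (n := 8)) => //.
  iso_forms [:: [:: trm1 (1 : R) 1]; [:: trm1 (d0 * f1 - d3 * f2) 3; trm1 (d0 * f2 + d3 * f1) 4];
    [:: trm1 (- d3 * f1 - d0 * f2) 3; trm1 (- d3 * f2 + d0 * f1) 4];
    [:: trm1 d0 2; trm1 d3 5; trm1 d1 3; trm1 d2 4];
    [:: trm1 (- d3) 2; trm1 d0 5; trm1 (- d2) 3; trm1 d1 4]; [:: trm1 1 6]; [:: trm1 1 7]].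
  move=> x hx; kernel_eqs hx k1 k2 k3 k4 k5 k6 k7.
  have [x3 x4] : x 3 = 0 /\ x 4 = 0.
    apply: (@lin2 _ (d0 * f1 - d3 * f2) (d0 * f2 + d3 * f1) (- d3 * f1 - d0 * f2) (- d3 * f2 + d0 * f1)); [|from_eq k2|from_eq k3].
    by rewrite (_ : _ - _ = r * (f1 * f1 - f2 * - f2)); [rewrite mulf_neq0 | rewrite /r; ring].
  have [x2 x5] : x 2 = 0 /\ x 5 = 0.
    rewrite x3 x4 in k4 k5; apply: (@lin2 _ d0 d3 (- d3) d0); [|from_eq k4|from_eq k5].
    by rewrite (_ : _ - _ = r) // /r; ring.
  by move=> [|[|[|[|[|[|[|[|k]]]]]]]] //= _; lra.
(* [kap] scales the third form so that its product with the second has the x1 x2 coefficient of d(a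
   y + b eta). *)
pose kap := (r * D)^-1.
have kap0 : kap != 0 by rewrite /kap invr_eq0 mulf_neq0.
have hkap : kap * (r * (a ^+ 2 + b ^+ 2) * D) = a ^+ 2 + b ^+ 2.
  by rewrite /kap; field; rewrite r0 D0.
pose z1 := d0 * f1 + d3 * h1; pose z2 := d0 * f2 + d3 * h2.
pose y1 := - d3 * f1 + d0 * h1; pose y2 := - d3 * f2 + d0 * h2.
apply: (iso_tgt (n := 9)) => //.
apply: (@lc_iso _ _ _ [:: [:: trm1 (1 : R) 1];
    [:: trm1 (a * z1 + b * y1) 3; trm1 (a * z2 + b * y2) 4];
    [:: trm1 (kap * (b * z1 - a * y1)) 3; trm1 (kap * (b * z2 - a * y2)) 4];
    [:: trm1 (a * d0 - b * d3) 2; trm1 (a * d3 + b * d0) 5; trm1 (a * d1 - b * d2) 3; trm1 (a * d2 + b * d1) 4];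
    [:: trm1 (kap * (b * d0 + a * d3)) 2; trm1 (kap * (b * d3 - a * d0)) 5;
        trm1 (kap * (b * d1 + a * d2)) 3; trm1 (kap * (b * d2 - a * d1)) 4];
    [:: trm1 a 6; trm1 b 7]; [:: trm1 (kap * b) 6; trm1 (- (kap * a)) 7]]) => //.
  move=> [|[|[|[|[|[|[|k]]]]]]] x y // _ /=; rewrite ?/z1 ?/z2 ?/y1 ?/y2; try ring.
    transitivity ((kap * (r * (a ^+ 2 + b ^+ 2) * D)) * - (x 3 * y 4 - x 4 * y 3) +
      1 * (x 1 * ((a * d0 - b * d3) * y 2 + (a * d3 + b * d0) * y 5 + (a * d1 - b * d2) * y 3 + (a * d2 + b * d1) * y 4)
        - y 1 * ((a * d0 - b * d3) * x 2 + (a * d3 + b * d0) * x 5 + (a * d1 - b * d2) * x 3 + (a * d2 + b * d1) * x 4))).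
      by rewrite /r /D; ring.
    by rewrite hkap /a /b; ring.
  by rewrite /a /b; ring.
move=> x hx; kernel_eqs hx k1 k2 k3 k4 k5 k6 k7.
have [x3 x4] : x 3 = 0 /\ x 4 = 0.
  apply: (@lin2 _ (a * z1 + b * y1) (a * z2 + b * y2) (kap * (b * z1 - a * y1)) (kap * (b * z2 - a * y2))); [|from_eq k2|from_eq k3].
  rewrite (_ : _ - _ = - (kap * (r * (a ^+ 2 + b ^+ 2) * D))); first by rewrite hkap oppr_eq0.
  by rewrite /z1 /z2 /y1 /y2 /r /D; ring.
have [x2 x5] : x 2 = 0 /\ x 5 = 0.
  rewrite x3 x4 in k4 k5.
  apply: (@lin2 _ (a * d0 - b * d3) (a * d3 + b * d0) (kap * (b * d0 + a * d3)) (kap * (b * d3 - a * d0))); [|from_eq k4|from_eq k5].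
  rewrite (_ : _ - _ = - (kap * (r * (a ^+ 2 + b ^+ 2)))); last by rewrite /r; ring.
  by rewrite oppr_eq0 !mulf_neq0.
have [x6 x7] : x 6 = 0 /\ x 7 = 0.
  apply: (@lin2 _ a b (kap * b) (- (kap * a))); [|from_eq k6|from_eq k7].
  rewrite (_ : _ - _ = - (kap * (a ^+ 2 + b ^+ 2))); last by ring.
  by rewrite oppr_eq0 mulf_neq0.
by move=> [|[|[|[|[|[|[|[|k]]]]]]]] //= _; lra.
Qed.

Lemma untwisted_flat (d0 d1 d2 d3 : R) : d0 ^+ 2 + d3 ^+ 2 != 0 ->
  exists m : 'I_12, lie_iso (lc (untwisted 0 0 0 0 0 d0 d1 d2 d3)) (L12 R m).
Proof.
move=> r0; apply: (iso_tgt (n := 1)) => //.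
iso_forms [:: [:: trm1 (1 : R) 1]; [:: trm1 d0 2; trm1 d3 5; trm1 d1 3; trm1 d2 4];
    [:: trm1 (- d3) 2; trm1 d0 5; trm1 (- d2) 3; trm1 d1 4]; [:: trm1 1 3]; [:: trm1 1 6];
    [:: trm1 1 7]; [:: trm1 1 4]].
move=> x hx; kernel_eqs hx k1 k2 k3 k4 k5 k6 k7.
have [x2 x5] : x 2 = 0 /\ x 5 = 0.
  have x3 : x 3 = 0 by lra.
  have x4 : x 4 = 0 by lra.
  rewrite x3 x4 in k2 k3; apply: (@lin2 _ d0 d3 (- d3) d0); [|from_eq k2|from_eq k3].
  by rewrite (_ : _ - _ = d0 ^+ 2 + d3 ^+ 2) //; ring.
by move=> [|[|[|[|[|[|[|[|k]]]]]]]] //= _; lra.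
Qed.

(* Here D is the rank one map (c x0 + s x3) -> (c^2 + s^2) (g1 x1 + g2 x2). *)
Lemma untwisted_rank1 (c s g1 g2 d0 d1 d2 d3 : R) : c ^+ 2 + s ^+ 2 != 0 -> g1 ^+ 2 + g2 ^+ 2 != 0 ->
  d0 ^+ 2 + d3 ^+ 2 != 0 ->
  exists m : 'I_12, lie_iso (lc (untwisted 0 (c * g1) (c * g2) (s * g1) (s * g2) d0 d1 d2 d3)) (L12 R m).
Proof.
move=> p0 q0 r0; set p := c ^+ 2 + s ^+ 2 in p0; set q := g1 ^+ 2 + g2 ^+ 2 in q0.
pose a := d0 * c + d3 * s; pose a' := - d0 * s + d3 * c.
pose t := a ^+ 2 + a' ^+ 2.
have tE : t = p * (d0 ^+ 2 + d3 ^+ 2) by rewrite /t /p /a /a'; ring.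
have t0 : t != 0 by rewrite tE mulf_neq0.
pose P := c * g2 + s * g1; pose Q := c * g1 - s * g2.
(* Up to the factor - p, [U] and [V] are the x1 x2 coefficients of the differentials of p (a y - a'
   eta) and p (a' y + a eta). If V = 0, these forms give number 7; otherwise a multiple of the
   second removes the term from the first, giving number 8. *)
pose U := a * P - a' * Q; pose V := a' * P + a * Q.
have UV : U ^+ 2 + V ^+ 2 = t * (p * q) by rewrite /U /V /P /Q /t /p /q; ring.
(* Z1 = t (c x0 + s x3) + ..., Z2 = t (-s x0 + c x3) + ... *)
pose z13 := p * (a * d1 + a' * d2); pose z14 := p * (a * d2 - a' * d1).
pose z23 := p * (a' * d1 - a * d2); pose z24 := p * (a' * d2 + a * d1).
have [V0|V0] := eqVneq V 0.
  have U0 : U != 0.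
    by apply/eqP => U0; move: UV; rewrite U0 V0 expr0n addr0 => /esym/eqP; rewrite !mulf_eq0 (negPf t0) (negPf p0) (negPf q0).
  have [k hk k0] : exists2 k, U - k * (t * q) = 0 & k != 0.
    exists (U / (t * q)); first by rewrite divfK ?mulf_neq0 // subrr.
    by rewrite !mulf_neq0 ?invr_eq0 ?mulf_neq0.
  apply: (iso_tgt (n := 6)) => //.
  apply: (@lc_iso _ _ _ [:: [:: trm1 (1 : R) 1]; [:: trm1 (t * p * g1) 3; trm1 (t * p * g2) 4];
    [:: trm1 (t * c) 2; trm1 (t * s) 5; trm1 z13 3; trm1 z14 4];
    [:: trm1 (k * g2) 3; trm1 (- (k * g1)) 4];
    [:: trm1 (- (t * s)) 2; trm1 (t * c) 5; trm1 z23 3; trm1 z24 4];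
    [:: trm1 (p * a) 6; trm1 (- (p * a')) 7]; [:: trm1 (p * a') 6; trm1 (p * a) 7]]) => //.
    move=> [|[|[|[|[|[|[|i]]]]]]] x y // _ /=; try by rewrite ?/p; ring.
    - apply: (eq_from_zero (w := p * (x 3 * y 4 - x 4 * y 3)) hk).
      by rewrite /z13 /z14 /U /P /Q /t /q /p /a /a'; ring.
    - apply: (eq_from_zero (w := p * (x 3 * y 4 - x 4 * y 3)) V0).
      by rewrite /z23 /z24 /V /P /Q /t /p /a /a'; ring.
  move=> x hx; kernel_eqs hx k1 k2 k3 k4 k5 k6 k7.
  have [x3 x4] : x 3 = 0 /\ x 4 = 0.
    apply: (@lin2 _ (t * p * g1) (t * p * g2) (k * g2) (- (k * g1))); [|from_eq k2|from_eq k4].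
    by rewrite (_ : _ - _ = - (t * p * k * q)); [rewrite oppr_eq0 !mulf_eq0 ?(negPf t0) ?(negPf p0) ?(negPf k0) ?(negPf q0) | rewrite /q; ring].
  rewrite x3 x4 in k3 k5.
  have [x2 x5] : x 2 = 0 /\ x 5 = 0.
    apply: (@lin2 _ (t * c) (t * s) (- (t * s)) (t * c)); [|from_eq k3|from_eq k5].
    by rewrite (_ : _ - _ = t * t * p); [rewrite !mulf_eq0 ?(negPf t0) ?(negPf p0) | rewrite /p; ring].
  have [x6 x7] : x 6 = 0 /\ x 7 = 0.
    apply: (@lin2 _ (p * a) (- (p * a')) (p * a') (p * a)); [|from_eq k6|from_eq k7].
    by rewrite (_ : _ - _ = p * p * t); [rewrite !mulf_eq0 ?(negPf t0) ?(negPf p0) | rewrite /t; ring].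
  by move=> [|[|[|[|[|[|[|[|i]]]]]]]] //= _; lra.
pose mu := U / V; have hmu : U - mu * V = 0 by rewrite /mu divfK // subrr.
have [k hk k0] : exists2 k, V - k * (t * q) = 0 & k != 0.
  exists (V / (t * q)); first by rewrite divfK ?mulf_neq0 // subrr.
  by rewrite !mulf_neq0 ?invr_eq0 ?mulf_neq0.
apply: (iso_tgt (n := 7)) => //.
apply: (@lc_iso _ _ _ [:: [:: trm1 (1 : R) 1]; [:: trm1 (t * p * g1) 3; trm1 (t * p * g2) 4];
    [:: trm1 (t * (c + mu * s)) 2; trm1 (t * (s - mu * c)) 5; trm1 (z13 - mu * z23) 3;
        trm1 (z14 - mu * z24) 4];
    [:: trm1 (- (t * s)) 2; trm1 (t * c) 5; trm1 z23 3; trm1 z24 4];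
    [:: trm1 (k * g2) 3; trm1 (- (k * g1)) 4];
    [:: trm1 (p * (a - mu * a')) 6; trm1 (- (p * (a' + mu * a))) 7];
    [:: trm1 (p * a') 6; trm1 (p * a) 7]]) => //.
  move=> [|[|[|[|[|[|[|i]]]]]]] x y // _ /=; try by rewrite ?/p; ring.
  - apply: (eq_from_zero (w := p * (x 3 * y 4 - x 4 * y 3)) hmu).
    by rewrite /z13 /z14 /z23 /z24 /U /V /P /Q /t /p /a /a'; ring.
  - apply: (eq_from_zero (w := p * (x 3 * y 4 - x 4 * y 3)) hk).
    by rewrite /z23 /z24 /V /P /Q /t /q /p /a /a'; ring.
move=> x hx; kernel_eqs hx k1 k2 k3 k4 k5 k6 k7.
have [x3 x4] : x 3 = 0 /\ x 4 = 0.
  apply: (@lin2 _ (t * p * g1) (t * p * g2) (k * g2) (- (k * g1))); [|from_eq k2|from_eq k5].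
  by rewrite (_ : _ - _ = - (t * p * k * q)); [rewrite oppr_eq0 !mulf_eq0 ?(negPf t0) ?(negPf p0) ?(negPf k0) ?(negPf q0) | rewrite /q; ring].
rewrite x3 x4 in k3 k4.
have [x2 x5] : x 2 = 0 /\ x 5 = 0.
  apply: (@lin2 _ (t * (c + mu * s)) (t * (s - mu * c)) (- (t * s)) (t * c)); [|from_eq k3|from_eq k4].
  by rewrite (_ : _ - _ = t * t * p); [rewrite !mulf_eq0 ?(negPf t0) ?(negPf p0) | rewrite /p; ring].
have [x6 x7] : x 6 = 0 /\ x 7 = 0.
  apply: (@lin2 _ (p * (a - mu * a')) (- (p * (a' + mu * a))) (p * a') (p * a)); [|from_eq k6|from_eq k7].
  by rewrite (_ : _ - _ = p * p * t); [rewrite !mulf_eq0 ?(negPf t0) ?(negPf p0) | rewrite /t; ring].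
by move=> [|[|[|[|[|[|[|[|i]]]]]]]] //= _; lra.
Qed.

Lemma untwisted_class (n f1 f2 h1 h2 d0 d1 d2 d3 : R) : n = 0 \/ (d0 = 0 /\ d3 = 0) ->
  exists m : 'I_12, lie_iso (lc (untwisted n f1 f2 h1 h2 d0 d1 d2 d3)) (L12 R m).
Proof.
move=> hn; have [r0|r0] := eqVneq (d0 ^+ 2 + d3 ^+ 2) 0.
  have [-> ->] := sum2sq_eq0 r0; exact: untwisted_two_step.
have {hn}-> : n = 0.
  by case: hn => // -[e0 e3]; move: r0; rewrite e0 e3 expr0n addr0 eqxx.
have [D0|D0] := eqVneq (f1 * h2 - f2 * h1) 0; last exact: untwisted_rank2.
have [q0|q0] := eqVneq (f1 ^+ 2 + f2 ^+ 2) 0.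
  have [-> ->] := sum2sq_eq0 q0.
  have [q1|q1] := eqVneq (h1 ^+ 2 + h2 ^+ 2) 0.
    by have [-> ->] := sum2sq_eq0 q1; apply: untwisted_flat.
  have := @untwisted_rank1 0 1 h1 h2 d0 d1 d2 d3; rewrite !mul0r !mul1r.
  by apply=> //; rewrite expr0n expr1n add0r oner_eq0.
pose s := (f1 * h1 + f2 * h2) / (f1 ^+ 2 + f2 ^+ 2).
have E1 : h1 = s * f1.
  apply: (mulIf q0); rewrite mulrAC /s divfK //.
  by apply: (eq_from_zero (w := - f2) D0); ring.
have E2 : h2 = s * f2.
  apply: (mulIf q0); rewrite mulrAC /s divfK //.
  by apply: (eq_from_zero (w := f1) D0); ring.
have := @untwisted_rank1 1 s f1 f2 d0 d1 d2 d3; rewrite !mul1r -E1 -E2.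
apply=> //; rewrite expr1n; apply/eqP => h.
by have := sqr_ge0 s; lra.
Qed.

End FamilyOneClass.

(** * A normal form governed by the Eisenstein norm *)

Section Eisenstein.
Variable R : rcfType.

(** The products of e^4, e^5 with e^2, e^3 in the last differential have the coefficients of a^2 - a
    b + b^2. *)
Definition nf6 (al be s t : R) : seq (seq (R * nat * nat)) :=
  [:: [::]; [::]; [::]; [:: trm 1 1 2]; [:: trm 1 1 3];
      [:: trm 1 2 3; trm al 1 4; trm be 1 5];
      [:: trm 1 4 2; trm (-1) 4 3; trm 1 5 3; trm 1 6 1; trm s 1 4; trm t 1 5]].

(** Adding multiples k and l of e^1 to e^2 and e^3, and correcting e^6, changes the last
    differential by terms in 14 and 15. Removing [s] and [t] means k - 2 l = - s and k + l = - t,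
    whence the division by 3. *)
Lemma nf6_shift (al be s t : R) : lie_iso (lc (nf6 al be s t)) (lc (nf6 al be 0 0)).
Proof.
pose l := (s - t) / 3; pose k := - t - l.
apply: (@lc_iso _ _ _ [:: [:: trm1 (1 : R) 1]; [:: trm1 1 2; trm1 k 1]; [:: trm1 1 3; trm1 l 1];
   [:: trm1 1 4]; [:: trm1 1 5]; [:: trm1 1 6; trm1 k 5; trm1 (- l) 4]; [:: trm1 1 7]]) => //.
  by move=> [|[|[|[|[|[|[|i]]]]]]] x y // _ /=; rewrite /k /l; field.
move=> x hx; kernel_eqs hx h1 h2 h3 h4 h5 h6 h7.
have x1 : x 1 = 0 by lra.
have x4 : x 4 = 0 by lra.
have x5 : x 5 = 0 by lra.
rewrite x1 x4 x5 in h2 h3 h6.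
by move=> [|[|[|[|[|[|[|[|i]]]]]]]] //= _; lra.
Qed.

(** N vanishes only for al = be = 0, where number 6 results. Otherwise (al, be) and (- be, al + be)
    have determinant N, and adapting both pairs e^2, e^3 and e^4, e^5 to them gives number 4. *)
Lemma nf6_class (al be s t : R) : exists m : 'I_12, lie_iso (lc (nf6 al be s t)) (L12 R m).
Proof.
suff [m hm] : exists m : 'I_12, lie_iso (lc (nf6 al be 0 0)) (L12 R m).
  by exists m; apply: lie_iso_trans (nf6_shift _ _ _ _) hm.
pose N := al ^+ 2 + al * be + be ^+ 2.
have [N0|N0] := eqVneq N 0.
  have [-> hb] : al = 0 /\ - be = 0 by apply: eisenstein_eq0; rewrite -[RHS]N0 /N; ring.
  have -> : be = 0 by lra.
  apply: (iso_tgt (n := 5)) => //.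
  iso_forms [:: [:: trm1 (1 : R) 2]; [:: trm1 1 3]; [:: trm1 1 1]; [:: trm1 1 6]; [:: trm1 (-1) 5];
    [:: trm1 1 4]; [:: trm1 2 7]].
  move=> x hx; kernel_eqs hx h1 h2 h3 h4 h5 h6 h7.
  by move=> [|[|[|[|[|[|[|[|i]]]]]]]] //= _; lra.
apply: (iso_tgt (n := 3)) => //.
have [i i0 e2] : exists2 i, i != 0 & i * (i * (al ^+ 2 + al * be + be ^+ 2)) = i.
  by exists N^-1; rewrite ?invr_eq0 // -/N mulVf // mulr1.
apply: (@lc_iso _ _ _ [:: [:: trm1 (1 : R) 1]; [:: trm1 (i * al) 2; trm1 (i * be) 3];
   [:: trm1 (i * al) 4; trm1 (i * be) 5];
   [:: trm1 (- (i * be)) 2; trm1 (i * (al + be)) 3]; [:: trm1 i 6];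
   [:: trm1 (- (i * be)) 4; trm1 (i * (al + be)) 5]; [:: trm1 (- i) 7]]) => //.
  move=> [|[|[|[|[|[|[|j]]]]]]] x y // _ /=; try by ring.
    transitivity ((i * (i * (al ^+ 2 + al * be + be ^+ 2))) * (x 2 * y 3 - x 3 * y 2) +
      i * (al * (x 1 * y 4 - x 4 * y 1) + be * (x 1 * y 5 - x 5 * y 1))).
      by ring.
    by rewrite e2; ring.
  transitivity (- (i * (i * (al ^+ 2 + al * be + be ^+ 2))) * (x 4 * y 2 - x 2 * y 4 - (x 4 * y 3 - x 3 * y 4)
     + (x 5 * y 3 - x 3 * y 5)) - i * (x 6 * y 1 - x 1 * y 6)).
    by ring.
  by rewrite e2; ring.
move=> x hx; kernel_eqs hx h1 h2 h3 h4 h5 h6 h7.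
have det : i * al * (i * (al + be)) - i * be * (- (i * be)) != 0.
  have -> : i * al * (i * (al + be)) - i * be * (- (i * be)) =
    i * (i * (al ^+ 2 + al * be + be ^+ 2)) by ring.
  by rewrite e2.
have [x2 x3] : x 2 = 0 /\ x 3 = 0 by apply: (lin2 det); [from_eq h2 | from_eq h4].
have [x4 x5] : x 4 = 0 /\ x 5 = 0 by apply: (lin2 det); [from_eq h3 | from_eq h6].
have x6 : x 6 = 0 by apply: (mulr_0l i0); lra.
have x7 : x 7 = 0 by apply: (mulr_0l i0); lra.
by move=> [|[|[|[|[|[|[|[|j]]]]]]]] //= _; lra.
Qed.

Lemma twisted_nf6 (b f l e d0 d1 d2 d3 : R) : b != 0 -> l != 0 ->
  exists al be s t, lie_iso
   (lc (model ((b ^+ 2 + b * f + f ^+ 2) / l) (- (e * f)) f 0 0 0 (b + f) (- (e * l)) l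
     (e * (b + f)) (- (e ^+ 2 * l)) (e * l) 0 0 0 0 0 d0 d1 d2 d3)) (lc (nf6 al be s t)).
Proof.
move=> b0 l0.
(* Subtracting cp dx0 + cr dx2 removes the terms w x1 and w x3 from dy; the linear system for [cp]
   and [cr] has determinant b^2. [gp] and [gr] do the same for d eta. *)
pose cp := (d1 * l - d3 * f - d3 * b) / b ^+ 2.
pose cr := (d3 * f ^+ 2 / l - d1 * f + d3 * f * b / l + d3 * b ^+ 2 / l) / b ^+ 2.
pose gp := (- (d0 * f) - d2 * l - d0 * b) / b ^+ 2.
pose gr := (d0 * f ^+ 2 / l + d0 * f * b / l + d2 * f + d0 * b ^+ 2 / l) / b ^+ 2.
pose al := b ^+ 2 / l * d0; pose be := b * (d0 * f / l + d3 * e + d2).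
pose s := b / l * (- d3 - b * cp) - e * l / b ^+ 2 * al.
pose t := b / l * ((- d3 - b * cp) * f / b + (d0 * e + d1 - b * cr) * l / b) - e * l / b ^+ 2 * be.
exists al, be, s, t.
apply: (@lc_iso _ _ _ [:: [:: trm1 (1 : R) 1]; [:: trm1 (b ^+ 2 / l) 3];
   [:: trm1 (b * (b + f) / l) 3; trm1 b 5; trm1 (- (b * e)) 4];
   [:: trm1 1 2; trm1 (- (f / l)) 4]; [:: trm1 (b / l) 4];
   [:: trm1 (b ^+ 2 / l) 6; trm1 (- (b ^+ 2 / l * cp)) 2; trm1 (- (b ^+ 2 / l * cr)) 4];
   [:: trm1 (b / l) 7; trm1 (- (b / l * gp) + e * cp) 2; trm1 (- (b / l * gr) + e * cr) 4;
       trm1 (- e) 6]]) => //.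
  move=> [|[|[|[|[|[|[|i]]]]]]] x y // _ /=; try by field.
  - by rewrite /al /be /cp /cr; field; rewrite ?b0 ?l0.
  - by rewrite /s /t /al /be /cp /cr /gp /gr; field; rewrite ?b0 ?l0.
move=> x hx; kernel_eqs hx h1 h2 h3 h4 h5 h6 h7.
have n1 : b ^+ 2 / l != 0 by rewrite mulf_neq0 ?invr_eq0 ?expf_neq0.
have n2 : b / l != 0 by rewrite mulf_neq0 ?invr_eq0.
have x1 : x 1 = 0 by lra.
have x3 : x 3 = 0 by apply: (mulr_0l n1); lra.
have x4 : x 4 = 0 by apply: (mulr_0l n2); lra.
have x5 : x 5 = 0 by apply: (mulr_0l b0); rewrite x3 x4 in h3; lra.
have x2 : x 2 = 0 by rewrite x4 in h4; lra.
have x6 : x 6 = 0 by apply: (mulr_0l n1); rewrite x2 x4 in h6; lra.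
have x7 : x 7 = 0 by apply: (mulr_0l n2); rewrite x2 x4 x6 in h7; lra.
by move=> [|[|[|[|[|[|[|[|i]]]]]]]].
Qed.

End Eisenstein.

(** * Twisted solutions: nonzero eigenvalue *)

Section CaseA.
Variable R : rcfType.

(** Two rows annihilate every column of M, and the second of them differs from the second row of M
    by 2 b in its first entry. If their cross product has a nonzero first component, comparing the
    two annihilates the first row; the dependent cases are treated separately. *)
Lemma twisted_row0 (f1 f2 f3 m11 m12 m13 m21 m22 m23 m31 m32 m33 d0 d1 d2 d3 : R) :
  is_lie (lc (model f1 f2 f3 m11 m12 m13 m21 m22 m23 m31 m32 m33 0 0 0 0 0 d0 d1 d2 d3)) ->
  m11 + m22 + m33 = 0 -> m21 - m12 - f3 != 0 -> [/\ m11 = 0, m12 = 0 & m13 = 0].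
Proof.
move=> hl tr; have [b hb] : exists b, m21 - m12 - f3 = b by eexists.
rewrite hb => b0.
have fE : f3 = m21 - m12 - b by rewrite -hb; ring.
have [P1 [P2 [P3 [p12 [p13 [p23 [q01 [q02 [q03 [q12 [q13 q23]]]]]]]]]]] := model_jacobi_abelian hl.
have b20 : 2 * b != 0 by rewrite mulf_neq0 // pnatr_eq0.
have bK x : 2 * b * x = 0 -> x = 0 by exact: mulr_0l.
have r1 : (m21 - 2 * b) * m11 + m22 * m21 + m23 * m31 = 0.
  by apply: (eq_from_zero (w := -1) q01); rewrite fE; ring.
have r2 : (m21 - 2 * b) * m12 + m22 * m22 + m23 * m32 = 0.
  by apply: (eq_from_zero (w := -1) q02); rewrite fE; ring.
have r3 : (m21 - 2 * b) * m13 + m22 * m23 + m23 * m33 = 0.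
  by apply: (eq_from_zero (w := -1) q03); rewrite fE; ring.
(* The rows (m11, m12, m13) and (m21 - 2b, m22, m23) are killed by M, so its
   columns are multiples of their cross product. *)
pose n1 := m12 * m23 - m13 * m22; pose n2 := m13 * (m21 - 2 * b) - m11 * m23.
pose n3 := m11 * m22 - m12 * (m21 - 2 * b).
have c2 a1 a2 a3 : m11 * a1 + m12 * a2 + m13 * a3 = 0 ->
    (m21 - 2 * b) * a1 + m22 * a2 + m23 * a3 = 0 -> n1 * a2 = n2 * a1.
  move=> h h'; apply/eqP; rewrite -subr_eq0; apply/eqP.
  transitivity (m23 * (m11 * a1 + m12 * a2 + m13 * a3) - m13 * ((m21 - 2 * b) * a1 + m22 * a2 + m23 * a3)).
    by rewrite /n1 /n2; ring.
  by rewrite h h' !mulr0 subr0.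
rewrite expr2 in P1.
have c12 := c2 _ _ _ P1 r1; have c22 := c2 _ _ _ P2 r2; have c32 := c2 _ _ _ P3 r3; clear c2.
have [n10|n10] := eqVneq n1 0; last first.
  have K a1 a2 a3 : m11 * a1 + m12 * a2 + m13 * a3 = 0 ->
      (m21 - 2 * b) * a1 + m22 * a2 + m23 * a3 = 0 -> a1 = 0.
    move=> h h'; apply: bK; apply: (mulr_0l n10).
    transitivity (n1 * m21 * a1 + n1 * m22 * a2 + n1 * m23 * a3 -
      n1 * ((m21 - 2 * b) * a1 + m22 * a2 + m23 * a3)); first by ring.
    rewrite h' c12 c22 c32; transitivity (n2 * (m11 * a1 + m12 * a2 + m13 * a3)); first by ring.
    by rewrite h mulr0.
  by split; [apply: (K _ m21 m31) | apply: (K _ m22 m32) | apply: (K _ m23 m33)].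
have [m130|m130] := eqVneq m13 0.
  have [m120|m120] := eqVneq m12 0.
    split=> //; apply/eqP; rewrite -sqrf_eq0 expr2; apply/eqP.
    by rewrite -P1 m120 m130; ring.
  have e23 : m23 = 0 by apply: (mulr_0l m120); rewrite -[RHS]n10 /n1 m130; ring.
  have e22 : m11 + m22 = 0.
    by apply: (mulr_0l m120); rewrite -[RHS]P2 m130; ring.
  exfalso; have /eqP : 2 * b * m12 = 0.
    have m22E : m22 = - m11 by lra.
    have := P1; have := r2; rewrite e23 m130 m22E => k1 k2; nra.
  by rewrite mulf_eq0 (negPf b20) (negPf m120).
(* Here (m21 - 2 b, m22, m23) is k times the first row of M, so the other entries are determined by
   that row, and the last relation used reduces to 6 b^2 = 0. *)
exfalso; have [k e23] : exists k, m23 = k * m13 by exists (m23 / m13); rewrite divfK.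
have e22 : m22 = k * m12.
  by apply: (mulfI m130); apply: (eq_from_zero (w := -1) n10); rewrite /n1 e23; ring.
have n20 : n2 = 0.
  by apply: (mulfI m130); rewrite mulr0 mulrC -c32 n10 mul0r.
have e21 : m21 = 2 * b + k * m11.
  by apply: (mulfI m130); apply: (eq_from_zero (w := 1) n20); rewrite /n2 e23; ring.
have e31 : m13 * m31 = - (m11 * m11 + m12 * m21) by lra.
have e33 : m33 = - (m11 + m22) by lra.
have g2 : f2 * m13 = k * m11 * m12 + b * m12 - m12 ^+ 2.
  apply: (mulfI (_ : (2 : R) != 0)); first by rewrite pnatr_eq0.
  apply: (eq_from_zero (w := 1) p23); rewrite e31 e33 e22 fE e21; ring.
have g1 : f1 * m13 = k * m11 ^+ 2 + 3 * b * m11 - m11 * m12.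
  apply: (eq_from_zero (w := 1) p13); rewrite e33 e23 e22 fE.
  have -> : k * m13 * m31 = k * (m13 * m31) by ring.
  have -> : f2 * (k * m13) = k * (f2 * m13) by ring.
  by rewrite e31 g2 e21; ring.
have /eqP : 6 * b ^+ 2 = 0.
  apply: (eq_from_zero (w := 1) q13); rewrite e33 e23 e22 fE.
  have -> : - 2%:R * f1 * (k * m13) = - 2 * k * (f1 * m13) by ring.
  have q : m13 * m32 = - (m11 * m12 + m12 * m22) by lra.
  have -> : k * m13 * m32 = k * (m13 * m32) by ring.
  by rewrite q g1 e22 e21; ring.
by rewrite mulf_eq0 sqrf_eq0 (negPf b0) orbF pnatr_eq0.
Qed.

(** With the first row gone, m23 is nonzero, since otherwise f3^2 - f3 m21 + m21^2 = 0 and b = 0.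
    The other relations are then solved by dividing by m23, which gives the parameters of
    [twisted_nf6]. *)
Lemma twisted_class (f1 f2 f3 m11 m12 m13 m21 m22 m23 m31 m32 m33 d0 d1 d2 d3 : R) :
  is_lie (lc (model f1 f2 f3 m11 m12 m13 m21 m22 m23 m31 m32 m33 0 0 0 0 0 d0 d1 d2 d3)) ->
  m11 + m22 + m33 = 0 -> m21 - m12 - f3 != 0 ->
  exists n : 'I_12, lie_iso (lc (model f1 f2 f3 m11 m12 m13 m21 m22 m23 m31 m32 m33 0 0 0 0 0 d0 d1 d2 d3)) (L12 R n).
Proof.
move=> hl tr b0; have [e11 e12 e13] := twisted_row0 hl tr b0; subst m11 m12 m13.
have e33 : m33 = - m22 by lra.
subst m33; clear tr; rewrite subr0 in b0.
have [_ [_ [_ [_ [_ [_ [q01 [q02 [_ [_ [q13 q23]]]]]]]]]]] := model_jacobi_abelian hl.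
have {}q01 : m23 * m31 = - (m21 * m22) by lra.
have {}q02 : m23 * m32 = - m22 ^+ 2 by lra.
have {}q23 : f2 * m23 = f3 * m22 by lra.
have {}q13 : f1 * m23 = f3 ^+ 2 - f3 * m21 + m21 ^+ 2 by nra.
have [m230|m230] := eqVneq m23 0.
  have [e3 e21] : f3 = 0 /\ m21 = 0 by apply: eisenstein_eq0; rewrite -q13 m230 mulr0.
  by move: b0; rewrite e3 e21 subrr eqxx.
have [e he] : exists e, m22 = - (e * m23) by exists (- (m22 / m23)); rewrite mulNr divfK // opprK.
have e32 : m32 = - (e ^+ 2 * m23) by apply: (mulfI m230); rewrite q02 he; ring.
have e31 : m31 = e * m21 by apply: (mulfI m230); rewrite q01 he; ring.
have ef2 : f2 = - (e * f3) by apply: (mulIf m230); rewrite q23 he; ring.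
have [b hb b1] : exists2 b, m21 = b + f3 & b != 0 by exists (m21 - f3) => //; rewrite subrK.
have ef1 : f1 = (b ^+ 2 + b * f3 + f3 ^+ 2) / m23.
  by apply: (mulIf m230); rewrite divfK // q13 hb; ring.
have -> : - m22 = e * m23 by rewrite he opprK.
rewrite {hl} e32 e31 ef2 ef1 he hb.
have [al [be [s [t hi]]]] := twisted_nf6 f3 e d0 d1 d2 d3 b1 m230.
have [n hn] := nf6_class al be s t; exists n.
exact: lie_iso_trans hn.
Qed.

End CaseA.

(** * Eigenplanes *)

Section Eigenplanes.
Variable R : rcfType.

Definition no7 (d : seq (seq (R * nat * nat))) :=
  all (all (fun t : R * nat * nat => (t.1.2 != 7) && (t.2 != 7))%N) d.

Lemma no7_central d v : all (@wf2 R) d -> no7 d -> br (lc d) (ee R 7) v = 0.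
Proof.
move=> wd /all_nthP-/(_ [::]) h; apply: cfP => k hk; rewrite cf0 cf_br_lc //.
have : all (fun t : R * nat * nat => (t.1.2 != 7) && (t.2 != 7))%N (nth [::] d k.-1).
  by case: (ltnP k.-1 (size d)) => hs; [exact: h | rewrite nth_default].
have := wf2_nth k.-1 wd.
elim: (nth _ _ _) => [|[[a p] q] l IH] /=; first by rewrite oppr0.
move=> /andP[/andP[hp hq] wl] /andP[/andP[p7 q7] l7].
by rewrite !cf_ee // (negPf p7) (negPf q7) !mul0r subrr mulr0 add0r IH.
Qed.

(** X is e_7, central because it occurs in no differential. The bracket in the last hypothesis is -
    phi1(e_7, Y, v); its sign matches that of the Lie bracket in terms of differentials. *)
Lemma eigen_lc d (Y : nat -> R) (l : R) : all (@wf2 R) d -> no7 d ->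
  (exists2 k, (0 < k < 7)%N & Y k != 0) ->
  (forall k v, (k < 6)%N -> ev2 (nth [::] d k) Y v = 0) ->
  (forall v, ev2 (nth [::] d 6) Y v =
     l * (Y 6 * v 1 - Y 1 * v 6 + (Y 3 * v 2 - Y 2 * v 3) + (Y 5 * v 4 - Y 4 * v 5))) ->
  eigenplane (lc d).
Proof.
move=> wd n7 [k hk yk] h6 h7; exists (ee R 7), (vec Y), l; split.
- apply/eqP => e; have : cf (ee R 7) 7 = 0 by rewrite e cf0.
  by rewrite cf_ee //= => /eqP; rewrite oner_eq0.
- by move=> v; apply: no7_central.
- move=> [m e]; case/andP: hk => hk1 hk2.
  have hk8 : (0 < k < 8)%N by rewrite hk1 ltnS ltnW.
  have := congr1 (fun u => cf u k) e; rewrite cf_vec // cfZ cf_ee // (ltn_eqF hk2) mulr0.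
  by move/eqP; rewrite (negPf yk).
move=> v; have Yv p : wfi p -> cf (vec Y) p = Y p by move=> hp; rewrite cf_vec.
have E p : wfi p -> cf (br (lc d) (vec Y) v) p = - ev2 (nth [::] d p.-1) Y (cf v).
  by move=> hp; rewrite cf_br_lc //; congr (- _); apply: ev2_ext => //; apply: wf2_nth.
apply: cfP => p hp; rewrite E // cfZ cf_ee //.
have [p7|p7] := ltnP p 7.
  by rewrite h6 ?oppr0 ?(ltn_eqF p7) ?mulr0 //; case: (p) hp p7.
have -> : p = 7%N by apply/eqP; rewrite eqn_leq p7 -ltnS andbT; case/andP: hp.
by rewrite h7 /phi1 /ev3 !cf_ee //= !Yv //; ring.
Qed.

Lemma model_eigen6 (f1 f2 f3 m11 m12 m13 m21 m22 m23 m31 m32 m33 u2 n32 d0 d1 d2 d3 : R) :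
  eigenplane (lc (model f1 f2 f3 m11 m12 m13 m21 m22 m23 m31 m32 m33 u2 0 0 0 n32 d0 d1 d2 d3)).
Proof.
apply: (@eigen_lc _ (fun n => (n == 6)%:R) (m21 - m12 - f3)) => //.
- by exists 6%N => //=; rewrite oner_eq0.
- by move=> [|[|[|[|[|[|?]]]]]] v // _ /=; ring.
- by move=> v /=; ring.
Qed.

(** Y = g e_6 - e_2. The conditions on m22 and m23 cancel the dependence of [Y, v] on v4 and v5, the
    coefficient of v3 is the eigenvalue up to sign, and the coefficient of v1 fixes d3. *)
Lemma model_eigen26 (f1 f2 f3 m11 m12 m13 m21 m22 m23 m31 m32 m33 u2 u3 n22 n23 n32 d0 d1 d2 d3 g : R) :
  [/\ m11 = 0, m12 = 0, m13 = 0 & d0 = 0] -> [/\ m22 = g * n22, m23 = g * n23 &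
  d3 = g ^+ 2 * u3 + g * (m21 - 2 * f3)] ->
  eigenplane (lc (model f1 f2 f3 m11 m12 m13 m21 m22 m23 m31 m32 m33 u2 u3 n22 n23 n32 d0 d1 d2 d3)).
Proof.
move=> [-> -> -> ->] [-> -> ->].
apply: (@eigen_lc _ (fun n => if n is 6%N then g else if n is 2%N then -1 else 0) (f3 - g * u3)) => //.
- by exists 2%N => //=; rewrite oppr_eq0 oner_eq0.
- by move=> [|[|[|[|[|[|?]]]]]] v // _ /=; ring.
- by move=> v /=; ring.
Qed.

End Eigenplanes.

(** * Filiform reductions *)

Section CaseC.
Variable R : rcfType.

Lemma filiform_eigen_axis (f1 f2 f3 m11 m12 m13 m21 m22 m23 m31 m32 m33 u2 u3 n23 d0 d1 d2 d3 : R) :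
  is_lie (lc (model f1 f2 f3 m11 m12 m13 m21 m22 m23 m31 m32 m33 u2 u3 0 n23 0 d0 d1 d2 d3)) ->
  m11 + m22 + m33 = 0 -> n23 != 0 -> u2 != 0 ->
  eigenplane (lc (model f1 f2 f3 m11 m12 m13 m21 m22 m23 m31 m32 m33 u2 u3 0 n23 0 d0 d1 d2 d3)).
Proof.
move=> hl tr n0 u0.
have J := jac_at hl (model_wf f1 f2 f3 m11 m12 m13 m21 m22 m23 m31 m32 m33 u2 u3 0 n23 0 d0 d1 d2 d3).
have e12 : m12 = 0.
  by apply: (mulr_0l n0); apply: (eq_from_zero (w := -1) (J 2 1 3 5 isT)); rewrite /bf /ind /=; ring.
have e13 : m13 = 0.
  by apply: (mulr_0l u0); apply: (eq_from_zero (w := -1) (J 1 1 4 5 isT)); rewrite /bf /ind /= e12; ring.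
have e32 : m32 = 0.
  by apply: (mulr_0l n0); apply: (eq_from_zero (w := 1) (J 3 1 3 4 isT)); rewrite /bf /ind /=; ring.
have e22 : m22 = 0.
  have : m11 - m22 + m33 = 0.
    by apply: (mulr_0l n0); apply: (eq_from_zero (w := 1) (J 3 1 3 5 isT)); rewrite /bf /ind /=; ring.
  by lra.
have e11 : m11 = 0.
  apply/eqP; rewrite -sqrf_eq0; apply/eqP.
  by apply: (eq_from_zero (w := 1) (J 5 1 2 3 isT)); rewrite /bf /ind /= e12 e13; ring.
have e33 : m33 = 0 by lra.
subst m11 m12 m13 m22 m32 m33.
have [g hg] : exists g, m23 = g * n23 by exists (m23 / n23); rewrite divfK.
have e0 : d0 = 0.
  by apply: (mulr_0l n0); apply: (eq_from_zero (w := -1) (J 6 1 2 5 isT)); rewrite /bf /ind /=; ring.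
have ef2 : f2 = g * u2.
  by apply: (mulfI n0); apply: (eq_from_zero (w := -1) (J 1 1 3 5 isT)); rewrite /bf /ind /= hg; ring.
have e31 : m31 = 0.
  by apply: (mulr_0l n0); apply: (eq_from_zero (w := 1) (J 6 1 3 6 isT)); rewrite /bf /ind /=; ring.
have ed2 : d2 = - g ^+ 2 * u2.
  by apply: (mulfI n0); apply: (eq_from_zero (w := -1) (J 5 1 3 5 isT)); rewrite /bf /ind /= hg ef2 e31 e0; ring.
apply: (@model_eigen26 _ _ _ _ _ _ _ _ _ _ _ _ _ _ _ _ _ _ _ _ _ _ g); split=> //; first by rewrite mulr0.
by apply: (mulIf u0); apply: (eq_from_zero (w := 1) (J 6 1 3 4 isT)); rewrite /bf /ind /= hg ef2 e31 ed2 e0; ring.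
Qed.

(** On ker w all of dx2 and dx3 is a multiple of x1 (x2 + q x3), and t is the part of dx0 outside
    this line. The Jacobi identity then leads to the situation of [model_eigen26];
    [filiform_eigen_axis] is the missing direction x3. *)
Lemma filiform_eigen (f1 f2 f3 m11 m12 m13 m21 m22 m23 m31 m32 m33 u2 t q k d0 d1 d2 d3 : R) :
  let d := model f1 f2 f3 m11 m12 m13 m21 m22 m23 m31 m32 m33 u2 (t + q * u2) (- (k * q)) (- (k * q ^+ 2)) k d0 d1 d2 d3 in
  is_lie (lc d) -> m11 + m22 + m33 = 0 -> k != 0 -> t != 0 -> eigenplane (lc d).
Proof.
move=> d hl tr k0 t0; have J := jac_at hl (model_wf _ _ _ _ _ _ _ _ _ _ _ _ _ _ _ _ _ _ _ _ _).
have e13 : m13 = q * m12.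
  by apply: (mulfI k0); apply: (eq_from_zero (w := -1) (J 2 1 3 4 isT)); rewrite /bf /ind /=; ring.
have e12 : m12 = 0.
  by apply: (mulr_0l t0); apply: (eq_from_zero (w := 1) (J 1 1 4 5 isT)); rewrite /bf /ind /= e13; ring.
have {}e13 : m13 = 0 by rewrite e13 e12 mulr0.
subst m12 m13.
have e11 : m11 = 0.
  apply/eqP; rewrite -sqrf_eq0; apply/eqP.
  by apply: (eq_from_zero (w := 1) (J 5 1 2 3 isT)); rewrite /bf /ind /=; ring.
subst m11.
have e23 : m23 = - (q ^+ 2 * m32).
  by apply: (mulfI k0); apply: (eq_from_zero (w := -1) (J 3 1 3 4 isT)); rewrite /bf /ind /=; ring.
have e33 : m33 = q * m32.
  have : m22 + 2 * q * m32 - m33 = 0.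
    by apply: (mulr_0l k0); apply: (eq_from_zero (w := 1) (J 4 1 3 4 isT)); rewrite /bf /ind /=; ring.
  by lra.
have e22 : m22 = - (q * m32) by lra.
have [g hg] : exists g, m32 = g * k by exists (m32 / k); rewrite divfK.
have e21 : q * (m21 + q * m31) = 0.
  by apply: (mulr_0l k0); apply: (eq_from_zero (w := -1) (J 6 1 3 6 isT)); rewrite /bf /ind /=; ring.
have q0d : q * d0 = 0.
  apply: (mulr_0l k0); apply: (eq_from_zero (w := 1) (J 6 1 2 4 isT)); rewrite /bf /ind /= e22 e23; ring.
have e0 : d0 = 0.
  have [q0|q0] := eqVneq q 0; last exact: (mulr_0l q0).
  by apply: (mulr_0l t0); apply: (eq_from_zero (w := -1) (J 6 1 2 3 isT)); rewrite /bf /ind /= e22 e23 q0; ring.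
subst d0 m22 m23 m33 m32.
have ef3 : f3 = q * f2 + g * t.
  by apply: (mulfI k0); apply: (eq_from_zero (w := -1) (J 1 1 3 4 isT)); rewrite /bf /ind /=; ring.
have ed3 : d3 = q * d2 + g * (q * f2 - f3 + m21 + q * m31).
  by apply: (mulfI k0); apply: (eq_from_zero (w := -1) (J 5 1 3 4 isT)); rewrite /bf /ind /=; ring.
apply: (@model_eigen26 _ _ _ _ _ _ _ _ _ _ _ _ _ _ _ _ _ _ _ _ _ _ g); split=> //; try ring.
have [q0|q0] := eqVneq q 0; first by rewrite ed3 ef3 q0; ring.
have e21' : m21 = - (q * m31) by apply/eqP; rewrite -addr_eq0; apply/eqP/(mulr_0l q0).
apply: (mulfI t0).
have comb (a b : R) : a = 0 -> b = 0 -> q * a - b = 0 by move=> -> ->; rewrite mulr0 subr0.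
(* The combination eliminates f1. *)
have E := comb _ _ (J 6 1 3 4 isT) (J 6 1 3 5 isT).
by apply: (eq_from_zero (w := -1) E); rewrite /bf /ind /= ed3 ef3 e21'; ring.
Qed.

End CaseC.

(** * Heisenberg reductions *)

Section Heisenberg.
Variable R : rcfType.

(** The solutions of the Jacobi identity when ker w modulo X and Y is a Heisenberg algebra with dx0
    = u x1 (r x2 + x3). The parameters phi, mu, psi, chi are f3, m21, f1, m23 divided by u, while g
    and a measure how far f2 and m31 are from r f3 and - r m21. *)
Definition modelB (r u phi mu psi chi g a d1 : R) :=
  let d3 := u * (psi * chi + phi * mu - phi ^+ 2 - mu ^+ 2) in
  model (u * psi) (g + r * (u * phi)) (u * phi) 0 0 0
    (u * mu) (r * (u * chi)) (u * chi) (a - r * (u * mu)) (- (r ^+ 2 * (u * chi))) (- (r * (u * chi)))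
    (r * u) u 0 0 0 (- (chi * a)) d1 (mu * (g + 2 * a) - phi * (2 * g + a) + r * d3) d3.

Lemma heisenberg_modelB (f1 f2 f3 m11 m12 m13 m21 m22 m23 m31 m32 m33 u2 u d0 d1 d2 d3 : R) :
  let d := model f1 f2 f3 m11 m12 m13 m21 m22 m23 m31 m32 m33 u2 u 0 0 0 d0 d1 d2 d3 in
  is_lie (lc d) -> m11 + m22 + m33 = 0 -> u != 0 ->
  exists r phi mu psi chi g a, d = modelB r u phi mu psi chi g a d1 /\ chi * g = 0.
Proof.
move=> d hl tr u0; have J := jac_at hl (model_wf _ _ _ _ _ _ _ _ _ _ _ _ _ _ _ _ _ _ _ _ _).
have e12 : m12 = 0.
  by apply: (mulr_0l u0); apply: (eq_from_zero (w := 1) (J 6 1 4 6 isT)); rewrite /bf /ind /=; ring.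
have e13 : m13 = 0.
  by apply: (mulr_0l u0); apply: (eq_from_zero (w := 1) (J 6 1 5 6 isT)); rewrite /bf /ind /=; ring.
have e11 : m11 = 0.
  by apply: (mulr_0l u0); apply: (eq_from_zero (w := 1) (J 6 1 3 6 isT)); rewrite /bf /ind /=; ring.
subst m11 m12 m13.
have ex x : exists y, x = u * y by exists (x / u); rewrite mulrC divfK.
have [r er] := ex u2; have [phi ef3] := ex f3; have [mu emu] := ex m21; have [psi epsi] := ex f1.
have [chi echi] := ex m23.
have e33 : m33 = - m22 by lra.
have e22 : m22 = r * (u * chi).
  by apply: (mulfI u0); apply: (eq_from_zero (w := -1) (J 1 1 3 5 isT)); rewrite /bf /ind /= er e33 echi; ring.
have e32 : m32 = - (r ^+ 2 * (u * chi)).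
  by apply: (mulfI u0); apply: (eq_from_zero (w := 1) (J 1 1 3 4 isT)); rewrite /bf /ind /= er e22; ring.
have [g eg] : exists g, f2 = g + r * (u * phi) by exists (f2 - r * (u * phi)); rewrite subrK.
have [a ea] : exists a, m31 = a - r * (u * mu) by exists (m31 + r * (u * mu)); rewrite addrK.
exists r, phi, mu, psi, chi, g, a.
have e0 : d0 = - (chi * a).
  apply: (mulfI u0); apply: (eq_from_zero (w := -1) (J 6 1 2 3 isT)).
  by rewrite /bf /ind /= e33 e22 emu echi ea; ring.
have cg : chi * g = 0.
  apply: (mulr_0l u0); apply: (eq_from_zero (w := -1) (J 5 1 3 5 isT)).
  by rewrite /bf /ind /= e33 e22 emu echi ea e0 eg ef3; ring.
have e3 : d3 = u * (psi * chi + phi * mu - phi ^+ 2 - mu ^+ 2).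
  have u20 : 2 * u != 0 by rewrite mulf_neq0 // pnatr_eq0.
  apply: (mulfI u20); apply: (eq_from_zero (w := 1) (J 6 1 3 5 isT)).
  by rewrite /bf /ind /= e33 e32 e22 emu echi epsi ef3; ring.
have e2 : d2 = mu * (g + 2 * a) - phi * (2 * g + a) + r * d3.
  apply: (mulfI u0); apply: (eq_from_zero (w := 1) (J 6 1 3 4 isT)).
  by rewrite /bf /ind /= er e33 e32 e22 emu echi epsi ef3 ea eg e3; ring.
split=> //; rewrite /d /modelB e2 e3 e0 ea eg e33 e32 e22 emu echi epsi ef3 er.
by rewrite [u * r]mulrC.
Qed.

Lemma modelB_eigen0 (r u phi psi g a d1 : R) : u != 0 ->
  eigenplane (lc (modelB r u phi 0 psi 0 g a d1)).
Proof.
move=> u0.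
apply: (@eigen_lc _ _ (fun n => if n is 6%N then phi else if n is 2%N then -1 else 0) 0) => //.
- by exists 2%N => //=; rewrite oppr_eq0 oner_eq0.
- by move=> [|[|[|[|[|[|?]]]]]] v // _ /=; ring.
- by move=> v /=; ring.
Qed.

Lemma modelB_eigen1 (r u phi mu psi d1 : R) : u != 0 -> mu != 0 ->
  eigenplane (lc (modelB r u phi mu psi 0 0 0 d1)).
Proof.
move=> u0 m0; have n3 : (3 : R) != 0 by rewrite pnatr_eq0.
(* p, q solve p (2 mu - phi) u + q d3 = d1, p + q (phi + mu) = psi *)
pose d3 := u * (phi * mu - phi ^+ 2 - mu ^+ 2).
pose p := (d1 * (phi + mu) - psi * d3) / (3 * u * mu ^+ 2).
pose q := ((2 * mu - phi) * u * psi - d1) / (3 * u * mu ^+ 2).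
apply: (@eigen_lc _ _ (fun n => if n is 6%N then p else if n is 2%N then q else
   if n is 4%N then 1 else if n is 5%N then - r else 0) (- (u * mu))) => //.
- by exists 4%N => //=; rewrite oner_eq0.
- by move=> [|[|[|[|[|[|?]]]]]] v // _ /=; ring.
- by move=> v /=; rewrite /p /q /d3; field; rewrite u0 m0.
Qed.

(** Supplies the eigenvalue in [modelB_eigen2]: the polynomial changes sign between - b and b
    because b^3 >= b >= |c|. *)
Lemma cube_root (c : R) : exists x : R, x ^+ 3 = c.
Proof.
pose p : {poly R} := 'X^3 - c%:P; pose b := 1 + `|c|.
have b1 : 1 <= b by rewrite lerDl.
have b3 : b <= b ^+ 3 by rewrite -[leLHS]mulr1 exprS ler_wpM2l ?(le_trans ler01) // exprn_ege1.
have cb : `|c| <= b by rewrite lerDr.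
have [x _ /rootP] : exists2 x, -b <= x <= b & root p x.
  apply: poly_ivt; first by lra.
  rewrite /p !hornerE; apply/andP; split.
    have := ler_norm (- c); rewrite normrN => h.
    by rewrite (_ : (- b) ^+ 3 = - b ^+ 3); [lra | ring].
  by have := ler_norm c; lra.
by rewrite /p !hornerE => /eqP; rewrite subr_eq0 => /eqP; exists x.
Qed.

Lemma modelB_eigen2 (r u phi mu psi chi d1 : R) : u != 0 -> chi != 0 ->
  eigenplane (lc (modelB r u phi mu psi chi 0 0 d1)).
Proof.
move=> u0 c0.
(* Y = e_4 - r e_5 + p e_6 + q e_2 is determined by l, which has to solve a
   cubic equation l ^ 3 = const. *)
pose b := mu - phi; pose D := psi * chi + phi * mu - phi ^+ 2 - mu ^+ 2.
have [x hx] := cube_root ((mu * D - d1 / u * chi) + b * (psi * chi - mu * phi)).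
pose l := u * x; pose q := (mu + x) / chi; pose p := psi + q * (x - phi).
apply: (@eigen_lc _ _ (fun n => if n is 6%N then p else if n is 2%N then q else
   if n is 4%N then 1 else if n is 5%N then - r else 0) l) => //.
- by exists 4%N => //=; rewrite oner_eq0.
- by move=> [|[|[|[|[|[|?]]]]]] v // _ /=; ring.
- move=> v /=; apply: (eq_from_zero (w := - (v 1 / chi * u)) (e := x ^+ 3 - ((mu * D - d1 / u * chi) + b * (psi * chi - mu * phi)))).
    by rewrite hx subrr.
  by rewrite /p /q /l /b /D; field; rewrite ?u0 ?c0.
Qed.

End Heisenberg.

(** * The pencil of 2-forms *)

Section Pencil.
Variable R : rcfType.

Definition nf5 (al be : R) : seq (seq (R * nat * nat)) :=
  [:: [::]; [::]; [:: trm 1 1 2]; [::];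
      [:: trm 1 1 4; trm al 1 3; trm be 2 3]; [:: trm 1 2 4; trm (al + be) 1 3; trm (- al) 2 3];
      [:: trm 1 1 5; trm (- 1) 2 5; trm 1 2 6; trm 1 3 4]].

(** Rescaling the coframe preserves s t / q^2, which the hypothesis fixes to - 3, the coefficient in
    the target. *)
Lemma nf5_eigen_tgt (q s t : R) : q != 0 -> s != 0 -> s * t + 3 * q ^+ 2 = 0 ->
  lie_iso (lc [:: [::]; [::]; [:: trm 1 1 2]; [::]; [:: trm 1 1 3]; [:: trm 1 2 4; trm 1 2 3];
    [:: trm q 1 6; trm q 2 5; trm q 3 4; trm s 1 5; trm t 2 6]]) (lc (tgt R 4)).
Proof.
move=> q0 s0 hst; have st : t = - 3 * q ^+ 2 / s.
  apply: (mulfI s0); rewrite mulrCA divff // mulr1.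
  by apply: (eq_from_zero (w := 1) hst); ring.
pose b := q / s; have b0 : b != 0 by rewrite mulf_neq0 ?invr_eq0.
have l0 : q / s ^+ 2 != 0 by rewrite mulf_neq0 ?invr_eq0 ?expf_neq0.
apply: (@lc_iso _ _ _ [:: [:: trm1 1 1]; [:: trm1 b 2]; [:: trm1 b 3]; [:: trm1 b 4]; [:: trm1 b 5];
   [:: trm1 (b ^+ 2) 6]; [:: trm1 (q / s ^+ 2) 7]]) => //.
  by move=> [|[|[|[|[|[|[|i]]]]]]] x y // _ /=; rewrite ?st /b; field.
move=> x hx; kernel_eqs hx h1 h2 h3 h4 h5 h6 h7.
have b20 : b ^+ 2 != 0 by rewrite expf_neq0.
have K (c y : R) : c != 0 -> c * y + 0 = 0 -> y = 0 by move=> c0; rewrite addr0; exact: mulr_0l.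
move=> [|[|[|[|[|[|[|[|i]]]]]]]] //= _;
  by [move: h1; rewrite mul1r addr0 | exact: K h2 | exact: K h3 | exact: K h4 | exact: K h5
     | exact: K h6 | exact: K h7].
Qed.

(* In the basis (e^1, e^2), (e^5, e^6) the structure equations involve the
   traceless matrix K = [al, be; al + be, - al] with K^2 = rho^2; its
   eigenvectors split the pencil. *)
Lemma nf5_tgt (al be : R) : al ^+ 2 + al * be + be ^+ 2 != 0 -> lie_iso (lc (nf5 al be)) (lc (tgt R 4)).
Proof.
move=> S0; have Sp : 0 <= al ^+ 2 + al * be + be ^+ 2.
  by have := sqr_ge0 (al + be / 2); have := sqr_ge0 be; nra.
(* The sign of the square root is chosen so that rho + al is nonzero; both signs can fail only if
   the root is zero. *)
have [rho hr r0] : exists2 rho, rho ^+ 2 - (al ^+ 2 + al * be + be ^+ 2) = 0 & rho + al != 0.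
  have h := sqr_sqrtr Sp; set s := Num.sqrt _ in h.
  have [e|e] := eqVneq (s + al) 0; last by exists s => //; rewrite h subrr.
  exists (- s); first by rewrite sqrrN h subrr.
  apply/eqP => e'; have s0 : s = 0 by lra.
  by move: S0; rewrite -h s0 expr0n eqxx.
have rho0 : rho != 0.
  by apply/eqP => e; move/eqP: S0; apply; move: hr; rewrite e; lra.
pose q := rho * (rho + al).
pose s := (rho + al) ^+ 2 - (rho + al) * (al + be) + (al + be) ^+ 2.
pose t := - ((rho + al) ^+ 2 + (rho + al) * be + be ^+ 2).
have q0 : q != 0 by rewrite mulf_neq0.
have s0 : s != 0.
  by apply/eqP => hs; have [e' _] := eisenstein_eq0 hs; move: r0; rewrite e' eqxx.
apply: lie_iso_trans (nf5_eigen_tgt (q := q) (s := s) (t := t) q0 s0 _); last first.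
  apply: (eq_from_zero hr (w := 3 * rho * al + 2 * rho ^+ 2 + al * be + al ^+ 2 + be ^+ 2)).
  by rewrite /s /t /q; ring.
pose e := rho + al.
(* (e, be) and (al + be, - e) are row eigenvectors of K for rho and - rho; the same pairs serve for
   e^5, e^6. *)
apply: (@lc_iso _ _ _ [:: [:: trm1 e 1; trm1 be 2]; [:: trm1 (al + be) 1; trm1 (- e) 2];
  [:: trm1 (- 2 * e) 4; trm1 (- 2 * e * rho) 3]; [:: trm1 (4 * e) 4];
  [:: trm1 (- 2 * e * e) 5; trm1 (- 2 * e * be) 6]; [:: trm1 (2 * e * (al + be)) 5; trm1 (- 2 * e * e) 6];
  [:: trm1 (- 8 * rho ^+ 2 * e ^+ 3) 7]]) => //.
  move=> [|[|[|[|[|[|[|i]]]]]]] x y // _ /=; try ring.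
  - by apply: (eq_from_zero hr (w := x 1 * y 2 - x 2 * y 1)); rewrite /e; ring.
  - by apply: (eq_from_zero hr (w := (- 2 * e) * (x 1 * y 3 - x 3 * y 1))); rewrite /e; ring.
  - by apply: (eq_from_zero hr (w := (2 * e) * (x 2 * y 3 - x 3 * y 2))); rewrite /e; ring.
  (* [rho] is known only through its square, and the long polynomial is the cofactor of that
     relation. *)
  - apply: (eq_from_zero hr (w :=
      (- 6 * rho * al ^+ 2 - 6 * rho ^+ 2 * al - 2 * rho ^+ 3 - 2 * al ^+ 3) * (x 1 * y 6 - x 6 * y 1) +
      (- 10 * rho * al ^+ 2 - 14 * rho ^+ 2 * al - 6 * rho ^+ 3 - 2 * al ^+ 3) * (x 2 * y 5 - x 5 * y 2) +
      (6 * rho * al * be + 14 * rho * al ^+ 2 + 2 * rho * be ^+ 2 + 16 * rho ^+ 2 * al + 2 * rho ^+ 2 * be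
        + 6 * rho ^+ 3 + 2 * al * be ^+ 2 + 4 * al ^+ 2 * be + 4 * al ^+ 3) * (x 1 * y 5 - x 5 * y 1) +
      (- 2 * rho * al * be + 10 * rho * al ^+ 2 + 2 * rho * be ^+ 2 + 14 * rho ^+ 2 * al - 2 * rho ^+ 2 * be
        + 6 * rho ^+ 3 + 2 * al * be ^+ 2 + 2 * al ^+ 3) * (x 2 * y 6 - x 6 * y 2))).
    by rewrite /q /s /t /e; ring.
move=> x hx; kernel_eqs hx h1 h2 h3 h4 h5 h6 h7.
have e0 : e != 0 by [].
have det : e * - e - be * (al + be) != 0.
  have -> : e * - e - be * (al + be) = - 2 * (rho * e).
    by apply: (eq_from_zero hr (w := 1)); rewrite /e; ring.
  by rewrite mulf_neq0 ?mulf_neq0 // oppr_eq0 pnatr_eq0.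
have e20 : - 2 * e != 0 by rewrite mulf_neq0 // oppr_eq0 pnatr_eq0.
have [x1 x2] : x 1 = 0 /\ x 2 = 0 by apply: (lin2 det); [from_eq h1 | from_eq h2].
have [x5 x6] : x 5 = 0 /\ x 6 = 0.
  apply: (@lin2 _ e be (al + be) (- e)) => //; apply: (mulr_0l e20); first by rewrite -[RHS]h5; ring.
  by rewrite -[RHS]oppr0 -[in RHS]h6; ring.
have x4 : x 4 = 0 by apply: (mulr_0l e0); lra.
have x3 : x 3 = 0.
  have er : e * rho != 0 by rewrite mulf_neq0.
  by apply: (mulr_0l er); rewrite x4 in h3; lra.
have x7 : x 7 = 0.
  have c0 : rho ^+ 2 * e ^+ 3 != 0 by rewrite mulf_neq0 ?expf_neq0.
  by apply: (mulr_0l c0); lra.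
by move=> [|[|[|[|[|[|[|[|i]]]]]]]].
Qed.

Lemma modelB_nf5 (r u phi mu psi g a d1 : R) : u != 0 -> mu != 0 ->
  lie_iso (lc (modelB r u phi mu psi 0 g a d1)) (lc (nf5 (- (a * mu)) (mu * (g + a)))).
Proof.
move=> u0 m0.
pose f3 := u * phi; pose m := u * mu; pose b := m - f3; pose f1 := u * psi.
pose d3 := u * (phi * mu - phi ^+ 2 - mu ^+ 2).
pose D2 := mu * (g + 2 * a) - phi * (2 * g + a).
(* The w x1 coefficients of the fifth and sixth equations force [al] and [be]. The components [c]
   and [c'] of the fourth form along w and x1 then come from the seventh; their linear system has
   determinant 3 m^2. *)
pose A := d3 * f1 - f3 * d1; pose B := b * f1 - u * d1.
pose c := ((2 * m - f3) * A - d3 * B) / (3 * m ^+ 3).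
pose c' := ((m + f3) * B - u * A) / (3 * m ^+ 3).
pose al := - (f1 - f3 * c' + u * c) / m; pose be := - (d1 - d3 * c' + b * c) / m.
apply: (@lc_iso _ _ _ [:: [:: trm1 1 1]; [:: trm1 mu^-1 3; trm1 (phi / mu) 1]; [:: trm1 (u * mu ^+ 2)^-1 4];
  [:: trm1 r 4; trm1 1 5; trm1 (- (a / (u * mu))) 4; trm1 c 1; trm1 c' 3];
  [:: trm1 ((mu - phi) / (u * mu ^+ 2)) 2; trm1 (- (u * mu ^+ 2)^-1) 6;
      trm1 (((mu - phi) * al - be) / (u * mu ^+ 2)) 4];
  [:: trm1 (u * mu)^-1 2; trm1 (al / (u * mu)) 4];
  [:: trm1 (u ^+ 2 * mu ^+ 3)^-1 7; trm1 (- (r * u - D2 - r * d3) / (u ^+ 2 * mu ^+ 3 * (u * mu))) 4]]) => //.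
  move=> [|[|[|[|[|[|[|i]]]]]]] x y // _ /=.
  - by ring.
  - by ring.
  - by field; rewrite u0 m0.
  - by field; rewrite u0 m0.
  - by rewrite /al /be /c /c' /A /B /D2 /d3 /f1 /b /m /f3; field; rewrite u0 m0.
  - by rewrite /al /be /c /c' /A /B /D2 /d3 /f1 /b /m /f3; field; rewrite u0 m0.
  - by rewrite /al /be /c /c' /A /B /D2 /d3 /f1 /b /m /f3; field; rewrite u0 m0.
move=> x hx; kernel_eqs hx h1 h2 h3 h4 h5 h6 h7.
have v1 : mu^-1 != 0 by rewrite invr_eq0.
have v2 : (u * mu ^+ 2)^-1 != 0 by rewrite invr_eq0 mulf_neq0 ?expf_neq0.
have v3 : (u * mu)^-1 != 0 by rewrite invr_eq0 mulf_neq0.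
have v4 : (u ^+ 2 * mu ^+ 3)^-1 != 0 by rewrite invr_eq0 mulf_neq0 ?expf_neq0.
have x1 : x 1 = 0 by lra.
have x3 : x 3 = 0 by apply: (mulr_0l v1); rewrite x1 in h2; lra.
have x4 : x 4 = 0 by apply: (mulr_0l v2); lra.
have x5 : x 5 = 0 by rewrite x1 x3 x4 in h4; lra.
have x2 : x 2 = 0 by apply: (mulr_0l v3); rewrite x4 in h6; lra.
have x6 : x 6 = 0 by apply: (mulr_0l v2); rewrite x2 x4 in h5; lra.
have x7 : x 7 = 0 by apply: (mulr_0l v4); rewrite x4 in h7; lra.
by move=> [|[|[|[|[|[|[|[|i]]]]]]]].
Qed.

End Pencil.

(** * The five-step family *)

Section FiveStep.
Variable R : rcfType.

Definition nf11 (v : R) : seq (seq (R * nat * nat)) :=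
  [:: [::]; [::]; [:: trm 1 1 2]; [:: trm 1 1 3]; [:: trm 1 2 3];
      [:: trm 1 1 5; trm 1 2 4]; [:: trm 1 1 6; trm v 2 5; trm 1 3 4]].

Lemma nf11_tgt10 : lie_iso (lc (nf11 0)) (lc (tgt R 10)).
Proof.
iso_forms [:: [:: trm1 (1 : R) 1]; [:: trm1 1 2]; [:: trm1 1 3]; [:: trm1 1 4]; [:: trm1 1 5]; [:: trm1 1 6]; [:: trm1 1 7]].
move=> x hx; kernel_eqs hx h1 h2 h3 h4 h5 h6 h7.
by move=> [|[|[|[|[|[|[|[|i]]]]]]]] //= _; lra.
Qed.

Lemma nf11_tgt11 v : v != 0 -> lie_iso (lc (nf11 v)) (lc (tgt R 11)).
Proof.
move=> v0.
iso_forms [:: [:: trm1 1 1]; [:: trm1 v 2]; [:: trm1 v 3]; [:: trm1 v 4]; [:: trm1 (v ^+ 2) 5];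
  [:: trm1 (v ^+ 2) 6]; [:: trm1 (v ^+ 2) 7]].
move=> x hx; kernel_eqs hx h1 h2 h3 h4 h5 h6 h7.
have v20 : v ^+ 2 != 0 by rewrite expf_neq0.
have K (c y : R) : c != 0 -> c * y + 0 = 0 -> y = 0 by move=> c0; rewrite addr0; exact: mulr_0l.
move=> [|[|[|[|[|[|[|[|i]]]]]]]] //= _;
  by [move: h1; rewrite mul1r addr0 | exact: K h2 | exact: K h3 | exact: K h4 | exact: K h5
     | exact: K h6 | exact: K h7].
Qed.

(** What the change of coframe in [modelB_nf11] leaves of the term 25; only its vanishing matters,
    because a nonzero value can be scaled to 1. *)
Definition nf11_v (r u phi mu psi chi a d1 : R) : R := let be := phi - mu in
  (u * (3 * be * phi ^+ 2 - 2 * be * chi * psi - 3 * be ^+ 2 * phi + be ^+ 3 + chi * phi * psi - phi ^+ 3)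
   - a * chi ^+ 2 * r - chi * d1) / (a * chi * u).

Lemma modelB_nf11 (r u phi mu psi chi a d1 : R) : u != 0 -> chi != 0 -> a != 0 ->
  lie_iso (lc (modelB r u phi mu psi chi 0 a d1)) (lc (nf11 (nf11_v r u phi mu psi chi a d1))).
Proof.
move=> u0 c0 a0; pose be := phi - mu.
pose f1 := u * psi; pose h := u * chi; pose m := u * mu.
(* [aij] is the coefficient of the j-th given form in the i-th new one. The last form is eta minus
   s, c3, c4, c5 times the new forms 6, 3, 4, 5, divided by k; likewise [y4], [y5] and [ka] for the
   sixth. *)
pose a34 := - (r / a); pose a35 := - a^-1.
pose a54 := - (1 + m * a34) / (a * h); pose a55 := - (m * a35) / (a * h).
pose a42 := - (a * u)^-1.
pose a44 := - (f1 * a34 + a * m * a54) / (a * u); pose a45 := - (f1 * a35 + a * m * a55) / (a * u).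
pose ka := a ^+ 2 * h; pose y4 := a * phi * u; pose y5 := a * be * m.
pose a62 := - (y4 * a42) / ka.
pose a64 := - (- d1 * a34 + y4 * a44 + y5 * a54) / ka.
pose a65 := - (- d1 * a35 + y4 * a45 + y5 * a55) / ka.
pose k := a ^+ 2 * chi * u ^+ 2.
pose s := a * u ^+ 2 * (2 * be * phi - be ^+ 2 + chi * psi - phi ^+ 2).
pose c3 := be * phi * r * u - be ^+ 2 * r * u + chi * psi * r * u - phi ^+ 2 * r * u - 2 * a * be + a * phi - r * u.
pose c4 := a * chi * r * u - be * psi * u ^+ 2 - u * d1.
pose c5 := - (a * chi * phi * r * u) + be * phi * psi * u ^+ 2 + chi * psi ^+ 2 * u ^+ 2 - phi ^+ 2 * psi * u ^+ 2
  + a ^+ 2 * chi + be * d1 * u - d1 * phi * u.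
have D : a * h != 0 /\ ka != 0 /\ k != 0.
  by rewrite /ka /k /h !mulf_neq0 ?expf_neq0.
apply: (@lc_iso _ _ _ [:: [:: trm1 1 3; trm1 be 1]; [:: trm1 1 1]; [:: trm1 a34 4; trm1 a35 5];
  [:: trm1 a42 2; trm1 a44 4; trm1 a45 5]; [:: trm1 a54 4; trm1 a55 5];
  [:: trm1 ka^-1 6; trm1 a62 2; trm1 a64 4; trm1 a65 5];
  [:: trm1 k^-1 7; trm1 (- (s / ka / k)) 6; trm1 (- (s * a62 + c4 * a42) / k) 2;
      trm1 (- (s * a64 + c3 * a34 + c4 * a44 + c5 * a54) / k) 4;
      trm1 (- (s * a65 + c3 * a35 + c4 * a45 + c5 * a55) / k) 5]]) => //.
  move=> [|[|[|[|[|[|[|i]]]]]]] x y // _ /=.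
  - by ring.
  - by ring.
  - by rewrite /a34 /a35; field.
  - by rewrite /a42 /a44 /a45 /a54 /a55 /a34 /a35 /f1 /m /h /be; field; rewrite u0 c0 a0.
  - by rewrite /a54 /a55 /a34 /a35 /m /h /be; field; rewrite u0 c0 a0.
  - by rewrite /a62 /a64 /a65 /y4 /y5 /ka /a42 /a44 /a45 /a54 /a55 /a34 /a35 /f1 /m /h /be; field; rewrite u0 c0 a0.
  - rewrite /nf11_v /s /c3 /c4 /c5 /a62 /a64 /a65 /y4 /y5 /ka /k /a42 /a44 /a45 /a54 /a55 /a34 /a35 /f1 /m /h /be.
    by field; rewrite u0 c0 a0.
move=> x hx; kernel_eqs hx h1 h2 h3 h4 h5 h6 h7.
have [ah0 [ka0 k0]] := D.
have x1 : x 1 = 0 by lra.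
have x3 : x 3 = 0 by rewrite x1 in h1; lra.
have det : a34 * a55 - a35 * a54 != 0.
  have -> : a34 * a55 - a35 * a54 = - (a * (a * h))^-1.
    by rewrite /a54 /a55 /a34 /a35 /h; field; rewrite u0 c0 a0.
  by rewrite oppr_eq0 invr_eq0 mulf_neq0.
have [x4 x5] : x 4 = 0 /\ x 5 = 0 by apply: (lin2 det); [from_eq h3 | from_eq h5].
have n42 : a42 != 0 by rewrite /a42 oppr_eq0 invr_eq0 mulf_neq0.
have x2 : x 2 = 0 by apply: (mulr_0l n42); rewrite x4 x5 in h4; lra.
have x6 : x 6 = 0.
  by apply: (mulr_0l (_ : ka^-1 != 0)); [rewrite invr_eq0 | rewrite x2 x4 x5 in h6; lra].
have x7 : x 7 = 0.
  by apply: (mulr_0l (_ : k^-1 != 0)); [rewrite invr_eq0 | rewrite x2 x4 x5 x6 in h7; lra].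
by move=> [|[|[|[|[|[|[|[|i]]]]]]]].
Qed.

End FiveStep.

(** * Classification *)

Section Classification.
Variable R : rcfType.

(** The degenerate choices chi = mu = 0, chi = g = a = 0 and g = a = 0 have an eigenplane. What is
    left is the pencil for chi = 0 and the five-step family otherwise. *)
Lemma modelB_class (r u phi mu psi chi g a d1 : R) : u != 0 -> chi * g = 0 ->
  ~ eigenplane (lc (modelB r u phi mu psi chi g a d1)) ->
  exists n : 'I_12, lie_iso (lc (modelB r u phi mu psi chi g a d1)) (L12 R n).
Proof.
move=> u0 cg ne; have [c0|c0] := eqVneq chi 0.
  subst chi; have [m0|m0] := eqVneq mu 0.
    by case: ne; rewrite m0; apply: modelB_eigen0.
  have [S0|S0] := eqVneq ((- (a * mu)) ^+ 2 + - (a * mu) * (mu * (g + a)) + (mu * (g + a)) ^+ 2) 0.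
    have [e1 e2] : a * mu = 0 /\ mu * (g + a) = 0 by apply: eisenstein_eq0; rewrite -[RHS]S0; ring.
    have a0 : a = 0 by apply: (mulr_0l m0); rewrite mulrC.
    have g0 : g = 0 by apply: (mulr_0l m0); rewrite -[RHS]e2 a0; ring.
    by case: ne; rewrite a0 g0; apply: modelB_eigen1.
  exact: (iso_tgt (n := 4)) (lie_iso_trans (modelB_nf5 r phi psi g a d1 u0 m0) (nf5_tgt S0)).
have g0 := mulr_0l c0 cg; subst g.
have [a0|a0] := eqVneq a 0; first by case: ne; rewrite a0; apply: modelB_eigen2.
have i := modelB_nf11 r phi mu psi d1 u0 c0 a0.
have [v0|v0] := eqVneq (nf11_v r u phi mu psi chi a d1) 0.
  by rewrite v0 in i; exact: (iso_tgt (n := 10)) (lie_iso_trans i (nf11_tgt10 R)).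
exact: (iso_tgt (n := 11)) (lie_iso_trans i (nf11_tgt11 v0)).
Qed.

(** With an eigenplane in the frame the reduction is abelian or a Heisenberg algebra with u2
    nonzero, and both cases are solved. Without one, every reduction except the Heisenberg algebra
    with u3 nonzero is contradictory. *)
Theorem calibrated_class (c : sconst R) : is_lie c -> lie_nilpotent c -> calibrated_G2 c ->
  exists n : 'I_12, lie_iso c (L12 R n).
Proof.
move=> hl0 hn0 hc0.
have [f1 [f2 [f3 [m11 [m12 [m13 [m21 [m22 [m23 [m31 [m32 [m33 [u2 [u3 [n22 [n23 [n32 [d0 [d1 [d2 [d3 [icd hl tr he hd]]]]]]]]]]]]]]]]]]]]]] := calibrated_model hl0 hn0 hc0.
suff [n hn] : exists n : 'I_12, lie_iso (lc (model f1 f2 f3 m11 m12 m13 m21 m22 m23 m31 m32 m33 u2 u3 n22 n23 n32 d0 d1 d2 d3)) (L12 R n).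
  by exists n; apply: lie_iso_trans icd hn.
clear c icd hl0 hn0 hc0.
case: he => [[z1 z2 z3]|ne].
  subst u3 n22 n23; case: hd => [[[z1 _ _ _ z2] top]|der].
    subst u2 n32; have [b0|b0] := eqVneq (m21 - m12 - f3) 0; last exact: twisted_class.
    have [e3 [e11 [e12 e13]] [e21 [e22 e23]] e33] := abelian_untwisted hl tr top b0.
    by subst; apply: (untwisted_class (n := 0)); left.
  have [z|n0] := eqVneq n32 0; last first.
    (* [der] is given a functional x0 + a4 x2 + a5 x3 that vanishes on the brackets of ker w. *)
    by exfalso; apply: (der 0 (- u2 / n32)); rewrite ?mulNr ?divfK //; ring.
  have [z'|u0] := eqVneq u2 0.
    by exfalso; apply: (der 0 0); rewrite ?z'; ring.
  subst n32; have [e3 [e11 [e12 e13]] [e21 [e22 e23]] e33 [e0 ed3]] := heisenberg_untwisted hl tr u0.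
  by subst; apply: untwisted_class; right.
case: hd => [[[z1 z2 z3 z4 z5] _]|der].
  by case: ne; subst; apply: model_eigen6.
(* The matrix (n22, n23; n32, - n22) of the action of e_3 on the plane of e_4 and e_5 has square
   zero. *)
have q0 : n22 ^+ 2 + n23 * n32 = 0.
  have J := jac_at hl (model_wf _ _ _ _ _ _ _ _ _ _ _ _ _ _ _ _ _ _ _ _ _).
  by apply: (eq_from_zero (w := 1) (J 6 3 4 6 isT)); rewrite /bf /ind /=; ring.
have [z|n0] := eqVneq n32 0; last first.
  have [q eq22] : exists q, n22 = - (n32 * q).
    by exists (- (n22 / n32)); rewrite mulrN opprK mulrC divfK.
  have e23 : n23 = - (n32 * q ^+ 2).
    by apply: (mulIf n0); apply: (eq_from_zero (w := 1) q0); rewrite eq22; ring.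
  have [t e3] : exists t, u3 = t + q * u2 by exists (u3 - q * u2); rewrite subrK.
  subst n22 n23 u3; have [t0|t0] := eqVneq t 0; last by case: ne; apply: filiform_eigen.
  by exfalso; apply: (der 0 (- u2 / n32)); rewrite ?t0; field.
subst n32; have z : n22 = 0 by apply/eqP; rewrite -sqrf_eq0 -[X in _ == X]q0 mulr0 addr0.
subst n22; have [z|n0] := eqVneq n23 0; last first.
  have [z'|u0] := eqVneq u2 0; last by case: ne; apply: filiform_eigen_axis.
  by exfalso; apply: (der (- u3 / n23) 0); rewrite ?z'; field.
subst n23; have [z|u0] := eqVneq u3 0; first by case: ne; rewrite z; apply: model_eigen6.
have [r [phi [mu [psi [chi [g [a [E cg]]]]]]]] := heisenberg_modelB hl tr u0.
by rewrite E in ne *; apply: modelB_class.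
Qed.

End Classification.

(** * Existence of calibrated structures *)

Section Examples.
Variable R : rcfType.

Lemma tgt_is_lie n : (n < 12)%N -> is_lie (lc (tgt R n)).
Proof.
move=> hn; apply: lc_is_lie; first exact: tgt_wf.
by move: n hn => [|[|[|[|[|[|[|[|[|[|[|[|n]]]]]]]]]]]] // _ [|[|[|[|[|[|[|k]]]]]]] x y z // _;
  rewrite /bf /=; ring.
Qed.

Definition triangular (d : seq (seq (R * nat * nat))) := forall k, (k < 7)%N ->
  all (fun t : R * nat * nat => (t.1.2 <= k)%N && (t.2 <= k)%N) (nth [::] d k).

(** d e^(k+1) involves only e^1, ..., e^k, so m nested brackets have their first m coordinates equal
    to zero. *)
Lemma triangular_nilpotent d : all (@wf2 R) d -> triangular d -> lie_nilpotent (lc d).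
Proof.
move=> wd tri; exists 7%N => xs y sz; apply: cfP => n /andP[n0 n8]; rewrite cf0.
have K m us : size us = m -> forall n, (0 < n < 8)%N -> (n <= m)%N -> cf (foldr (br (lc d)) y us) n = 0.
  elim: us m => [|x us IH] [|m] // => [_ k /andP[k0 _]|[su] k hk km]; first by rewrite leqNgt k0.
  have /andP[k0 k8] := hk; rewrite /= cf_br_lc //.
  have := wf2_nth k.-1 wd; have : all (fun t : R * nat * nat => (t.1.2 <= k.-1)%N && (t.2 <= k.-1)%N) (nth [::] d k.-1).
    by apply: tri; rewrite -ltnS prednK.
  elim: (nth _ _ _) => [|t l IHl] /=; first by rewrite oppr0.
  move=> /andP[/andP[t1 t2] tl] /andP[/andP[w1 w2] wl].
  have lt p : (p <= k.-1)%N -> (p <= m)%N by move=> h; apply: leq_trans h _; rewrite -ltnS prednK.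
  by rewrite (IH m) ?lt // (IH m) ?lt // !mulr0 subrr mulr0 add0r IHl.
by apply: (K 7%N) => //; rewrite n0.
Qed.

Lemma tgt_nilpotent n : (n < 12)%N -> lie_nilpotent (lc (tgt R n)).
Proof.
move=> hn; apply: triangular_nilpotent; first exact: tgt_wf.
by move: n hn => [|[|[|[|[|[|[|[|[|[|[|[|n]]]]]]]]]]]] // _ [|[|[|[|[|[|[|k]]]]]]].
Qed.

(** Conversely to the derivation of [model], trace zero makes [phi1] closed. An example therefore
    only needs parameter values that yield the wanted algebra. *)
Lemma model_calibrated (f1 f2 f3 m11 m12 m13 m21 m22 m23 m31 m32 m33 u2 u3 n22 n23 n32 d0 d1 d2 d3 : R) :
  m11 + m22 + m33 = 0 ->
  calibrated_G2 (lc (model f1 f2 f3 m11 m12 m13 m21 m22 m23 m31 m32 m33 u2 u3 n22 n23 n32 d0 d1 d2 d3)).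
Proof.
move=> tr; have -> : m33 = - m11 - m22 by lra.
apply: closed_phi1_calibrated => x y z t.
by rewrite /phi1 /ev3 !cf_br_lc //=; ring.
Qed.

Ltac numeric_iso S :=
  apply: (@lc_iso _ _ _ S) => //; [by move=> [|[|[|[|[|[|[|?]]]]]]] ? ? // _ /=; ring |
   let x := fresh "x" in let hx := fresh "hx" in move=> x hx;
   have := (hx 0%N isT, hx 1%N isT, hx 2%N isT, hx 3%N isT, hx 4%N isT, hx 5%N isT, hx 6%N isT);
   rewrite /= => -[[[[[[? ?] ?] ?] ?] ?] ?]; clear hx;
   by move=> [|[|[|[|[|[|[|[|?]]]]]]]] //= _; lra].

Lemma tgt_calibrated n : (n < 12)%N -> calibrated_G2 (lc (tgt R n)).
Proof.
move: n => [|[|[|[|[|[|[|[|[|[|[|[|n]]]]]]]]]]]] // _.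
- apply: (@calibrated_iso _ (lc (untwisted 0 0 0 0 0 0 0 0 0))); last by apply: model_calibrated; ring.
  numeric_iso [:: [:: trm1 (1 : R) 1]; [:: trm1 1 2]; [:: trm1 1 3]; [:: trm1 1 4]; [:: trm1 1 5];
    [:: trm1 1 6]; [:: trm1 1 7]].
- apply: (@calibrated_iso _ (lc (untwisted 0 0 0 0 0 1 0 0 0))); last by apply: model_calibrated; ring.
  numeric_iso [:: [:: trm1 (1 : R) 1]; [:: trm1 1 2]; [:: trm1 1 5]; [:: trm1 1 3]; [:: trm1 1 6];
    [:: trm1 1 7]; [:: trm1 1 4]].
- apply: (@calibrated_iso _ (lc (untwisted 0 1 0 0 0 0 0 1 0))); last by apply: model_calibrated; ring.
  numeric_iso [:: [:: trm1 (1 : R) 1]; [:: trm1 1 3]; [:: trm1 1 4]; [:: trm1 1 2]; [:: trm1 1 6];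
    [:: trm1 (- 1) 7; trm1 (- 1) 2]; [:: trm1 1 5]].
- apply: (@calibrated_iso _ (lc (model 1 0 0 0 0 0 1 0 1 0 0 0 0 0 0 0 0 1 0 0 0))); last by apply: model_calibrated; ring.
  numeric_iso [:: [:: trm1 (1 : R) 1]; [:: trm1 1 3]; [:: trm1 1 2]; [:: trm1 1 3; trm1 1 5]; [:: trm1 1 6];
    [:: trm1 1 4]; [:: trm1 (- 1) 7; trm1 (- 1) 2; trm1 1 4]].
- apply: (@calibrated_iso _ (lc (modelB 0 1 0 1 0 0 1 0 0))); last by apply: model_calibrated; ring.
  apply: lie_iso_trans (modelB_nf5 _ _ _ _ _ _ _ _) (nf5_tgt _); rewrite ?oner_eq0 //.
  by rewrite !mul0r mul1r addr0 oppr0 mul0r expr0n !add0r expr1n oner_eq0.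
- apply: (@calibrated_iso _ (lc (model 1 0 0 0 0 0 1 0 1 0 0 0 0 0 0 0 0 0 0 0 0))); last by apply: model_calibrated; ring.
  numeric_iso [:: [:: trm1 (1 : R) 3]; [:: trm1 1 3; trm1 1 5]; [:: trm1 1 1]; [:: trm1 1 6]; [:: trm1 (- 1) 4];
    [:: trm1 1 2]; [:: trm1 2 7]].
- apply: (@calibrated_iso _ (lc (untwisted 0 1 0 0 0 0 0 0 1))); last by apply: model_calibrated; ring.
  numeric_iso [:: [:: trm1 (1 : R) 1]; [:: trm1 1 3]; [:: trm1 1 2]; [:: trm1 1 4]; [:: trm1 1 5];
    [:: trm1 (- 1) 7]; [:: trm1 1 6]].
- apply: (@calibrated_iso _ (lc (untwisted 0 1 0 0 0 1 0 0 0))); last by apply: model_calibrated; ring.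
  numeric_iso [:: [:: trm1 (1 : R) 1]; [:: trm1 1 3]; [:: trm1 1 2]; [:: trm1 1 5]; [:: trm1 (- 1) 4];
    [:: trm1 1 6]; [:: trm1 1 7]].
- apply: (@calibrated_iso _ (lc (untwisted 0 1 0 0 1 1 0 0 0))); last by apply: model_calibrated; ring.
  numeric_iso [:: [:: trm1 (1 : R) 1]; [:: trm1 1 3]; [:: trm1 1 4]; [:: trm1 1 2]; [:: trm1 1 5];
    [:: trm1 1 6]; [:: trm1 1 7]].
- apply: (@calibrated_iso _ (lc (untwisted 0 1 0 0 (-1) 1 0 0 0))); last by apply: model_calibrated; ring.
  numeric_iso [:: [:: trm1 (1 : R) 1]; [:: trm1 1 4]; [:: trm1 (- 2) 3]; [:: trm1 (- 1) 5]; [:: trm1 (- 2) 2];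
    [:: trm1 (- 1) 7]; [:: trm1 (- 2) 6]].
- apply: (@calibrated_iso _ (lc (modelB 0 1 0 0 0 1 0 1 0))); last by apply: model_calibrated; ring.
  have i := @modelB_nf11 R 0 1 0 0 0 1 1 0 (oner_neq0 _) (oner_neq0 _) (oner_neq0 _).
  rewrite (_ : nf11_v 0 1 0 0 0 1 1 0 = 0) in i; last by rewrite /nf11_v; field.
  exact: lie_iso_trans i (nf11_tgt10 R).
apply: (@calibrated_iso _ (lc (modelB 0 1 0 0 0 1 0 1 1))); last by apply: model_calibrated; ring.
have i := @modelB_nf11 R 0 1 0 0 0 1 1 1 (oner_neq0 _) (oner_neq0 _) (oner_neq0 _).
rewrite (_ : nf11_v 0 1 0 0 0 1 1 1 = -1) in i; last by rewrite /nf11_v; field.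
by apply: lie_iso_trans i (nf11_tgt11 _); rewrite oppr_eq0 oner_eq0.
Qed.

Theorem L12_examples (n : 'I_12) :
  is_lie (L12 R n) /\ lie_nilpotent (L12 R n) /\ calibrated_G2 (L12 R n).
Proof.
have i : lie_iso (lc (tgt R n)) (L12 R n) by apply: lie_iso_ext => a b k; rewrite L12_tgt.
split; first exact: is_lie_iso i (tgt_is_lie (ltn_ord n)).
split; first exact: nilpotent_iso i (tgt_nilpotent (ltn_ord n)).
exact: calibrated_iso i (tgt_calibrated (ltn_ord n)).
Qed.

End Examples.

(** * Isomorphism invariants *)

Section SpanDimension.
Variable R : fieldType.
Implicit Types (S : 'rV[R]_7 -> Prop) (c : sconst R).

(** The dimension of the span of a predicate without forming the span: [V] is a basis of the least
    row space containing [S]. *)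
Definition span_dim S (k : nat) := exists V : 'M[R]_(k, 7), [/\ row_free V,
  (forall v, S v -> (v <= V)%MS) &
  forall W : 'M[R]_7, (forall v, S v -> (v <= W)%MS) -> (V <= W)%MS].

Lemma span_dim_uniq S k l : span_dim S k -> span_dim S l -> k = l.
Proof.
move=> [V [fV hV mV]] [W [fW hW mW]].
have VW : (V <= <<W>>)%MS by apply: mV => v /hW; rewrite genmxE.
have WV : (W <= <<V>>)%MS by apply: mW => v /hV; rewrite genmxE.
rewrite !genmxE in VW WV; move: fV fW; rewrite /row_free => /eqP <- /eqP <-.
by apply/eqP; rewrite eqn_leq !mxrankS.
Qed.

Lemma span_dim_iso (T : sconst R -> 'rV[R]_7 -> Prop) c1 c2 k :
  (forall c c' A, A \in unitmx -> (forall x y, br c' (x *m A) (y *m A) = br c x y *m A) ->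
     forall v, T c v -> T c' (v *m A)) ->
  lie_iso c1 c2 -> span_dim (T c1) k -> span_dim (T c2) k.
Proof.
move=> hT [A [uA hA]] [V [fV hV mV]].
have uB : invmx A \in unitmx by rewrite unitmx_inv.
have hB x y : br c1 (x *m invmx A) (y *m invmx A) = br c2 x y *m invmx A.
  by rewrite -{2}(mulmxKV uA x) -{2}(mulmxKV uA y) hA mulmxK.
exists (V *m A); split.
- by rewrite /row_free mxrankMfree // row_free_unit.
- by move=> v /(hT _ _ _ uB hB) /hV h; rewrite -(mulmxKV uA v) submxMr.
- move=> W hW; have : (V <= W *m invmx A)%MS.
    by apply: mV => v /(hT _ _ _ uA hA) /hW h; rewrite -(mulmxK uA v) submxMr.
  by move=> h; rewrite -(mulmxKV uA W) submxMr.
Qed.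

(** The basis vectors carry a minus sign because a bracket is minus the value of the
    differentials. *)
Lemma span_dim_std S (s : seq nat) : uniq s -> all (fun k => 0 < k < 8)%N s ->
  (forall v k, S v -> (0 < k < 8)%N -> k \notin s -> cf v k = 0) ->
  (forall k, k \in s -> S (- vec (fun n => (n == k)%:R))) -> span_dim S (size s).
Proof.
move=> us ws h0 hs; pose V : 'M[R]_(size s, 7) := \matrix_(i, j) (j.+1 == nth 0%N s i)%:R.
have VE (u : 'rV_(size s)) (i : 'I_(size s)) (k : 'I_7) : k.+1 = nth 0%N s i -> (u *m V) 0 k = u 0 i.
  move=> hk; rewrite mxE (bigD1 i) //= mxE hk eqxx mulr1 big1 ?addr0 // => j ji.
  rewrite mxE hk nth_uniq // (_ : (_ == _ :> nat) = false) ?mulr0 //.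
  by rewrite eq_sym; apply/negbTE.
have V0 (u : 'rV_(size s)) (k : 'I_7) : k.+1 \notin s -> (u *m V) 0 k = 0.
  move=> hk; rewrite mxE big1 // => j _; rewrite mxE.
  case: eqP => [e|_]; last by rewrite mulr0.
  by move: hk; rewrite e mem_nth.
have ix (i : 'I_(size s)) : exists k : 'I_7, k.+1 = nth 0%N s i.
  have /andP[k0 k8] := allP ws _ (mem_nth 0%N (ltn_ord i)).
  have k7 : ((nth 0%N s i).-1 < 7)%N by rewrite -ltnS prednK.
  by exists (Ordinal k7); rewrite /= prednK.
exists V; split.
- apply/row_freeP; exists V^T; apply/row_matrixP => i; rewrite row_mul.
  apply/rowP => j; rewrite !mxE; have [k hk] := ix j.
  rewrite (bigD1 k) //= !mxE hk eqxx mulr1 big1 ?addr0; last first.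
    by move=> k' kk'; rewrite !mxE -hk eqSS ?val_eqE (negPf kk') mulr0.
  by rewrite nth_uniq // eq_sym.
- move=> v Sv; apply/submxP; exists (\row_i cf v (nth 0%N s i)); apply/rowP => k.
  rewrite cf_row; case: (boolP (k.+1 \in s)) => hk; last by rewrite V0 // (h0 v) //= ltnS.
  have hi : (index k.+1 s < size s)%N by rewrite index_mem.
  by rewrite (VE _ (Ordinal hi)) /= ?nth_index // mxE /= nth_index.
- move=> W hW; apply/row_subP => i; have /(scalemx_sub (-1)) := hW _ (hs _ (mem_nth 0%N (ltn_ord i))).
  rewrite scaleN1r opprK.
  by congr (_ <= _)%MS; apply/rowP => k; rewrite !mxE.
Qed.

End SpanDimension.

(** * Dimensions along the lower central series *)

Section Separation.
Variable R : rcfType.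
Implicit Types (c : sconst R).

Definition derived2 c v := exists x y, v = br c x y.
Definition derived3 c v := exists x y z, v = br c x (br c y z).

Lemma derived2_iso k c1 c2 : lie_iso c1 c2 -> span_dim (derived2 c1) k -> span_dim (derived2 c2) k.
Proof.
apply: span_dim_iso => c c' A uA hA v [x [y ->]].
by exists (x *m A), (y *m A); rewrite hA.
Qed.

Lemma derived3_iso k c1 c2 : lie_iso c1 c2 -> span_dim (derived3 c1) k -> span_dim (derived3 c2) k.
Proof.
apply: span_dim_iso => c c' A uA hA v [x [y [z ->]]].
by exists (x *m A), (y *m A), (z *m A); rewrite !hA.
Qed.

Ltac coords := do ?[move=> ?]; apply: cfP => -[|[|[|[|[|[|[|[|?]]]]]]]] // _;
  rewrite ?(cfN, cf0, cfZ) !cf_br_lc ?tgt_wf //= ?cf_br_lc ?tgt_wf //=.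

(** The pairs of [dim2] and [dim3] leave three coincidences, in the numbering from 0: 3, 8, 9, then
    6, 7, then 10, 11. *)
Definition dim2 n := nth 0%N [:: 0; 2; 3; 4; 4; 4; 3; 3; 4; 4; 5; 5]%N n.
Definition dim3 n := nth 0%N [:: 0; 0; 0; 2; 3; 1; 1; 1; 2; 2; 4; 4]%N n.

Lemma span_dim_derived2 d (s : seq nat) : uniq s -> all (fun k => 0 < k < 8)%N s -> all (@wf2 R) d ->
  (forall k x y, (k < 7)%N -> k.+1 \notin s -> ev2 (nth [::] d k) x y = 0) ->
  (forall k, k \in s -> derived2 (lc d) (- vec (fun n => (n == k)%:R))) ->
  span_dim (derived2 (lc d)) (size s).
Proof.
move=> us ws wd h0 hs; apply: span_dim_std => // v [|k] // [x [y ->]] hk ks.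
by rewrite cf_br_lc // h0 ?oppr0.
Qed.

Lemma span_dim_derived3 d (s : seq nat) : uniq s -> all (fun k => 0 < k < 8)%N s -> all (@wf2 R) d ->
  (forall k x y z, (k < 7)%N -> k.+1 \notin s -> ev2 (nth [::] d k) x (bf d y z) = 0) ->
  (forall k, k \in s -> derived3 (lc d) (- vec (fun n => (n == k)%:R))) ->
  span_dim (derived3 (lc d)) (size s).
Proof.
move=> us ws wd h0 hs; apply: span_dim_std => // v [|k] // [x [y [z ->]]] hk ks.
rewrite cf_br_lc // -[RHS]oppr0 -(h0 k (cf x) (cf y) (cf z)) //; congr (- _).
by apply: ev2_ext => //; [exact: wf2_nth | move=> n hn; rewrite cf_br_lc].
Qed.

Lemma tgt_dim2 n : (n < 12)%N -> span_dim (derived2 (lc (tgt R n))) (dim2 n).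
Proof.
move: n => [|[|[|[|[|[|[|[|[|[|[|[|n]]]]]]]]]]]] // _.
- apply: (@span_dim_derived2 _ [::]%N) => //.
    by move=> [|[|[|[|[|[|[|?]]]]]]] ? ? //= _ _; ring.
- apply: (@span_dim_derived2 _ [:: 5; 6]%N) => //.
    by move=> [|[|[|[|[|[|[|?]]]]]]] ? ? //= _ _; ring.
  move=> k; rewrite !inE => /orP[] /eqP ->.
  + by exists (ee R 1), (ee R 2); coords; rewrite ?cf_ee ?cf_vec //=; ring.
  + by exists (ee R 1), (ee R 3); coords; rewrite ?cf_ee ?cf_vec //=; ring.
- apply: (@span_dim_derived2 _ [:: 4; 5; 6]%N) => //.
    by move=> [|[|[|[|[|[|[|?]]]]]]] ? ? //= _ _; ring.
  move=> k; rewrite !inE => /or3P[] /eqP ->.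
  + by exists (ee R 1), (ee R 2); coords; rewrite ?cf_ee ?cf_vec //=; ring.
  + by exists (ee R 1), (ee R 3); coords; rewrite ?cf_ee ?cf_vec //=; ring.
  + by exists (ee R 2), (ee R 3); coords; rewrite ?cf_ee ?cf_vec //=; ring.
- apply: (@span_dim_derived2 _ [:: 3; 5; 6; 7]%N) => //.
    by move=> [|[|[|[|[|[|[|?]]]]]]] ? ? //= _ _; ring.
  move=> k; rewrite !inE => /or4P[] /eqP ->.
  + by exists (ee R 1), (ee R 2); coords; rewrite ?cf_ee ?cf_vec //=; ring.
  + by exists (ee R 2), (ee R 4); coords; rewrite ?cf_ee ?cf_vec //=; ring.
  + by exists (ee R 1), (ee R 4); coords; rewrite ?cf_ee ?cf_vec //=; ring.
  + by exists (ee R 4), (ee R 6); coords; rewrite ?cf_ee ?cf_vec //=; ring.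
- apply: (@span_dim_derived2 _ [:: 3; 5; 6; 7]%N) => //.
    by move=> [|[|[|[|[|[|[|?]]]]]]] ? ? //= _ _; ring.
  move=> k; rewrite !inE => /or4P[] /eqP ->.
  + by exists (ee R 1), (ee R 2); coords; rewrite ?cf_ee ?cf_vec //=; ring.
  + by exists (ee R 1), (ee R 3); coords; rewrite ?cf_ee ?cf_vec //=; ring.
  + by exists (ee R 2), (ee R 4); coords; rewrite ?cf_ee ?cf_vec //=; ring.
  + by exists (ee R 2), (ee R 5); coords; rewrite ?cf_ee ?cf_vec //=; ring.
- apply: (@span_dim_derived2 _ [:: 4; 5; 6; 7]%N) => //.
    by move=> [|[|[|[|[|[|[|?]]]]]]] ? ? //= _ _; ring.
  move=> k; rewrite !inE => /or4P[] /eqP ->.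
  + by exists (ee R 1), (ee R 2); coords; rewrite ?cf_ee ?cf_vec //=; ring.
  + by exists (ee R 2), (ee R 3); coords; rewrite ?cf_ee ?cf_vec //=; ring.
  + by exists (ee R 3), (ee R 1); coords; rewrite ?cf_ee ?cf_vec //=; ring.
  + by exists (2^-1 *: ee R 2), (ee R 6); coords; rewrite ?cfZ ?cf_ee ?cf_vec //=; field.
- apply: (@span_dim_derived2 _ [:: 3; 6; 7]%N) => //.
    by move=> [|[|[|[|[|[|[|?]]]]]]] ? ? //= _ _; ring.
  move=> k; rewrite !inE => /or3P[] /eqP ->.
  + by exists (ee R 1), (ee R 2); coords; rewrite ?cf_ee ?cf_vec //=; ring.
  + by exists (ee R 1), (ee R 3); coords; rewrite ?cf_ee ?cf_vec //=; ring.
  + by exists (ee R 1), (ee R 5); coords; rewrite ?cf_ee ?cf_vec //=; ring.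
- apply: (@span_dim_derived2 _ [:: 3; 6; 7]%N) => //.
    by move=> [|[|[|[|[|[|[|?]]]]]]] ? ? //= _ _; ring.
  move=> k; rewrite !inE => /or3P[] /eqP ->.
  + by exists (ee R 1), (ee R 2); coords; rewrite ?cf_ee ?cf_vec //=; ring.
  + by exists (ee R 1), (ee R 3); coords; rewrite ?cf_ee ?cf_vec //=; ring.
  + by exists (ee R 1), (ee R 4); coords; rewrite ?cf_ee ?cf_vec //=; ring.
- apply: (@span_dim_derived2 _ [:: 4; 5; 6; 7]%N) => //.
    by move=> [|[|[|[|[|[|[|?]]]]]]] ? ? //= _ _; ring.
  move=> k; rewrite !inE => /or4P[] /eqP ->.
  + by exists (ee R 1), (ee R 2); coords; rewrite ?cf_ee ?cf_vec //=; ring.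
  + by exists (ee R 1), (ee R 3); coords; rewrite ?cf_ee ?cf_vec //=; ring.
  + by exists (ee R 1), (ee R 4); coords; rewrite ?cf_ee ?cf_vec //=; ring.
  + by exists (ee R 1), (ee R 5); coords; rewrite ?cf_ee ?cf_vec //=; ring.
- apply: (@span_dim_derived2 _ [:: 4; 5; 6; 7]%N) => //.
    by move=> [|[|[|[|[|[|[|?]]]]]]] ? ? //= _ _; ring.
  move=> k; rewrite !inE => /or4P[] /eqP ->.
  + by exists (ee R 1), (ee R 2); coords; rewrite ?cf_ee ?cf_vec //=; ring.
  + by exists (ee R 1), (ee R 3); coords; rewrite ?cf_ee ?cf_vec //=; ring.
  + by exists (ee R 1), (ee R 4); coords; rewrite ?cf_ee ?cf_vec //=; ring.
  + by exists (ee R 1), (ee R 5); coords; rewrite ?cf_ee ?cf_vec //=; ring.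
- apply: (@span_dim_derived2 _ [:: 3; 4; 5; 6; 7]%N) => //.
    by move=> [|[|[|[|[|[|[|?]]]]]]] ? ? //= _ _; ring.
  move=> k; rewrite !inE => /orP[/eqP ->|/or4P[] /eqP ->].
  + by exists (ee R 1), (ee R 2); coords; rewrite ?cf_ee ?cf_vec //=; ring.
  + by exists (ee R 1), (ee R 3); coords; rewrite ?cf_ee ?cf_vec //=; ring.
  + by exists (ee R 2), (ee R 3); coords; rewrite ?cf_ee ?cf_vec //=; ring.
  + by exists (ee R 1), (ee R 5); coords; rewrite ?cf_ee ?cf_vec //=; ring.
  + by exists (ee R 1), (ee R 6); coords; rewrite ?cf_ee ?cf_vec //=; ring.
- apply: (@span_dim_derived2 _ [:: 3; 4; 5; 6; 7]%N) => //.
    by move=> [|[|[|[|[|[|[|?]]]]]]] ? ? //= _ _; ring.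
  move=> k; rewrite !inE => /orP[/eqP ->|/or4P[] /eqP ->].
  + by exists (ee R 1), (ee R 2); coords; rewrite ?cf_ee ?cf_vec //=; ring.
  + by exists (ee R 1), (ee R 3); coords; rewrite ?cf_ee ?cf_vec //=; ring.
  + by exists (ee R 2), (ee R 3); coords; rewrite ?cf_ee ?cf_vec //=; ring.
  + by exists (ee R 1), (ee R 5); coords; rewrite ?cf_ee ?cf_vec //=; ring.
  + by exists (ee R 1), (ee R 6); coords; rewrite ?cf_ee ?cf_vec //=; ring.
Qed.

Lemma tgt_dim3 n : (n < 12)%N -> span_dim (derived3 (lc (tgt R n))) (dim3 n).
Proof.
move: n => [|[|[|[|[|[|[|[|[|[|[|[|n]]]]]]]]]]]] // _.
- apply: (@span_dim_derived3 _ [::]%N) => //.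
    by move=> [|[|[|[|[|[|[|?]]]]]]] ? ? ? //= _ _; rewrite /bf /=; ring.
- apply: (@span_dim_derived3 _ [::]%N) => //.
    by move=> [|[|[|[|[|[|[|?]]]]]]] ? ? ? //= _ _; rewrite /bf /=; ring.
- apply: (@span_dim_derived3 _ [::]%N) => //.
    by move=> [|[|[|[|[|[|[|?]]]]]]] ? ? ? //= _ _; rewrite /bf /=; ring.
- apply: (@span_dim_derived3 _ [:: 5; 7]%N) => //.
    by move=> [|[|[|[|[|[|[|?]]]]]]] ? ? ? //= _ _; rewrite /bf /=; ring.
  move=> k; rewrite !inE => /orP[] /eqP ->.
  + by exists (ee R 1), (ee R 2), (ee R 1); coords; rewrite ?cf_ee ?cf_vec //=; ring.
  + by exists (ee R 1), (ee R 3), (ee R 1); coords; rewrite ?cf_ee ?cf_vec //=; ring.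
- apply: (@span_dim_derived3 _ [:: 5; 6; 7]%N) => //.
    by move=> [|[|[|[|[|[|[|?]]]]]]] ? ? ? //= _ _; rewrite /bf /=; ring.
  move=> k; rewrite !inE => /or3P[] /eqP ->.
  + by exists (ee R 1), (ee R 2), (ee R 1); coords; rewrite ?cf_ee ?cf_vec //=; ring.
  + by exists (ee R 2), (ee R 2), (ee R 1); coords; rewrite ?cf_ee ?cf_vec //=; ring.
  + by exists (ee R 4), (ee R 1), (ee R 2); coords; rewrite ?cf_ee ?cf_vec //=; ring.
- apply: (@span_dim_derived3 _ [:: 7]%N) => //.
    by move=> [|[|[|[|[|[|[|?]]]]]]] ? ? ? //= _ _; rewrite /bf /=; ring.
  move=> k; rewrite !inE => /eqP ->.
  by exists (2^-1 *: ee R 2), (ee R 1), (ee R 3); coords; rewrite ?cfZ ?cf_ee ?cf_vec //=; field.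
- apply: (@span_dim_derived3 _ [:: 6]%N) => //.
    by move=> [|[|[|[|[|[|[|?]]]]]]] ? ? ? //= _ _; rewrite /bf /=; ring.
  move=> k; rewrite !inE => /eqP ->.
  by exists (ee R 1), (ee R 2), (ee R 1); coords; rewrite ?cf_ee ?cf_vec //=; ring.
- apply: (@span_dim_derived3 _ [:: 6]%N) => //.
    by move=> [|[|[|[|[|[|[|?]]]]]]] ? ? ? //= _ _; rewrite /bf /=; ring.
  move=> k; rewrite !inE => /eqP ->.
  by exists (ee R 1), (ee R 2), (ee R 1); coords; rewrite ?cf_ee ?cf_vec //=; ring.
- apply: (@span_dim_derived3 _ [:: 6; 7]%N) => //.
    by move=> [|[|[|[|[|[|[|?]]]]]]] ? ? ? //= _ _; rewrite /bf /=; ring.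
  move=> k; rewrite !inE => /orP[] /eqP ->.
  + by exists (ee R 1), (ee R 2), (ee R 1); coords; rewrite ?cf_ee ?cf_vec //=; ring.
  + by exists (ee R 1), (ee R 3), (ee R 1); coords; rewrite ?cf_ee ?cf_vec //=; ring.
- apply: (@span_dim_derived3 _ [:: 6; 7]%N) => //.
    by move=> [|[|[|[|[|[|[|?]]]]]]] ? ? ? //= _ _; rewrite /bf /=; ring.
  move=> k; rewrite !inE => /orP[] /eqP ->.
  + by exists (ee R 1), (ee R 2), (ee R 1); coords; rewrite ?cf_ee ?cf_vec //=; ring.
  + by exists (ee R 1), (ee R 3), (ee R 1); coords; rewrite ?cf_ee ?cf_vec //=; ring.
- apply: (@span_dim_derived3 _ [:: 4; 5; 6; 7]%N) => //.
    by move=> [|[|[|[|[|[|[|?]]]]]]] ? ? ? //= _ _; rewrite /bf /=; ring.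
  move=> k; rewrite !inE => /or4P[] /eqP ->.
  + by exists (ee R 1), (ee R 2), (ee R 1); coords; rewrite ?cf_ee ?cf_vec //=; ring.
  + by exists (ee R 2), (ee R 2), (ee R 1); coords; rewrite ?cf_ee ?cf_vec //=; ring.
  + by exists (ee R 1), (ee R 3), (ee R 2); coords; rewrite ?cf_ee ?cf_vec //=; ring.
  + by exists (ee R 1), (ee R 5), (ee R 1); coords; rewrite ?cf_ee ?cf_vec //=; ring.
- apply: (@span_dim_derived3 _ [:: 4; 5; 6; 7]%N) => //.
    by move=> [|[|[|[|[|[|[|?]]]]]]] ? ? ? //= _ _; rewrite /bf /=; ring.
  move=> k; rewrite !inE => /or4P[] /eqP ->.
  + by exists (ee R 1), (ee R 2), (ee R 1); coords; rewrite ?cf_ee ?cf_vec //=; ring.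
  + by exists (ee R 2), (ee R 2), (ee R 1); coords; rewrite ?cf_ee ?cf_vec //=; ring.
  + by exists (ee R 1), (ee R 3), (ee R 2); coords; rewrite ?cf_ee ?cf_vec //=; ring.
  + by exists (ee R 1), (ee R 5), (ee R 1); coords; rewrite ?cf_ee ?cf_vec //=; ring.
Qed.

End Separation.

(** * Centralizer conditions *)

Section Invariants.
Variable R : rcfType.
Implicit Types (c : sconst R).

Definition three_step c := forall x y z w, br c x (br c y (br c z w)) = 0.
(** The centralizer of [g, g]; [in_cent4] below is the centralizer of [g, [g, [g, g]]]. *)
Definition in_cent c x := forall u v, br c x (br c u v) = 0.
Definition cent_abelian c := forall x y, in_cent c x -> in_cent c y -> br c x y = 0.
Definition cent_meets_derived3 c := exists x y u v w,
  [/\ in_cent c x, in_cent c y, br c x y <> 0 & br c x y = br c u (br c v w)].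
Definition in_cent4 c x := forall s t u v, br c x (br c s (br c t (br c u v))) = 0.
Definition cent4_two_step c := forall x y z, in_cent4 c x -> in_cent4 c y -> in_cent4 c z ->
  br c x (br c y z) = 0.

Lemma iso_back c1 c2 (A : 'M[R]_7) : A \in unitmx ->
  (forall x y, br c2 (x *m A) (y *m A) = br c1 x y *m A) ->
  forall x y, br c1 (x *m invmx A) (y *m invmx A) = br c2 x y *m invmx A.
Proof. by move=> uA hA x y; rewrite -{2}(mulmxKV uA x) -{2}(mulmxKV uA y) hA mulmxK. Qed.

Lemma three_step_iso c1 c2 : lie_iso c1 c2 -> three_step c1 -> three_step c2.
Proof.
move=> [A [uA hA]] h x y z w; have hB := iso_back uA hA.
by rewrite -(mulmxKV uA (br _ _ _)) -!hB h mul0mx.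
Qed.

Lemma in_cent_iso c1 c2 (A : 'M[R]_7) : A \in unitmx ->
  (forall x y, br c2 (x *m A) (y *m A) = br c1 x y *m A) ->
  forall x, in_cent c1 x -> in_cent c2 (x *m A).
Proof.
move=> uA hA x h u v.
by rewrite -(mulmxKV uA u) -(mulmxKV uA v) !hA h mul0mx.
Qed.

Lemma in_cent4_iso c1 c2 (A : 'M[R]_7) : A \in unitmx ->
  (forall x y, br c2 (x *m A) (y *m A) = br c1 x y *m A) ->
  forall x, in_cent4 c1 x -> in_cent4 c2 (x *m A).
Proof.
move=> uA hA x h s t u v; rewrite -(mulmxKV uA s) -(mulmxKV uA t).
by rewrite -(mulmxKV uA u) -(mulmxKV uA v) !hA h mul0mx.
Qed.

Lemma cent_abelian_iso c1 c2 : lie_iso c1 c2 -> cent_abelian c1 -> cent_abelian c2.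
Proof.
move=> [A [uA hA]] h x y hx hy; have hB := iso_back uA hA.
have uB : invmx A \in unitmx by rewrite unitmx_inv.
rewrite -(mulmxKV uA (br _ _ _)) -hB h ?mul0mx //; exact: in_cent_iso hB _ _.
Qed.

Lemma cent4_two_step_iso c1 c2 : lie_iso c1 c2 -> cent4_two_step c1 -> cent4_two_step c2.
Proof.
move=> [A [uA hA]] h x y z hx hy hz; have hB := iso_back uA hA.
have uB : invmx A \in unitmx by rewrite unitmx_inv.
rewrite -(mulmxKV uA (br _ _ _)) -!hB h ?mul0mx //; exact: in_cent4_iso hB _ _.
Qed.

Lemma cent_meets_derived3_iso c1 c2 : lie_iso c1 c2 -> cent_meets_derived3 c1 -> cent_meets_derived3 c2.
Proof.
move=> [A [uA hA]] [x [y [u [v [w [hx hy xy0 xy]]]]]].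
exists (x *m A), (y *m A), (u *m A), (v *m A), (w *m A); split.
- exact: in_cent_iso hx.
- exact: in_cent_iso hy.
- by rewrite hA => h; apply: xy0; rewrite -(mulmxK uA (br c1 x y)) h mul0mx.
- by rewrite !hA xy.
Qed.

Ltac coord := rewrite ?(cfN, cf0, cfZ); do 4?[rewrite !cf_br_lc ?tgt_wf //=].
Ltac allcoords := apply: cfP => -[|[|[|[|[|[|[|[|?]]]]]]]] // _; coord.

Lemma tgt3_four_step : ~ three_step (lc (tgt R 3)).
Proof.
move=> /(_ (ee R 1) (ee R 1) (ee R 1) (ee R 2)) /(congr1 (fun v => cf v 7)); coord.
by rewrite !cf_ee //= => h; lra.
Qed.

Lemma tgt8_three_step : three_step (lc (tgt R 8)).
Proof. move=> x y z w; allcoords; ring. Qed.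

Lemma tgt9_three_step : three_step (lc (tgt R 9)).
Proof. move=> x y z w; allcoords; ring. Qed.

Lemma tgt8_cent : cent_abelian (lc (tgt R 8)).
Proof.
have K x : in_cent (lc (tgt R 8)) x -> cf x 1 = 0.
  move=> /(_ (ee R 1) (ee R 2)) /(congr1 (fun v => cf v 6)); coord.
  by rewrite !cf_ee //= => h; lra.
by move=> x y /K x1 /K y1; allcoords; rewrite ?x1 ?y1; ring.
Qed.

Lemma tgt9_cent : ~ cent_abelian (lc (tgt R 9)).
Proof.
have K k : (1 < k < 4)%N -> in_cent (lc (tgt R 9)) (ee R k).
  by move=> hk u v; move: k hk => [|[|[|[|k]]]] // _; allcoords; rewrite ?cf_ee //=; ring.
move=> /(_ (ee R 2) (ee R 3) (K 2%N isT) (K 3%N isT)) /(congr1 (fun v => cf v 6)); coord.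
by rewrite !cf_ee //= => h; lra.
Qed.

Lemma tgt6_meets : cent_meets_derived3 (lc (tgt R 6)).
Proof.
exists (ee R 2), (ee R 4), (ee R 1), (ee R 2), (ee R 1); split.
- by move=> u v; allcoords; rewrite ?cf_ee //=; ring.
- by move=> u v; allcoords; rewrite ?cf_ee //=; ring.
- move=> /(congr1 (fun v => cf v 6)); coord.
  by rewrite !cf_ee //= => h; lra.
- by allcoords; rewrite ?cf_ee //=; ring.
Qed.

Lemma tgt7_meets : ~ cent_meets_derived3 (lc (tgt R 7)).
Proof.
have K x : in_cent (lc (tgt R 7)) x -> cf x 1 = 0.
  move=> /(_ (ee R 1) (ee R 2)) /(congr1 (fun v => cf v 6)); coord.
  by rewrite !cf_ee //= => h; lra.
move=> [x [y [u [v [w [/K x1 /K y1 xy0 xy]]]]]]; apply: xy0.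
have := congr1 (fun v => cf v 7) xy; coord => h7.
by allcoords; rewrite ?x1 ?y1 in h7 *; try ring; rewrite h7; ring.
Qed.

Lemma tgt10_cent4 : cent4_two_step (lc (tgt R 10)).
Proof.
have K x : in_cent4 (lc (tgt R 10)) x -> cf x 1 = 0.
  move=> /(_ (ee R 1) (ee R 2) (ee R 2) (ee R 1)) /(congr1 (fun v => cf v 7)); coord.
  by rewrite !cf_ee //= => h; lra.
by move=> x y z /K x1 /K y1 /K z1; allcoords; rewrite ?x1 ?y1 ?z1; ring.
Qed.

Lemma tgt11_cent4 : ~ cent4_two_step (lc (tgt R 11)).
Proof.
have K k : (1 < k < 4)%N -> in_cent4 (lc (tgt R 11)) (ee R k).
  by move=> hk s t u v; move: k hk => [|[|[|[|k]]]] // _; allcoords; rewrite ?cf_ee //=; ring.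
move=> /(_ (ee R 2) (ee R 2) (ee R 3) (K 2%N isT) (K 2%N isT) (K 3%N isT)) /(congr1 (fun v => cf v 7)); coord.
by rewrite !cf_ee //= => h; lra.
Qed.

(** Among the coincidences, 3 is not three-step while 8 and 9 are. In the other cases the relevant
    centralizer is the hyperplane e^1 = 0: it is abelian for 8 but not for 9; its brackets meet [g,
    [g, g]] nontrivially for 6 but not for 7; and [e_2, [e_2, e_3]] is nonzero in it for 11, while
    it is two-step for 10. *)
Theorem L12_distinct (n m : 'I_12) : lie_iso (L12 R n) (L12 R m) -> n = m.
Proof.
have it (k : nat) : lie_iso (lc (tgt R k)) (L12 R k) by apply: lie_iso_ext => a b l; rewrite L12_tgt.
move=> h; have {h}i : lie_iso (lc (tgt R n)) (lc (tgt R m)).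
  exact: lie_iso_trans (it n) (lie_iso_trans h (lie_iso_sym (it m))).
have e2 : dim2 n = dim2 m.
  exact: span_dim_uniq (derived2_iso i (tgt_dim2 R (ltn_ord n))) (tgt_dim2 R (ltn_ord m)).
have e3 : dim3 n = dim3 m.
  exact: span_dim_uniq (derived3_iso i (tgt_dim3 R (ltn_ord n))) (tgt_dim3 R (ltn_ord m)).
have j := lie_iso_sym i; apply/val_inj.
have n38 : ~ lie_iso (lc (tgt R 8)) (lc (tgt R 3)).
  by move=> k; apply: tgt3_four_step; apply: three_step_iso k tgt8_three_step.
have n39 : ~ lie_iso (lc (tgt R 9)) (lc (tgt R 3)).
  by move=> k; apply: tgt3_four_step; apply: three_step_iso k tgt9_three_step.
have n89 : ~ lie_iso (lc (tgt R 8)) (lc (tgt R 9)).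
  by move=> k; apply: tgt9_cent; apply: cent_abelian_iso k tgt8_cent.
have n67 : ~ lie_iso (lc (tgt R 6)) (lc (tgt R 7)).
  by move=> k; apply: tgt7_meets; apply: cent_meets_derived3_iso k tgt6_meets.
have n1011 : ~ lie_iso (lc (tgt R 10)) (lc (tgt R 11)).
  by move=> k; apply: tgt11_cent4; apply: cent4_two_step_iso k tgt10_cent4.
clear it; move: i j e2 e3.
have : (n < 12)%N by []; have : (m < 12)%N by [].
case: n m => n /= _ [m /= _].
by move: n m => [|[|[|[|[|[|[|[|[|[|[|[|n]]]]]]]]]]]] [|[|[|[|[|[|[|[|[|[|[|[|m]]]]]]]]]]]] // _ _ i j.
Qed.

End Invariants.

Theorem theorem4p3 (R : rcfType) :
  (forall n : 'I_12,
      is_lie (L12 R n) /\ lie_nilpotent (L12 R n) /\ calibrated_G2 (L12 R n)) /\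
  (forall c : sconst R,
      is_lie c -> lie_nilpotent c -> calibrated_G2 c ->
      exists n : 'I_12, lie_iso c (L12 R n)) /\
  (forall n m : 'I_12, lie_iso (L12 R n) (L12 R m) -> n = m).
Proof.
split; first exact: L12_examples.
split=> [c|n m]; [exact: calibrated_class | exact: L12_distinct].
Qed.
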